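(* Let $n\geq 2$ and let $\phi : M^n \rightarrow \mathbb{C}^{n}$ be a closed Lagrangian homothetic soliton for the inverse mean curvature flow. If the sectional curvature $K$ of $M^n$ is constant then $M^n$ is, up to dilations, the immersion of $\mathbb{S}^1 \times \cdots \times \mathbb{S}^1$ ($n$ factors) in $\mathbb{R}^{2n}\equiv\mathbb{C}^n$ as the product of $n$ circles.
   Context: Let $\phi : M^n \to \mathbb{R}^m$ be an isometric immersion of an $n$-dimensional manifold in Euclidean $m$-space, with second fundamental form $\sigma$ and nonvanishing mean curvature vector $H=\mathrm{trace}\,\sigma$ (not divided by $n$). $\phi$ is called a homothetic soliton for the inverse mean curvature flow if there is a real constant $a\neq 0$ with $-\frac{H}{|H|^2}=a\,\phi^\bot$, where $\phi^\bot$ is the projection of the position vector $\phi$ onto the normal bundle of $M$. This condition is invariant under dilations $\phi\mapsto\rho\phi$, $\rho>0$. Closed means compact without boundary. An immersion $\phi:M^n\to\mathbb{R}^{2n}\equiv\mathbb{C}^n$ is Lagrangian if $\phi^*\omega=0$, where $\omega(\cdot,\cdot)=\langle J\cdot,\cdot\rangle$ is the Kaehler two-form and $J$ is the complex structure of $\mathbb{C}^n$. Here $\mathbb{S}^1\subset\mathbb{C}$ is the unit circle centered at the origin, and the product of $n$ circles is the inclusion $\mathbb{S}^1\times\cdots\times\mathbb{S}^1\hookrightarrow\mathbb{C}\times\cdots\times\mathbb{C}=\mathbb{C}^n$.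
   Formalization: M is taken connected, and ''is, up to dilations, the product of n circles'' is read up to a unitary map of C^n and a covering of M onto the torus; without this it fails, e.g. for (z_1^2, z_2), for unitary images of the torus, or for two disjoint rotated tori. *)

(* Defs.v *)
From mathcomp Require Import all_boot all_order all_algebra.
From mathcomp Require Import all_classical all_reals all_analysis.
Import Order.TTheory GRing.Theory Num.Theory numFieldNormedType.Exports.

Set Implicit Arguments.
Unset Strict Implicit.
Unset Printing Implicit Defensive.

Local Open Scope classical_set_scope.
Local Open Scope ring_scope.

Section SmoothMaps.
Context {R : realType} {n : nat} {V : normedModType R}.
Implicit Types (f : 'rV[R]_n -> V) (U : set 'rV[R]_n).

Definition partial (i : 'I_n) f : 'rV[R]_n -> V :=
  fun x => 'D_(delta_mx 0 i) f x.

(* For U open, this says that f is of class C^oo on U: since all the iterated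
   partial derivatives are differentiable on U, they are continuous there. *)
Definition smooth_on U f :=
  forall s : seq 'I_n, forall x, U x -> differentiable (foldr partial f s) x.

End SmoothMaps.

(* chart_map and chart_inv are total functions, but only their restrictions to
   chart_dom and chart_map @` chart_dom are meaningful. *)
Record chart (R : realType) (n : nat) (M : topologicalType) := Chart {
  chart_dom : set M;
  chart_map : M -> 'rV[R]_n;
  chart_inv : 'rV[R]_n -> M;
  chart_dom_open : open chart_dom;
  chart_cod_open : open (chart_map @` chart_dom);
  chart_mapK : forall p, chart_dom p -> chart_inv (chart_map p) = p;
  chart_map_continuous : {within chart_dom, continuous chart_map};
  chart_inv_continuous :
    {within chart_map @` chart_dom, continuous chart_inv} }.

Record smooth_atlas (R : realType) (n : nat) (M : topologicalType) := Atlas {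
  charts : set (chart R n M);
  charts_cover : forall p, exists2 c, charts c & chart_dom c p;
  charts_compatible : forall c d, charts c -> charts d ->
    smooth_on (chart_map c @` (chart_dom c `&` chart_dom d))
              (chart_map d \o chart_inv c) }.

(* Manifolds are connected and nonempty; note that set0 satisfies
   [connected]. Second countability follows from compactness. *)
Definition closed_manifold (R : realType) (n : nat) (M : topologicalType)
    (A : smooth_atlas R n M) :=
  [/\ hausdorff_space M, compact [set: M], connected [set: M]
    & [set: M] !=set0].

Definition dot {R : realType} {m : nat} (u v : 'rV[R]_m) : R :=
  (u *m v^T) 0 0.

Section LocalImmersion.
Context {R : realType} {n m : nat}.
Implicit Types (f : 'rV[R]_n -> 'rV[R]_m) (x : 'rV[R]_n) (v : 'rV[R]_m).

Definition frame f x : 'M[R]_(n, m) := \matrix_(i < n) partial i f x.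

Definition induced_metric f x : 'M[R]_n := frame f x *m (frame f x)^T.

Definition tangent_part f x v : 'rV[R]_m :=
  v *m (frame f x)^T *m invmx (induced_metric f x) *m frame f x.

Definition normal_part f x v : 'rV[R]_m := v - tangent_part f x v.

(* sigma(d_i, d_j): the Euclidean derivative of d_j f along d_i, projected to
   the normal space. *)
Definition second_form f x (i j : 'I_n) : 'rV[R]_m :=
  normal_part f x (partial i (partial j f) x).

Definition mean_curvature f x : 'rV[R]_m :=
  \sum_(i < n) \sum_(j < n)
    invmx (induced_metric f x) i j *: second_form f x i j.

End LocalImmersion.

Section Curvature.
Context {R : realType} {n : nat}.
Variable G : 'rV[R]_n -> 'M[R]_n.

(* Gamma^k_ij, for the metric with matrix G in coordinates *)
Definition christoffel (k i j : 'I_n) (x : 'rV[R]_n) : R :=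
  2^-1 * \sum_(l < n) invmx (G x) k l *
    (partial i (fun y => G y j l) x + partial j (fun y => G y i l) x
     - partial l (fun y => G y i j) x).

(* The l-th component of R(d_i, d_j) d_k, where
   R(X, Y) Z = nabla_X nabla_Y Z - nabla_Y nabla_X Z - nabla_[X, Y] Z. *)
Definition riemann (i j k l : 'I_n) (x : 'rV[R]_n) : R :=
  partial i (christoffel l j k) x - partial j (christoffel l i k) x
  + \sum_(h < n) (christoffel h j k x * christoffel l i h x
                  - christoffel h i k x * christoffel l j h x).

Definition curvature_op (x u v w : 'rV[R]_n) : 'rV[R]_n :=
  \row_(l < n) \sum_(i < n) \sum_(j < n) \sum_(k < n)
    u 0 i * v 0 j * w 0 k * riemann i j k l x.

Definition metric_dot (x u v : 'rV[R]_n) : R := (u *m G x *m v^T) 0 0.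

Definition sectional_curvature (x u v : 'rV[R]_n) : R :=
  metric_dot x (curvature_op x u v v) u
  / (metric_dot x u u * metric_dot x v v - metric_dot x u v ^+ 2).

End Curvature.

Section Immersions.
Context {R : realType} {n m : nat} {M : topologicalType}.
Variables (A : smooth_atlas R n M) (phi : M -> 'rV[R]_m).

Definition in_charts (P : ('rV[R]_n -> 'rV[R]_m) -> 'rV[R]_n -> Prop) :=
  forall c p, charts A c -> chart_dom c p ->
    P (phi \o chart_inv c) (chart_map c p).

Definition smooth_map :=
  forall c, charts A c ->
    smooth_on (chart_map c @` chart_dom c) (phi \o chart_inv c).

Definition immersion := smooth_map /\ in_charts (fun f x => row_free (frame f x)).

Definition imcf_homothetic_soliton :=
  in_charts (fun f x => mean_curvature f x != 0) /\
  exists2 a : R, a != 0 &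
    in_charts (fun f x =>
      let H := mean_curvature f x in
      - ((dot H H)^-1 *: H) = a *: normal_part f x (f x)).

(* M carries the metric induced by phi. *)
Definition constant_sectional_curvature :=
  exists K : R, in_charts (fun f x => forall u v : 'rV[R]_n,
    row_free (col_mx u v) -> sectional_curvature (induced_metric f) x u v = K).

End Immersions.

(* C^n is R^(n + n), with z = x + i y encoded as row_mx x y. *)
Section ComplexSpace.
Context {R : realType} {n : nat}.

Definition Jmap (z : 'rV[R]_(n + n)) : 'rV[R]_(n + n) :=
  row_mx (- rsubmx z) (lsubmx z).

Definition omega (z w : 'rV[R]_(n + n)) : R := dot (Jmap z) w.

Definition lagrangian {M : topologicalType} (A : smooth_atlas R n M)
    (phi : M -> 'rV[R]_(n + n)) :=
  in_charts A phi (fun f x => forall i j : 'I_n,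
    omega (partial i f x) (partial j f x) = 0).

(* z |-> z *m U is orthogonal and complex linear, i.e., in U(n). *)
Definition unitary_map (U : 'M[R]_(n + n)) :=
  U *m U^T = 1%:M /\ forall z, Jmap (z *m U) = Jmap z *m U.

Definition product_of_circles : set 'rV[R]_(n + n) :=
  [set z | forall j : 'I_n, lsubmx z 0 j ^+ 2 + rsubmx z 0 j ^+ 2 = 1].

End ComplexSpace.

(* p is a covering map from X onto the subspace T of Y: the sheets W i over the
   evenly covered open subset V `&` T of T are the images of continuous local
   sections of p. *)
Definition covering_map_onto (X Y : topologicalType) (T : set Y) (p : X -> Y) :=
  [/\ continuous p, p @` [set: X] = T &
    forall y, T y -> exists V : set Y, [/\ open V, V y &
      exists (I : Type) (W : I -> set X),
        [/\ forall i, open (W i), trivIset [set: I] W,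
            p @^-1` V = \bigcup_i W i &
            forall i, exists s : Y -> X,
              [/\ {within V `&` T, continuous s},
                  s @` (V `&` T) = W i &
                  forall z, (V `&` T) z -> p (s z) = z]]]].

(* Main.v *)
Require Import Defs.
From mathcomp Require Import all_boot all_order all_algebra.
From mathcomp Require Import all_classical all_reals all_analysis.
From mathcomp Require Import ring lra complex.
Import Order.TTheory GRing.Theory Num.Theory numFieldNormedType.Exports.

Set Implicit Arguments.
Unset Strict Implicit.
Unset Printing Implicit Defensive.

Local Open Scope classical_set_scope.
Local Open Scope ring_scope.

(* In a chart, the Laplacian of |phi|^2 is 2 (n + <H, phi>), and the soliton equation makes <H, phi>
   constant. Comparing a maximum and a minimum of |phi|^2 gives <H, phi> = - n, and then the strong
   maximum principle shows that |phi| is constant: phi is normal and H = - N phi with N = n / |phi|^2.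
   Hence J phi is tangent, and sigma(J phi, -) is the identity up to J; as n >= 2, the Gauss equation
   forces the constant curvature to vanish, i.e., the matrices of the cubic form commute. Together with
   the trace condition this makes the cubic form parallel, so that the complex linear extensions L_i of
   the shape operators satisfy d_m L_i = sum_l Gamma^l_mi L_l as maps of C^n. Simultaneous
   diagonalization at one point therefore splits C^n orthogonally into complex lines which stay invariant
   under all L_i, and on each of them the projection of phi has constant norm. So phi maps M, up to
   a unitary map and a dilation, into a product of n unit circles; being an immersion between closed
   manifolds of the same dimension, it is a covering map onto this product. *)

(** * Calculus on matrices *)

(** Through [J] the second fundamental form becomes a product on each tangent space: total symmetry
    of the cubic form makes it commutative, and J phi is its unit. The Gauss term of a plane
    measures a failure of associativity and vanishes on planes through the unit, so constant
    curvature forces associativity. The lines of the splitting are spanned by joint eigenvectors of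
    the multiplications, and the unit is what separates their joint eigenvalues. The multiplications
    depend on the chart, and no global frame is at hand. What passes from chart to chart is the
    identity N |E_j phi|^2 = 1 for fixed projections E_j onto complex lines of C^n: it follows from
    the commutation of the E_j with all L_i, and when it holds near a point it gives this
    commutation back. Inside a chart the commutators [L_i, E_j] solve a linear homogeneous equation
    along segments. All |E_j phi| equal N^(-1/2), so one dilation suffices. A covering map is the
    natural conclusion because finite covers of the torus are solitons too. *)

Section Calculus.
Context {R : realType}.

Lemma differentiable_mx (V : normedModType R) m n (M : V -> 'M[R]_(m, n)) x :
  (forall i j, differentiable (fun y => M y i j) x) -> differentiable M x.
Proof.
move=> dM.
have -> : M = \sum_(i < m) \sum_(j < n) (fun y => M y i j *: delta_mx i j).
  apply/funext => y; rewrite [LHS]matrix_sum_delta fct_sumE.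
  by apply: eq_bigr => i _; rewrite fct_sumE.
by do 2 (apply: differentiable_sum => ?); exact: differentiableZl.
Qed.

Lemma differentiable_entry (V : normedModType R) m n (M : V -> 'M[R]_(m, n)) x i j :
  differentiable M x -> differentiable (fun y => M y i j) x.
Proof.
move=> dM.
exact: (@differentiable_comp _ _ _ _ M (fun N : 'M[R]_(m, n) => N i j) x dM
  (differentiable_coord _ _ _)).
Qed.

Lemma differentiable_mulmx (V : normedModType R) m n p (A : V -> 'M[R]_(m, n))
    (B : V -> 'M[R]_(n, p)) x :
  differentiable A x -> differentiable B x ->
  differentiable (fun y => A y *m B y) x.
Proof.
move=> dA dB; apply: differentiable_mx => i j.
have -> : (fun y => (A y *m B y) i j)
    = \sum_(k < n) ((fun y => A y i k) * (fun y => B y k j)).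
  by apply/funext => y; rewrite mxE fct_sumE.
by apply: differentiable_sum => k; apply: differentiableM;
  exact: differentiable_entry.
Qed.

Lemma differentiable_trmx (V : normedModType R) m n (A : V -> 'M[R]_(m, n)) x :
  differentiable A x -> differentiable (fun y => (A y)^T) x.
Proof.
move=> dA; apply: differentiable_mx => i j.
have -> : (fun y => (A y)^T i j) = (fun y => A y j i).
  by apply/funext => y; rewrite mxE.
exact: differentiable_entry.
Qed.

Lemma is_derive_entry (V : normedModType R) m n (A : V -> 'M[R]_(m, n)) x v dA i j :
  is_derive x v A dA -> is_derive x v (fun y => A y i j) (dA i j).
Proof.
move=> [ex <-]; split; first by move/derivable_mxP: ex; exact.
by rewrite derive_mx // mxE.
Qed.

Lemma is_derive_mx (V : normedModType R) m n (A : V -> 'M[R]_(m, n)) x v (dA : 'M[R]_(m, n)) :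
  (forall i j, is_derive x v (fun y => A y i j) (dA i j)) -> is_derive x v A dA.
Proof.
move=> h; have ex : derivable A x v by apply/derivable_mxP => i j; have [] := h i j.
split=> //; rewrite derive_mx //; apply/matrixP => i j; rewrite mxE.
by have [] := h i j.
Qed.

Lemma is_derive_mulmx (V : normedModType R) m n p (A : V -> 'M[R]_(m, n))
    (B : V -> 'M[R]_(n, p)) x v dA dB :
  is_derive x v A dA -> is_derive x v B dB ->
  is_derive x v (fun y => A y *m B y) (dA *m B x + A x *m dB).
Proof.
move=> hA hB; apply: is_derive_mx => i j.
have -> : (fun y => (A y *m B y) i j)
    = \sum_(k < n) ((fun y => A y i k) * (fun y => B y k j)).
  by apply/funext => y; rewrite mxE fct_sumE.
have hk k : is_derive x v ((fun y => A y i k) * (fun y => B y k j))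
    (A x i k *: dB k j + B x k j *: dA i k).
  by apply: is_deriveM; exact: is_derive_entry.
apply: is_derive_eq; rewrite !mxE -big_split /=; apply: eq_bigr => k _.
by rewrite addrC [dA i k * _]mulrC.
Qed.

Lemma is_derive_trmx (V : normedModType R) m n (A : V -> 'M[R]_(m, n)) x v dA :
  is_derive x v A dA -> is_derive x v (fun y => (A y)^T) dA^T.
Proof.
move=> hA; apply: is_derive_mx => i j.
have -> : (fun y => (A y)^T i j) = (fun y => A y j i).
  by apply/funext => y; rewrite mxE.
by rewrite mxE; exact: is_derive_entry.
Qed.

Lemma differentiable_prod (V : normedModType R) n (f : 'I_n -> V -> R) x :
  (forall i, differentiable (f i) x) ->
  differentiable (fun y => \prod_(i < n) f i y) x.
Proof.
elim: n f => [|n IH] f df.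
  have -> : (fun y => \prod_(i < 0) f i y) = cst 1.
    by apply/funext => y; rewrite big_ord0.
  exact: differentiable_cst.
have -> : (fun y => \prod_(i < n.+1) f i y)
    = f ord0 * (fun y => \prod_(i < n) f (lift ord0 i) y).
  by apply/funext => y; rewrite big_ord_recl.
by apply: differentiableM => //; apply: IH.
Qed.

Lemma differentiable_bigsum (V : normedModType R) (I : finType) (W : normedModType R) (f : I -> V -> W) x :
  (forall i, differentiable (f i) x) ->
  differentiable (fun y => \sum_(i : I) f i y) x.
Proof.
move=> df; rewrite -[X in differentiable X _]/(fun y => _).
have -> : (fun y => \sum_i f i y) = \sum_i f i by apply/funext => y; rewrite fct_sumE.
by elim/big_ind : _ => // [g h dg dh]; exact: differentiableD.
Qed.

Lemma differentiable_det (V : normedModType R) n (A : V -> 'M[R]_n) x :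
  differentiable A x -> differentiable (fun y => \det (A y)) x.
Proof.
move=> dA; apply: differentiable_bigsum => s.
apply: differentiableM; first exact: differentiable_cst.
by apply: differentiable_prod => i; exact: differentiable_entry.
Qed.

Lemma near_eq_differentiable (V W : normedModType R) (f g : V -> W) x :
  (\near x, f x = g x) -> differentiable f x -> differentiable g x.
Proof.
move=> fg df.
have gE : g \o shift x = cst (g x) + 'd f x +o_ (0 : V) id.
  apply/eqaddoP => e e0.
  have /diff_locally/eqaddoP /(_ e e0) := df.
  have := fg; rewrite (near_shift 0) subr0 => fg0.
  apply: filterS2 fg0 => y /= fgy.
  by rewrite -![(_ - _) y]/(_ - _) /= fgy (nbhs_singleton fg).
have cf := diff_continuous df.
have dE := diff_unique cf gE.
by apply/diff_locallyP; rewrite dE.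
Qed.

Lemma unitmx_nbhs (V : normedModType R) n (A : V -> 'M[R]_n) x :
  differentiable A x -> A x \in unitmx -> \forall y \near x, A y \in unitmx.
Proof.
rewrite unitmxE unitfE => dA nz.
have cdet : {for x, continuous (fun y => \det (A y))}.
  exact/differentiable_continuous/differentiable_det.
have : \forall y \near x, \det (A y) != 0 by exact: (cvgr_neq0 _ cdet nz).
by apply: filterS => y ny; rewrite unitmxE unitfE.
Qed.

Lemma differentiable_invmx (V : normedModType R) n (A : V -> 'M[R]_n) x :
  differentiable A x -> A x \in unitmx -> differentiable (fun y => invmx (A y)) x.
Proof.
move=> dA Ax.
have nz : \det (A x) != 0 by move: Ax; rewrite unitmxE unitfE.
have dadj : differentiable (fun y => (\det (A y))^-1 *: \adj (A y)) x.
  apply: differentiable_mx => i j.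
  have -> : (fun y => ((\det (A y))^-1 *: \adj (A y)) i j) =
     (fun y => (\det (A y))^-1) * (fun y => cofactor (A y) j i).
    by apply/funext => y; rewrite !mxE.
  apply: differentiableM.
    by apply: (@differentiableV _ _ (fun y => \det (A y))) => //; exact: differentiable_det.
  apply: differentiableM; first exact: differentiable_cst.
  apply: differentiable_det; apply: differentiable_mx => k l.
  have -> : (fun y => row' j (col' i (A y)) k l) = (fun y => A y (lift j k) (lift i l)).
    by apply/funext => y; rewrite !mxE.
  exact: differentiable_entry.
apply: near_eq_differentiable dadj.
by apply: filterS (unitmx_nbhs dA Ax) => y ny; rewrite /invmx ny.
Qed.

Lemma differentiable_eps (V W : normedModType R) (f : V -> W) x (e : R) :
  differentiable f x -> 0 < e ->
  \forall h \near (0 : V), `|f (h + x) - f x - 'd f x h| <= e * `|h|.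
Proof.
move=> df e0.
have /diff_locallyx h := df.
near=> k; rewrite h -addrA -opprD [_ - (_ + _)]addrC addKr.
by near: k; exact: littleoP.
Unshelve. all: by end_near. Qed.

Lemma derive_partial n (W : normedModType R) (f : 'rV[R]_n -> W) x v :
  differentiable f x -> 'D_v f x = \sum_(i < n) v 0 i *: partial i f x.
Proof.
move=> df; rewrite deriveE // {1}[v]row_sum_delta linear_sum /=.
by apply: eq_bigr => i _; rewrite linearZ /partial deriveE.
Qed.

Lemma is_derive_line (V W : normedModType R) (f : V -> W) x v t :
  differentiable f (x + t *: v) ->
  is_derive t 1 (fun s : R => f (x + s *: v)) ('D_v f (x + t *: v)).
Proof.
move=> df.
have dl : is_diff t (fun s : R => x + s *: v) (fun s : R => s *: v).
  by apply: is_diff_eq; rewrite add0r.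
have [dl1 dl2] := dl.
have dc : differentiable (f \o (fun s : R => x + s *: v)) t by exact: differentiable_comp.
split; first exact/diff_derivable.
by rewrite -[LHS]/('D_1 (f \o (fun s : R => x + s *: v)) t) deriveE // diff_comp //= dl2 /= scale1r deriveE.
Qed.

(** Differentiate the locally constant product [A y *m invmx (A y)] and solve for the derivative of
    the second factor. *)
Lemma is_derive_invmx (V : normedModType R) n (A : V -> 'M[R]_n) x v dA :
  differentiable A x -> A x \in unitmx -> is_derive x v A dA ->
  is_derive x v (fun y => invmx (A y)) (- invmx (A x) *m dA *m invmx (A x)).
Proof.
move=> difA Ax hA.
have di := differentiable_invmx difA Ax.
have hi : is_derive x v (fun y => invmx (A y)) ('D_v (fun y => invmx (A y)) x).
  exact/derivableP/diff_derivable.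
have h1 := is_derive_mulmx hA hi.
have near1 : \forall y \near x, A y *m invmx (A y) = 1%:M.
  apply: filterS (unitmx_nbhs difA Ax) => y uy.
  exact: mulmxV.
have h2 : is_derive x v (fun y => A y *m invmx (A y)) 0.
  have h0 : is_derive x v (cst (1%:M : 'M[R]_n)) 0 by exact: is_derive_cst.
  by apply: near_eq_is_derive h0; apply: filterS near1 => y ->.
have := h1.(derive_val); rewrite (h2.(derive_val)) => /esym/eqP.
rewrite addrC addr_eq0 => /eqP /(congr1 (mulmx (invmx (A x)))).
rewrite mulKmx // => e.
by rewrite -[X in is_derive _ _ _ X]/(- _ *m _ *m _) !mulNmx -mulmxA -mulmxN -e.
Qed.

Lemma MVT_interval (phi dphi : R -> R) (h : R) : 0 < h ->
  (forall t : R, 0 <= t <= h -> is_derive t 1 phi (dphi t)) ->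
  exists2 c, 0 < c < h & phi h - phi 0 = dphi c * h.
Proof.
move=> h0 dp.
have [] := @MVT R phi dphi 0 h h0.
- by move=> x; rewrite in_itv /= => /andP[/ltW a /ltW b]; apply: dp; rewrite a b.
- apply: derivable_within_continuous => x; rewrite in_itv /= => hx.
  by have [] := dp x hx.
move=> c; rewrite in_itv /= => hc; rewrite subr0 => e; by exists c.
Qed.

Lemma nbhs0_radius (V : normedModType R) (P : set V) :
  (\forall w \near (0 : V), P w) -> exists2 r : R, 0 < r & forall w, `|w| < r -> P w.
Proof.
move=> /nbhs_normP[r /= r0 h]; exists r => // w wr; apply: h.
by rewrite /ball_/= sub0r normrN.
Qed.

Lemma second_difference_bound (P1 P2 P0 cA Q h e : R) : 0 < h ->
  `|P1 - P0 - (cA + h * Q)| <= e * h / 2 -> `|P2 - P0 - cA| <= e * h / 2 ->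
  `|(P1 - P2) * h - h ^+ 2 * Q| <= e * h ^+ 2.
Proof.
move=> h0 b1 b2; have -> : (P1 - P2) * h - h ^+ 2 * Q = h * (P1 - P2 - h * Q) by ring.
rewrite normrM gtr0_norm // expr2 mulrCA ler_pM2l //.
by move: b1 b2; rewrite !ler_norml; lra.
Qed.

Lemma mixed_difference_close (S a b h e G1 G2 g : R) : 0 < h ->
  `|S - G1 - G2 + g - h ^+ 2 * a| <= e / 2 * h ^+ 2 ->
  `|S - G2 - G1 + g - h ^+ 2 * b| <= e / 2 * h ^+ 2 -> `|b - a| <= e.
Proof.
move=> h0; have h20 : 0 < h ^+ 2 by exact: exprn_gt0.
move=> k1 k2; rewrite -(ler_pM2l h20) -{1}(gtr0_norm h20) -normrM.
by move: k1 k2; rewrite !ler_norml; lra.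
Qed.

(** Here [g] stands for a first derivative at distance [c] along v, [D] for the second derivative
    and [N] for |v|. The tolerance D / (2 (N + 1)) keeps the error of the first-order expansion
    below c D / 2. *)
Lemma increment_gt0 (g c D N : R) : 0 < c -> 0 < D -> 0 <= N ->
  `|g - c * D| <= D / (2 * (N + 1)) * (c * N) -> 0 < g.
Proof.
move=> c0 D0 N0; have -> : D / (2 * (N + 1)) * (c * N) = (c * D / 2) * (N / (N + 1)) by field; lra.
have : (c * D / 2) * (N / (N + 1)) <= c * D / 2.
  apply: ler_piMr; first by rewrite divr_ge0 // mulr_ge0 // ltW.
  by rewrite ler_pdivrMr; lra.
have : 0 < c * D by rewrite mulr_gt0.
by rewrite ler_norml; lra.
Qed.

(** The mean value theorem in the direction [u] turns the second difference into an increment of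
    ['D_u g], which is expanded to first order at [x] in both points; the contribution of [c *: u]
    cancels. Differentiability of ['D_u g] at the single point [x] is enough. *)
Lemma second_difference (V : normedModType R) (g : V -> R) x u v (e : R) :
  (\forall y \near x, differentiable g y) -> differentiable ('D_u g) x -> 0 < e ->
  exists2 d : R, 0 < d & forall h : R, 0 < h < d ->
    `|g (x + h *: u + h *: v) - g (x + h *: u) - g (x + h *: v) + g x
      - h ^+ 2 * 'D_v ('D_u g) x| <= e * h ^+ 2.
Proof.
move=> dg ddg e0.
pose N := `|u| + `|v| + 1.
(* All the points that occur are within [h * N] of [x], so the tolerance [e / (2 * N)] costs at most
   e h / 2 in each of the two expansions. *)
have N0 : 0 < N by rewrite /N ltr_wpDl // addr_ge0.
have e1 : 0 < e / (2 * N) by rewrite divr_gt0 // mulr_gt0.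
have dg0 : \forall w \near (0 : V), differentiable g (w + x).
  by move: dg; rewrite (near_shift 0) subr0.
have [r r0 hr] := nbhs0_radius (filterI dg0 (differentiable_eps ddg e1)).
exists (r / N); first by rewrite divr_gt0.
move=> h /andP[h0 hd].
have hN : h * N < r by rewrite -ltr_pdivlMr.
have small (c d : R) : 0 <= c <= h -> 0 <= d <= h -> `|c *: u + d *: v| <= h * N.
  move=> /andP[c0 ch] /andP[d0 dh]; apply: le_trans (ler_normD _ _) _.
  rewrite !normrZ !ger0_norm // /N !mulrDr mulr1.
  have := ler_wpM2r (normr_ge0 u) ch; have := ler_wpM2r (normr_ge0 v) dh; lra.
have hh : 0 <= h <= h by rewrite lexx ltW.
have h00 : (0:R) <= 0 <= h by rewrite lexx ltW.
pose psi (s : R) := g (x + h *: v + s *: u) - g (x + s *: u).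
have dpsi (t : R) : 0 <= t <= h ->
    is_derive t 1 psi ('D_u g (x + h *: v + t *: u) - 'D_u g (x + t *: u)).
  move=> ht; apply: is_deriveB; apply: is_derive_line.
    have [] := hr (t *: u + h *: v); first exact: le_lt_trans (small _ _ ht hh) hN.
    by rewrite addrC [t *: u + _]addrC addrA.
  have [] := hr (t *: u + 0 *: v); first exact: le_lt_trans (small _ _ ht h00) hN.
  by rewrite addrC scale0r addr0.
have [c hc Hc] := MVT_interval h0 dpsi.
have hc' : 0 <= c <= h by move: hc => /andP[/ltW -> /ltW ->].
have [_ b1] := hr _ (le_lt_trans (small _ _ hc' hh) hN).
have [_ b2] := hr _ (le_lt_trans (small _ _ hc' h00) hN).
have -> : g (x + h *: u + h *: v) - g (x + h *: u) - g (x + h *: v) + g x = psi h - psi 0.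
  by rewrite /psi scale0r !addr0 (addrAC x); ring.
rewrite Hc.
have dl (t : R) : 'd ('D_u g) x (c *: u + t *: v) = c * 'D_u ('D_u g) x + t * 'D_v ('D_u g) x.
  by rewrite linearD !linearZ /= -!(deriveE _ ddg).
rewrite !dl in b1 b2.
have s1 := small _ _ hc' hh; have s2 := small _ _ hc' h00.
move: b1 b2 => /le_trans/(_ (ler_wpM2l (ltW e1) s1)) b1 /le_trans/(_ (ler_wpM2l (ltW e1) s2)) b2.
move: b1 b2; rewrite mul0r !scale0r !addr0.
rewrite [c *: u + h *: v + x]addrC [c *: u + x]addrC [c *: u + h *: v]addrC addrA.
have -> : e / (2 * N) * (h * N) = e * h / 2 by field; lra.
exact: second_difference_bound.
Qed.

(* Both mixed derivatives are limits of the same second difference quotient. *)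
Lemma derive_swap (V : normedModType R) (g : V -> R) x u v :
  (\forall y \near x, differentiable g y) ->
  differentiable ('D_u g) x -> differentiable ('D_v g) x ->
  'D_v ('D_u g) x = 'D_u ('D_v g) x.
Proof.
move=> dg du dv; apply/eqP; rewrite -subr_eq0 -normr_eq0; apply/eqP.
apply/eqP; rewrite eq_le normr_ge0 andbT; apply/ler_addgt0Pr => e e0.
have e2 : 0 < e / 2 by lra.
have [d1 d10 h1] := second_difference v dg du e2.
have [d2 d20 h2] := second_difference u dg dv e2.
pose h := Num.min d1 d2 / 2.
have m0 : 0 < Num.min d1 d2 by rewrite lt_min d10.
have h0 : 0 < h by rewrite divr_gt0.
have hm : h < Num.min d1 d2 by rewrite /h ltr_pdivrMr // ltr_pMr // ltr1n.
have /andP[hd1 hd2] : (h < d1) && (h < d2) by rewrite -lt_min.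
have := h1 h; rewrite h0 hd1 => /(_ isT); have := h2 h; rewrite h0 hd2 => /(_ isT).
rewrite add0r [x + h *: v + _]addrAC => k1 k2; exact: mixed_difference_close h0 k1 k2.
Qed.

(** If the second derivative were positive, ['D_v g] would be positive just after [x] along [v], and
    by the mean value theorem [g] would exceed its maximum. *)
Lemma local_max_derive (V : normedModType R) (g : V -> R) x v :
  (\forall y \near x, differentiable g y) -> differentiable ('D_v g) x ->
  (\forall y \near x, g y <= g x) -> 'D_v g x = 0 /\ 'D_v ('D_v g) x <= 0.
Proof.
move=> dg ddg mx.
have sh (P : set V) : (\forall y \near x, P y) -> exists2 r : R, 0 < r & forall t : R, `|t| < r -> P (x + t *: v).
  rewrite (near_shift 0) subr0 => /nbhs0_radius[r r0 hr].
  exists (r / (`|v| + 1)); first by rewrite divr_gt0 // ltr_wpDl.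
  move=> t; rewrite ltr_pdivlMr ?ltr_wpDl // => ht.
  have := hr (t *: v); rewrite /= addrC; apply.
  by rewrite normrZ; apply: le_lt_trans ht; rewrite ler_wpM2l // lerDl.
have [r1 r10 hr1] := sh _ (filterI dg mx).
pose phi (t : R) := g (x + t *: v).
have dphi (t : R) : `|t| < r1 -> is_derive t 1 phi ('D_v g (x + t *: v)).
  by move=> /hr1[dgt _]; exact: is_derive_line.
have z : 'D_v g x = 0.
  have -> : 'D_v g x = 'D_1 phi 0.
    by have [_ ->] := dphi 0 (ltac:(by rewrite normr0)); rewrite scale0r addr0.
  suff h : is_derive (0 : R) 1 phi 0 by exact: h.(derive_val).
  apply: (@derive1_at_max R phi (- r1) r1).
  - by lra.
  - by move=> t; rewrite in_itv /= => ht; have [] := dphi t (ltac:(by rewrite ltr_norml)).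
  - by rewrite in_itv /=; lra.
  - move=> t; rewrite in_itv /= => ht; rewrite /phi scale0r addr0.
    by have [] := hr1 t (ltac:(by rewrite ltr_norml)).
split => //; rewrite leNgt; apply/negP => D0.
set D := 'D_v _ _ in D0.
have e0 : 0 < D / (2 * (`|v| + 1)).
  by rewrite divr_gt0 // mulr_gt0 // ltr_wpDl.
have := differentiable_eps ddg e0.
have [r r0 hr] := sh _ (filterI dg mx).
move=> /nbhs0_radius[r2 r20 hr2].
pose h := Num.min r1 (r2 / (`|v| + 1)) / 2.
have v1 : 0 < `|v| + 1 by rewrite ltr_wpDl.
have m0 : 0 < Num.min r1 (r2 / (`|v| + 1)) by rewrite lt_min r10 divr_gt0.
have h0 : 0 < h by rewrite divr_gt0.
have hm : h < Num.min r1 (r2 / (`|v| + 1)) by rewrite /h ltr_pdivrMr // ltr_pMr // ltr1n.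
have /andP[hd1 hd2] : (h < r1) && (h < r2 / (`|v| + 1)) by rewrite -lt_min.
have [|c /andP[c0 ch] hc] := @MVT_interval phi (fun t => 'D_v g (x + t *: v)) h h0.
  by move=> t ht; apply: dphi; rewrite ltr_norml; lra.
have [_] := hr1 h (ltac:(by rewrite ltr_norml; lra)).
rewrite -/(phi h) -subr_le0.
have -> : g x = phi 0 by rewrite /phi scale0r addr0.
rewrite hc pmulr_lle0 //.
have cv : `|c *: v| < r2.
  rewrite normrZ gtr0_norm //; move: hd2; rewrite ltr_pdivlMr // => hd2.
  apply: le_lt_trans hd2; apply: ler_pM; rewrite ?normr_ge0 ?lerDl ?(ltW c0) ?(ltW ch) //.
have := hr2 _ cv; rewrite z subr0 linearZ /= -deriveE // -/D normrZ gtr0_norm //.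
rewrite [c *: v + x]addrC => /(increment_gt0 c0 D0 (normr_ge0 _)).
by rewrite ltNge => /negP h1 h2; apply: h1.
Qed.

(** The function exp(- C t) w(t) is nonincreasing. *)
Lemma gronwall_zero (w dw : R -> R) (C : R) :
  (forall t : R, 0 <= t <= 1 -> is_derive t 1 w (dw t)) ->
  (forall t : R, 0 <= t <= 1 -> dw t <= C * w t) -> w 0 = 0 -> w 1 <= 0.
Proof.
move=> hw hC w0.
pose k (t : R) := expR (- C * t) * w t.
have [|c /andP[c0 c1] hc] := @MVT_interval k (fun t => expR (- C * t) * (dw t - C * w t)) 1 ltr01.
  move=> t ht; have := hw t ht => hwt.
  apply: is_derive_eq.
  change (expR (- C * t) * dw t + w t * (expR (- C * t) * (- C * 1)) = expR (- C * t) * (dw t - C * w t)); ring.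
have ce : 0 <= c <= 1 by lra.
have : k 1 - k 0 <= 0.
  by rewrite hc mulr1 pmulr_rle0 ?expR_gt0 // subr_le0; exact: hC.
by rewrite /k w0 mulr0 subr0 pmulr_rle0 // expR_gt0.
Qed.

Lemma is_derive_bigsum (V W : normedModType R) (I : finType) (f : I -> V -> W) x v (df : I -> W) :
  (forall i, is_derive x v (f i) (df i)) ->
  is_derive x v (\sum_i f i) (\sum_i df i).
Proof.
move=> h; elim/big_ind2 : _ => // [|f1 d1 f2 d2 h1 h2]; last exact: is_deriveD.
exact: is_derive_cst.
Qed.

Lemma continuous_bigsum (T : topologicalType) (W : normedModType R) (I : finType)
    (f : I -> T -> W) x :
  (forall i, {for x, continuous (f i)}) -> {for x, continuous (fun y => \sum_i f i y)}.
Proof.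
move=> h; have -> : (fun y => \sum_i f i y) = \sum_i f i by apply/funext => y; rewrite fct_sumE.
elim/big_ind : _ => // [|f1 f2 h1 h2]; last exact: continuousD.
exact: cst_continuous.
Qed.

(** Uniqueness for a linear homogeneous system along a segment: the sum of squares of the unknowns
    satisfies a Gronwall inequality, since continuous coefficients are bounded on [0, 1]. *)
Lemma linear_ode_zero (V : normedModType R) (I : finType) (u : I -> V -> R)
    (b : I -> I -> V -> R) x v :
  (forall (t : R) i, 0 <= t <= 1 -> differentiable (u i) (x + t *: v)) ->
  (forall (t : R) i j, 0 <= t <= 1 -> differentiable (b i j) (x + t *: v)) ->
  (forall (t : R) i, 0 <= t <= 1 ->
     'D_v (u i) (x + t *: v) = \sum_j b i j (x + t *: v) * u j (x + t *: v)) ->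
  (forall i, u i x = 0) -> forall i, u i (x + v) = 0.
Proof.
move=> du db hD u0.
pose S (t : R) := \sum_i \sum_j `|b i j (x + t *: v)|.
have cS : {within `[0 : R, 1], continuous S}.
  apply: continuous_in_subspaceT => t; rewrite inE /= in_itv /= => ht.
  apply: continuous_bigsum => i; apply: continuous_bigsum => j.
  apply: cvg_norm.
  have := is_derive_line (db t i j ht); move=> [/derivable1_diffP/differentiable_continuous h _].
  exact: h.
have [c _ hc] := EVT_max (ler01 : (0:R) <= 1) cS.
pose C := S c.
pose w (t : R) := \sum_i u i (x + t *: v) ^+ 2.
pose dw (t : R) := \sum_i (2 * u i (x + t *: v) * 'D_v (u i) (x + t *: v)).
have : w 1 <= 0.
  (* By [tm] each term of the derivative is at most C (u_i^2 + u_j^2); summing over the pairs (i, j)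
     gives 2 C #|I| w. *)
  apply: (@gronwall_zero w dw (2 * C * #|I|%:R)); last first.
  - by rewrite /w big1 // => i _; rewrite scale0r addr0 u0 expr0n.
  - move=> t ht; rewrite /dw.
    have bC i j : `|b i j (x + t *: v)| <= C.
      apply: le_trans (hc t _); last by rewrite in_itv.
      rewrite /S (bigD1 i) //= (bigD1 j) //= -addrA lerDl addr_ge0 //.
        by apply: sumr_ge0.
      by apply: sumr_ge0 => ? _; apply: sumr_ge0.
    have C0 : 0 <= C by rewrite /C /S; apply: sumr_ge0 => ? _; apply: sumr_ge0.
    have tm i j : 2 * u i (x + t *: v) * (b i j (x + t *: v) * u j (x + t *: v))
       <= C * (u i (x + t *: v) ^+ 2 + u j (x + t *: v) ^+ 2).
      set p := u i _; set q := u j _; set B := b i j _.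
      have := bC i j; rewrite -/B ler_norml => /andP[B1 B2].
      have : 0 <= (C - B) * (p + q) ^+ 2 by rewrite mulr_ge0 ?sqr_ge0 // subr_ge0.
      have : 0 <= (C + B) * (p - q) ^+ 2 by rewrite mulr_ge0 ?sqr_ge0 //; lra.
      by lra.
    apply: le_trans (_ : \sum_i \sum_j C * (u i (x + t *: v) ^+ 2 + u j (x + t *: v) ^+ 2) <= _).
      apply: ler_sum => i _; rewrite hD // mulr_sumr; apply: ler_sum => j _; exact: tm.
    under eq_bigr do rewrite -mulr_sumr big_split /= sumr_const.
    rewrite -mulr_sumr big_split /= sumr_const sumrMnl -/(w t).
    rewrite -mulr_natr.
    by rewrite le_eqVlt; apply/orP; left; apply/eqP; ring.
  - move=> t ht.
    have hu i := is_derive_line (du t i ht).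
    have -> : w = \sum_i (fun s : R => u i (x + s *: v)) ^+ 2.
      by apply/funext => s; rewrite fct_sumE; apply: eq_bigr.
    by apply: is_derive_bigsum => i; apply: is_derive_eq; rewrite expr1.
rewrite /w => w1 i; apply/eqP.
have : \sum_i u i (x + 1 *: v) ^+ 2 == 0.
  by rewrite eq_le w1 sumr_ge0 // => j _; exact: sqr_ge0.
rewrite psumr_eq0; last by move=> j _; exact: sqr_ge0.
by move=> /allP /(_ i (mem_index_enum _)); rewrite /= sqrf_eq0 scale1r.
Qed.

End Calculus.

(** * Totally symmetric tensors *)

Section Tensors.
Context {R : realType} {n : nat}.

(* The family [E] of the slices of a cubic form is totally symmetric. *)
Definition symmetric_family (E : 'I_n -> 'M[R]_n) :=
  (forall i, (E i)^T = E i) /\ (forall i j k, E i j k = E j i k).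

Lemma sum_family_mul (E : 'I_n -> 'M[R]_n) (Y : 'M[R]_n) b :
  symmetric_family E -> \sum_d (E d *m Y) b d = \tr (E b *m Y).
Proof.
move=> [_ sE]; rewrite /mxtrace; apply: eq_bigr => d _; rewrite !mxE.
by apply: eq_bigr => x _; rewrite sE.
Qed.

Lemma sum_mul_family (E : 'I_n -> 'M[R]_n) (X Y : 'M[R]_n) b :
  symmetric_family E ->
  \sum_d (X *m E d *m Y) b d = \sum_e X b e * \tr (E e *m Y).
Proof.
move=> sE; under eq_bigr do rewrite -mulmxA mxE.
rewrite exchange_big /=; apply: eq_bigr => e _.
by rewrite -mulr_sumr sum_family_mul.
Qed.

Lemma family_entry (E : 'I_n -> 'M[R]_n) i j k : symmetric_family E ->
  [/\ E i j k = E j i k, E i j k = E i k j & E i j k = E k j i].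
Proof.
move=> [tE sE]; have t a b c : E a b c = E a c b by rewrite -[in LHS]tE mxE.
by split; [exact: sE | exact: t | rewrite t sE t].
Qed.

Section Associative.
Variables (C : 'I_n -> 'M[R]_n) (G P : 'M[R]_n) (w : 'rV[R]_n).
Hypothesis sC : symmetric_family C.
Hypothesis PG : P *m G = 1%:M.
Hypothesis tG : G^T = G.
Hypothesis tP : P^T = P.
Hypothesis CC : forall i j, C i *m P *m C j = C j *m P *m C i.
Hypothesis wC : \sum_k w 0 k *: C k = G.

(** Associativity of the algebra with structure constants [(C a *m P) f p]: total symmetry makes it
    commutative, so it is associative as soon as its multiplications commute, which is [CC]. By [wC]
    its unit is [w]. *)
Lemma family_mul a f : C a *m P *m C f = \sum_p (C a *m P) f p *: C p.
Proof.
apply/matrixP => x y; rewrite summxE.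
have e (i j k l : 'I_n) : (C i *m P *m C j) k l = (C k *m P *m C j) i l.
  rewrite !mxE; apply: eq_bigr => q _; rewrite !mxE; congr (_ * _).
  by apply: eq_bigr => p _; have [-> _ _] := family_entry i k p sC.
transitivity ((C a *m P *m C x) f y).
  by rewrite CC e CC.
rewrite [LHS]mxE; apply: eq_bigr => p _; rewrite [RHS]mxE; congr (_ * _).
by have [-> _ _] := family_entry x p y sC.
Qed.

Lemma family_unit (E : 'I_n -> 'M[R]_n) a b :
  symmetric_family E -> (E a *m w^T) b 0 = (\sum_k w 0 k *: E k) a b.
Proof.
move=> sE; rewrite summxE mxE; apply: eq_bigr => k _; rewrite !mxE mulrC.
have [_ e _] := family_entry a b k sE; rewrite e.
by have [-> _ _] := family_entry a k b sE.
Qed.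

(* Contracting the hypothesis on [D P C] shows that [\tr (D m a P C b P)] is antisymmetric in
   [a, b] and symmetric in [m, a], hence zero; contracting once more leaves [N * D = 0]. *)
Lemma parallel_family (D : 'I_n -> 'I_n -> 'M[R]_n) (N : R) : N != 0 ->
  (forall m, symmetric_family (D m)) -> (forall m i, D m i = D i m) ->
  (forall m i k, D m i *m P *m C k + C i *m P *m D m k
               = D m k *m P *m C i + C k *m P *m D m i) ->
  (forall m, \sum_k w 0 k *: D m k = 0) ->
  (forall m k, \tr (D m k *m P) = 0) ->
  (forall k, \tr (C k *m P) = N * (w *m G) 0 k) ->
  forall m i, D m i = 0.
Proof.
move=> N0 sD Dc AS wD tD tC.
have wGP : P *m (w *m G)^T = w^T by rewrite trmx_mul tG mulmxA PG mul1mx.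
have sumw (X : 'M[R]_n) b : \sum_e (X *m P) b e * (N * (w *m G) 0 e) = N * (X *m w^T) b 0.
  rewrite -wGP mulmxA mxE mulr_sumr; apply: eq_bigr => e _; rewrite [(w *m G)^T e 0]mxE; ring.
pose M m a b := \tr (D m a *m P *m C b *m P).
have M1 m a b : M m b a + M m a b = 0.
  have h : \sum_d ((D m a *m P *m C d + C a *m P *m D m d) *m P) b d
         = \sum_d ((D m d *m P *m C a + C d *m P *m D m a) *m P) b d.
    by apply: eq_bigr => d _; rewrite AS.
  move: h; under eq_bigr do rewrite mulmxDl mxE.
  under [X in _ = X -> _]eq_bigr do rewrite mulmxDl mxE -2!(mulmxA (D m _)) -2!(mulmxA (C _)).
  rewrite !big_split /= !sum_mul_family // !sum_family_mul // !mulmxA.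
  rewrite [X in _ + X = _]big1 ?addr0; last by move=> e _; rewrite tD mulr0.
  under eq_bigr do rewrite tC.
  rewrite sumw family_unit // wD mxE mulr0 => /esym.
  by rewrite -[C b *m P *m D m a *m P]mulmxA [X in _ + X]mxtrace_mulC !mulmxA.
have M0 m a b : M m a b = 0.
  have c x y z : M x y z = M y x z by rewrite /M Dc.
  have o x y z : M x y z = - M x z y by apply/eqP; rewrite -addr_eq0 M1.
  have : M m a b = - M m a b by rewrite {1}o c o opprK c o c.
  by move/eqP; rewrite -addr_eq0 -mulr2n mulrn_eq0 /= => /eqP.
(* By [family_mul] the product of the two multiplications is a combination of single ones, which
   brings the trace back to [M0]. *)
have MM m b a f : \tr (D m b *m P *m C a *m P *m C f *m P) = 0.
  rewrite -!mulmxA (mulmxA (C a)) (mulmxA (_ *m P)) family_mul.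
  rewrite mulmx_suml !mulmx_sumr linear_sum big1 //= => p _.
  by rewrite -scalemxAl -!scalemxAr linearZ /= !mulmxA -/(M m b p) M0 mulr0.
(* The trace form of the algebra is N times the metric; this is where [N] enters the last
   contraction. *)
have trCC e f : \tr (C e *m P *m C f *m P) = N * G e f.
  rewrite family_mul mulmx_suml linear_sum /=.
  under eq_bigr do rewrite -scalemxAl linearZ /= tC.
  by rewrite sumw (family_unit e f sC) wC.
move=> m a; apply/matrixP => b f; rewrite [RHS]mxE.
apply: (mulfI N0); rewrite mulr0.
(* Of the four terms of this contraction, one vanishes by [M0] and two by [MM]; by [trCC] the
   remaining one is N times the entry of [D m a]. *)
have h : \sum_d ((D m a *m P *m C d + C a *m P *m D m d) *m (P *m C f *m P)) b d
       = \sum_d ((D m d *m P *m C a + C d *m P *m D m a) *m (P *m C f *m P)) b d.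
  by apply: eq_bigr => d _; rewrite AS.
move: h; under eq_bigr do rewrite mulmxDl mxE.
under [X in _ = X -> _]eq_bigr do rewrite mulmxDl mxE -2!(mulmxA (D m _)) -2!(mulmxA (C _)).
rewrite !big_split /= !sum_mul_family // !sum_family_mul // !mulmxA.
rewrite [X in _ + X = _]big1 ?addr0; last first.
  by move=> e _; rewrite !mulmxA -/(M m e f) M0 mulr0.
rewrite MM add0r.
have -> : C b *m P *m D m a *m P *m C f *m P = (C b *m P) *m (D m a *m P *m C f *m P).
  by rewrite !mulmxA.
rewrite mxtrace_mulC !mulmxA MM.
under eq_bigr do rewrite !mulmxA trCC.
have -> : \sum_i (D m a *m P) b i * (N * G i f) = N * \sum_i (D m a *m P) b i * G i f.
  by rewrite mulr_sumr; apply: eq_bigr => i _; ring.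
move=> e; rewrite -[RHS]e; congr (_ * _).
by transitivity ((D m a *m P *m G) b f); [rewrite -mulmxA PG mulmx1 | rewrite mxE].
Qed.

End Associative.
End Tensors.

(** One step of symmetric elimination: [S] is the Schur complement of the corner entry, and it is
    positive because its values are values of [G] at the vectors whose first coordinate minimizes
    the form. *)
Lemma cholesky (R : realType) n (G : 'M[R]_n) : G^T = G ->
  (forall u : 'rV[R]_n, u != 0 -> 0 < (u *m G *m u^T) 0 0) ->
  exists T : 'M[R]_n, T *m G *m T^T = 1%:M.
Proof.
elim: n G => [|n IH] G tG pG.
  by exists 1%:M; apply/matrixP => -[].
rewrite -[n.+1]/(1 + n)%N in G tG pG *.
pose a := ulsubmx G; pose b := ursubmx G; pose D := drsubmx G.
have GE : G = block_mx a b b^T D.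
  by rewrite -[LHS]submxK; congr block_mx; rewrite /b trmx_ursub tG.
have tD : D^T = D by rewrite /D trmx_drsub tG.
have aE : a = (a 0 0)%:M by rewrite [LHS]mx11_scalar.
set a0 := a 0 0 in aE.
have a0p : 0 < a0.
  have := pG (row_mx 1%:M 0); rewrite GE tr_row_mx trmx1 trmx0 mul_row_block mul_row_col.
  rewrite !mul1mx !mul0mx !addr0 mulmx1 mulmx0 addr0; apply.
  apply/eqP => /matrixP /(_ 0 (lshift n 0)); rewrite row_mxEl !mxE /= => /eqP.
  by rewrite oner_eq0.
pose S := D - a0^-1 *: (b^T *m b).
have tS : S^T = S by rewrite /S linearB linearZ /= trmx_mul trmxK tD.
have bGb (v : 'rV[R]_n) : let u := row_mx (- a0^-1 *: (v *m b^T)) v in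
    u *m G = row_mx 0 (v *m S).
  rewrite /= GE mul_row_block aE mul_mx_scalar scalerA mulrN divff ?gt_eqF // scaleN1r addNr.
  by rewrite /S mulmxBr -scalemxAr mulmxA -scalemxAl scaleNr addrC.
have pS (v : 'rV[R]_n) : v != 0 -> 0 < (v *m S *m v^T) 0 0.
  move=> v0; have := pG (row_mx (- a0^-1 *: (v *m b^T)) v).
  rewrite bGb tr_row_mx mul_row_col mul0mx add0r; apply.
  by apply: contra_neq v0 => /eqP; rewrite row_mx_eq0 => /andP[_ /eqP].
have [T hT] := IH S tS pS.
pose s := Num.sqrt a0.
have s0 : 0 < s by rewrite sqrtr_gt0.
have ss : s ^+ 2 = a0 by rewrite sqr_sqrtr // ltW.
exists (block_mx (s^-1)%:M 0 (- a0^-1 *: (T *m b^T)) T).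
rewrite GE aE mulmx_block tr_block_mx mulmx_block.
rewrite !mul0mx !addr0 !trmx0 !mulmx0 !addr0 -!scalar_mxM tr_scalar_mx -scalar_mxM.
have z1 : - a0^-1 *: (T *m b^T) *m a0%:M + T *m b^T = 0.
  by rewrite mul_mx_scalar scalerA mulrN divff ?gt_eqF // scaleN1r addNr.
have z2 : (s^-1 * a0)%:M *m (- a0^-1 *: (T *m b^T))^T + (s^-1)%:M *m b *m T^T = 0.
  rewrite linearZ /= trmx_mul trmxK !mul_scalar_mx -scalemxAl scalerA -scalerDl.
  by rewrite mulrN mulfK ?gt_eqF // addNr scale0r.
rewrite z1 z2 !mul0mx add0r.
have -> : - a0^-1 *: (T *m b^T) *m b + T *m D = T *m S.
  by rewrite /S mulmxBr -scalemxAr -scalemxAl mulmxA scaleNr addrC.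
have -> : s^-1 * a0 / s = 1 by rewrite -ss; field; rewrite gt_eqF.
by rewrite hT -scalar_mx_block.
Qed.

(* The complex spectral theorem gives a split minimal polynomial with real roots. *)
Lemma symmetric_diagonalizable (R : realType) n (A : 'M[R]_n) : A^T = A -> diagonalizable A.
Proof.
case: n A => [|n] A tA.
  by exists 1%:M; rewrite ?unitmx1 //; apply/is_diag_mxP => -[].
pose f := real_complex R.
pose B := map_mx f A.
have Br : B \is a mxOver Num.real.
  by apply/mxOverP => i j; rewrite mxE complex_real.
have Bh : B \is hermsymmx.
  apply/is_hermitianmxP; rewrite expr0 scale1r; apply/matrixP => i j.
  by rewrite !mxE -[in A j i]tA mxE; apply/esym/CrealP; rewrite complex_real.
have dr := hermitian_spectral_diag_real Bh.
have /orthomx_spectralP BE := hermitian_normalmx Bh.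
set P := spectralmx B in BE; set d := spectral_diag B in BE dr.
have Pu : P \in unitmx by exact: spectral_unit.
have mB : mxminpoly B = \prod_(r <- undup [seq d 0 i | i <- enum 'I_n.+1]) ('X - r%:P).
  rewrite -mxminpoly_diag; apply: (similar_mxminpoly Pu); apply/similarP => //.
  by rewrite BE !mulmxA mulmxV // mul1mx.
pose rs := undup [seq complex.Re (d 0 i) | i <- enum 'I_n.+1].
have dE : undup [seq d 0 i | i <- enum 'I_n.+1] = map f rs.
  have fi : injective f by move=> x y [].
  rewrite /rs -(undup_map_inj fi) -!map_comp; congr undup.
  apply: eq_map => i /=.
  have /mxOverP /(_ 0 i) := dr.
  by move=> /RRe_real.
apply/diagonalizableP; exists rs; first exact: undup_uniq.
have -> : \prod_(x <- rs) ('X - x%:P) = mxminpoly A; last exact: dvdpp.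
apply: (map_poly_inj f); rewrite -mxminpoly_map -/B mB dE rmorph_prod big_map.
by apply: eq_bigr => r _; exact: map_polyXsubC.
Qed.

(** Cholesky factors turn the [C i] into commuting symmetric matrices, hence simultaneously
    diagonalizable ones. The diagonalizing [Q] need not be orthogonal, but the unit [w] makes the
    joint eigenvalues of different rows distinct. So the rows of [T1] are automatically orthogonal
    for [G] and have only to be normalized. *)
Lemma codiagonalization (R : realType) n (C : 'I_n -> 'M[R]_n) (G P : 'M[R]_n) (w : 'rV[R]_n) :
  symmetric_family C -> G^T = G ->
  (forall u : 'rV[R]_n, u != 0 -> 0 < (u *m G *m u^T) 0 0) ->
  P *m G = 1%:M ->
  (forall i j, C i *m P *m C j = C j *m P *m C i) ->
  \sum_k w 0 k *: C k = G ->
  exists2 T : 'M[R]_n, T *m G *m T^T = 1%:M &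
    forall i j k, j != k -> (T *m C i *m T^T) j k = 0.
Proof.
move=> sC tG pG PG CC wC.
have [T0 hT0] := cholesky tG pG.
have T0u : T0 \in unitmx by case/mulmx1_unit: hT0; rewrite unitmx_mul => /andP[].
have T0tu : T0^T \in unitmx by rewrite unitmx_tr.
have PE : P = T0^T *m T0.
  have e : T0^T *m T0 *m G = 1%:M.
    by rewrite -mulmxA; apply: mulmx1C.
  have Gu : G \in unitmx by case/mulmx1_unit: PG.
  by apply: (can_inj (mulmxK Gu)); rewrite PG e.
pose S i := T0 *m C i *m T0^T.
have tS i : (S i)^T = S i by rewrite /S !trmx_mul trmxK (sC.1 i) mulmxA.
have SS i j : S i *m S j = S j *m S i.
  rewrite /S !mulmxA -!(mulmxA _ T0^T T0) -PE -!(mulmxA T0).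
  by rewrite CC.
have [Q Qu /allP hQ] : codiagonalizable [seq S i | i <- enum 'I_n].
  apply/codiagonalizableP; split.
    by move=> _ _ /mapP[i _ ->] /mapP[j _ ->]; exact: SS.
  by move=> _ /mapP[i _ ->]; exact: symmetric_diagonalizable.
have hD i : exists d : 'rV[R]_n, Q *m S i = diag_mx d *m Q.
  have /hQ /= /similar_diagPex[d /(similarP Qu) ?] : S i \in [seq S i | i <- enum 'I_n].
    by apply/mapP; exists i => //; rewrite mem_enum.
  by exists d.
have [d hd] := choice hD.
pose T1 := Q *m T0.
have T1u : T1 \in unitmx by rewrite unitmx_mul Qu.
have GE : T0 *m G = invmx T0^T.
  by apply: (can_inj (mulmxK T0tu)); rewrite hT0 mulVmx.
have TC i : T1 *m C i = diag_mx (d i) *m T1 *m G.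
  apply: (can_inj (mulmxK T0tu)).
  have -> : diag_mx (d i) *m T1 *m G *m T0^T = diag_mx (d i) *m Q *m (T0 *m G *m T0^T).
    by rewrite /T1 !mulmxA.
  by rewrite hT0 mulmx1 -hd /T1 /S !mulmxA.
clearbody T1.
have [K KD] : exists K, K = T1 *m G *m T1^T by exists (T1 *m G *m T1^T).
have tK : K^T = K by rewrite KD !trmx_mul trmxK tG mulmxA.
have TCT i : T1 *m C i *m T1^T = diag_mx (d i) *m K by rewrite TC KD !mulmxA.
have Kd i j k : d i 0 j * K j k = d i 0 k * K j k.
  have : (diag_mx (d i) *m K)^T = diag_mx (d i) *m K.
    by rewrite -TCT !trmx_mul trmxK (sC.1 i) mulmxA.
  move=> /matrixP /(_ j k); rewrite mxE !mul_diag_mx mxE [in RHS]mxE.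
  by have -> : K k j = K j k by rewrite -[in LHS]tK mxE.
pose g j i := (T1 *m G) j i.
(* Total symmetry lets the index of the family be exchanged with a column index. *)
have gd j i l : d i 0 j * g j l = d l 0 j * g j i.
  have e a b : d a 0 j * g j b = (T1 *m C a) j b.
    by rewrite TC -mulmxA mul_diag_mx mxE.
  rewrite !e !mxE; apply: eq_bigr => x _; congr (_ * _).
  by have [_ _ ->] := family_entry i x l sC.
have TGu : T1 *m G \in unitmx.
  by rewrite unitmx_mul T1u; case/mulmx1_unit: PG.
(* By [gd] and the unit, row m of [T1 *m G] is a multiple of the vector of eigenvalues of m. Two
   rows with the same eigenvalues would be proportional, against invertibility. *)
have sep j k : j != k -> exists i, d i 0 j != d i 0 k.
  move=> jk; apply/existsP; apply: contraT; rewrite negb_exists => /forallP h.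
  have dE i : d i 0 j = d i 0 k by apply/eqP; have := h i; rewrite negbK.
  have e m l : g m l = d l 0 m * (\sum_i w 0 i * g m i).
    have : (T1 *m G) m l = \sum_i w 0 i * (d i 0 m * g m l).
      rewrite -{1}wC mulmx_sumr summxE; apply: eq_bigr => i _.
      by rewrite -scalemxAr mxE TC -mulmxA mul_diag_mx mxE.
    rewrite -/(g m l) => ->; rewrite mulr_sumr; apply: eq_bigr => i _.
    by rewrite gd; ring.
  pose al := \sum_i w 0 i * g k i; pose be := \sum_i w 0 i * g j i.
  have : (al *: delta_mx 0 j - be *: delta_mx 0 k : 'rV[R]_n) *m (T1 *m G) = 0.
    apply/rowP => l; rewrite mulmxBl -!scalemxAl -!rowE.
    transitivity (al * g j l - be * g k l); first by rewrite /g !mxE.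
    rewrite [RHS]mxE (e j) (e k) -/al -/be dE; ring.
  move=> /(congr1 (mulmx^~ (invmx (T1 *m G)))); rewrite mulmxK // mul0mx => z.
  have be0 : be = 0.
    have /rowP /(_ k) := z; rewrite !mxE !eqxx (eq_sym k) (negbTE jk) /= mulr0 mulr1 sub0r.
    by move/eqP; rewrite oppr_eq0 => /eqP.
  have : row j (T1 *m G) = 0 by apply/rowP => l; rewrite mxE [RHS]mxE -/(g j l) e -/be be0 mulr0.
  rewrite rowE => /(congr1 (mulmx^~ (invmx (T1 *m G)))); rewrite mulmxK // mul0mx.
  by move=> /rowP /(_ j); rewrite !mxE !eqxx => /eqP; rewrite oner_eq0.
have K0 j k : j != k -> K j k = 0.
  move=> /sep[i di]; have /eqP := Kd i j k; rewrite -subr_eq0 -mulrBl mulf_eq0.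
  by rewrite subr_eq0 (negbTE di) => /eqP.
have Kp j : 0 < K j j.
  have -> : K j j = (row j T1 *m G *m (row j T1)^T) 0 0.
    rewrite KD -row_mul tr_row [LHS]mxE [RHS]mxE; apply: eq_bigr => x _.
    by rewrite [(row _ _) _ _]mxE [(col _ _) _ _]mxE.
  apply: pG; apply/eqP; rewrite rowE => /(congr1 (mulmx^~ (invmx T1))); rewrite mulmxK // mul0mx.
  by move=> /rowP /(_ j); rewrite !mxE !eqxx => /eqP; rewrite oner_eq0.
pose s : 'rV[R]_n := \row_j (Num.sqrt (K j j))^-1.
have KE : K = diag_mx (\row_j K j j).
  apply/matrixP => j k; rewrite !mxE; case: eqVneq => [->|jk]; first by rewrite mulr1n.
  by rewrite mulr0n K0.
exists (diag_mx s *m T1).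
  rewrite trmx_mul tr_diag_mx.
  have -> : diag_mx s *m T1 *m G *m (T1^T *m diag_mx s) = diag_mx s *m K *m diag_mx s by rewrite KD !mulmxA.
  rewrite KE !mulmx_diag -diag_const_mx; congr diag_mx; apply/rowP => j; rewrite !mxE.
  set r := Num.sqrt _.
  have r0 : 0 < r by rewrite sqrtr_gt0.
  have -> : K j j = r ^+ 2 by rewrite sqr_sqrtr // ltW.
  by field; rewrite gt_eqF.
move=> i j k jk; rewrite trmx_mul tr_diag_mx.
have -> : diag_mx s *m T1 *m C i *m (T1^T *m diag_mx s) = diag_mx s *m (T1 *m C i *m T1^T) *m diag_mx s.
  by rewrite !mulmxA.
by rewrite TCT KE !mulmx_diag !mxE (negbTE jk) mulr0n.
Qed.

Lemma is_derive_expR_comp (R : realType) (V : normedModType R) (g : V -> R) x v dg :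
  differentiable g x -> is_derive x v g dg ->
  is_derive x v (fun y => expR (g y)) (dg * expR (g x)).
Proof.
move=> dfg [_ <-].
have dexp : differentiable (@expR R) (g x) by apply/derivable1_diffP; exact: derivable_expR.
split; first by apply/diff_derivable; exact: differentiable_comp.
rewrite -[LHS]/('D_v (expR \o g) x) deriveE; last exact: differentiable_comp.
rewrite diff_comp //= deriv1E; last exact: derivable_expR.
by rewrite derive1E (is_derive_expR (g x)).(derive_val) deriveE.
Qed.

(** * The strong maximum principle *)

Section MaximumPrinciple.
Context {R : realType} {n : nat}.
Implicit Types (u : 'rV[R]_n -> R) (x y c : 'rV[R]_n).

Definition elliptic (a : 'M[R]_n) (b : 'rV[R]_n) u x :=
  \sum_(i < n) \sum_(j < n) a i j * partial i (partial j u) x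
  + \sum_(k < n) b 0 k * partial k u x.

Lemma derive_derive u x v :
  (\forall y \near x, differentiable u y) ->
  (forall i, differentiable (partial i u) x) ->
  differentiable ('D_v u) x /\
  'D_v ('D_v u) x = \sum_(i < n) \sum_(j < n) v 0 i * v 0 j * partial i (partial j u) x.
Proof.
move=> du ddu.
pose w y := \sum_(j < n) v 0 j *: partial j u y.
have wE : \forall y \near x, w y = 'D_v u y.
  by apply: filterS du => y dy; rewrite derive_partial.
have dw : differentiable w x.
  by apply: differentiable_bigsum => j; apply: differentiableZ.
split; first exact: near_eq_differentiable wE dw.
rewrite -(near_eq_derive v wE) derive_partial //.
apply: eq_bigr => i _; rewrite /partial.
have hj j : is_derive x (delta_mx 0 i) (fun y => v 0 j *: partial j u y)
    (v 0 j *: partial i (partial j u) x).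
  by apply: is_deriveZ; apply/derivableP/diff_derivable.
have -> : w = \sum_j (fun y => v 0 j *: partial j u y).
  by apply/funext => y; rewrite fct_sumE.
have h := is_derive_bigsum hj; rewrite h.(derive_val) scaler_sumr.
by apply: eq_bigr => j _; rewrite scalerA.
Qed.

(** With the factorization of [a], the second-order part is the sum of the second derivatives along
    the rows of [T], each of which is nonpositive at a maximum. *)
Lemma elliptic_local_max u x (a T : 'M[R]_n) b :
  (\forall y \near x, differentiable u y) ->
  (forall i, differentiable (partial i u) x) ->
  (\forall y \near x, u y <= u x) -> a = T^T *m T -> elliptic a b u x <= 0.
Proof.
move=> du ddu mx aE.
have hv v := derive_derive v du ddu.
have hm v := local_max_derive du (hv v).1 mx.
rewrite /elliptic [X in _ + X]big1 ?addr0; last first.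
  by move=> k _; rewrite /partial (hm _).1 mulr0.
have -> : \sum_(i < n) \sum_(j < n) a i j * partial i (partial j u) x
   = \sum_(k < n) 'D_(row k T) ('D_(row k T) u) x.
  under [RHS]eq_bigr do rewrite (hv _).2.
  rewrite [RHS]exchange_big; apply: eq_bigr => i _.
  rewrite [RHS]exchange_big; apply: eq_bigr => j _.
  rewrite aE mxE mulr_suml; apply: eq_bigr => k _.
  by rewrite [T^T _ _]mxE [row k T 0 i]mxE [row k T 0 j]mxE.
by apply: sumr_le0 => k _; have [] := hm (row k T).
Qed.

Lemma elliptic_combination (a : 'M[R]_n) b u E v x (eps : R) :
  (forall j, partial j v x = partial j u x + eps * partial j E x) ->
  (forall i j, partial i (partial j v) x
     = partial i (partial j u) x + eps * partial i (partial j E) x) ->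
  elliptic a b v x = elliptic a b u x + eps * elliptic a b E x.
Proof.
move=> h1 h2; rewrite /elliptic mulrDr addrACA; congr (_ + _); last first.
  rewrite mulr_sumr -big_split; apply: eq_bigr => k _; rewrite h1 mulrDr; congr (_ + _).
  by rewrite mulrCA.
rewrite mulr_sumr -big_split; apply: eq_bigr => i _.
rewrite mulr_sumr -big_split; apply: eq_bigr => j _; rewrite h2 mulrDr; congr (_ + _).
by rewrite mulrCA.
Qed.

Definition sqdist c x : R := dot (x - c) (x - c).

Lemma dotE m (x y : 'rV[R]_m) : dot x y = \sum_i x 0 i * y 0 i.
Proof. by rewrite /dot mxE; apply: eq_bigr => i _; rewrite mxE. Qed.

Lemma dot_ge0 m (x : 'rV[R]_m) : 0 <= dot x x.
Proof. by rewrite dotE; apply: sumr_ge0 => i _; rewrite -expr2 sqr_ge0. Qed.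

Lemma dot_eq0 m (x : 'rV[R]_m) : (dot x x == 0) = (x == 0).
Proof.
apply/idP/eqP => [|->]; last by rewrite dotE big1 // => i _; rewrite mxE mul0r.
rewrite dotE psumr_eq0; last by move=> i _; rewrite -expr2 sqr_ge0.
move=> /allP h; apply/rowP => i; rewrite [RHS]mxE.
by have := h i (mem_index_enum _); rewrite /= -expr2 sqrf_eq0 => /eqP.
Qed.

Lemma dot_gt0 m (x : 'rV[R]_m) : x != 0 -> 0 < dot x x.
Proof. by move=> x0; rewrite lt_neqAle dot_ge0 eq_sym dot_eq0 x0. Qed.

Lemma dotDD m (x y : 'rV[R]_m) : dot (x + y) (x + y) = dot x x + 2 * dot x y + dot y y.
Proof.
rewrite !dotE mulr_sumr -!big_split /=; apply: eq_bigr => i _; rewrite !mxE; ring.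
Qed.

Lemma dotBB m (x y : 'rV[R]_m) : dot (x - y) (x - y) = dot x x - 2 * dot x y + dot y y.
Proof.
rewrite !dotE mulr_sumr -sumrN -!big_split /=; apply: eq_bigr => i _; rewrite !mxE; ring.
Qed.

Lemma entry_norm m (x : 'rV[R]_m) i : `|x 0 i| <= `|x|.
Proof. by rewrite [leRHS]mx_normrE; apply: (le_bigmax _ (fun ij => `|x ij.1 ij.2|) (0, i)). Qed.

Lemma norm_le_entry m (x : 'rV[R]_m) e : 0 <= e -> (forall i, `|x 0 i| <= e) -> `|x| <= e.
Proof.
by move=> e0 h; rewrite [leLHS]mx_normrE; apply: bigmax_le => // -[i j] _ /=; rewrite ord1.
Qed.

Lemma dot_le_norm m (x : 'rV[R]_m) : dot x x <= m%:R * `|x| ^+ 2.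
Proof.
rewrite dotE -[m in m%:R]card_ord -sum1_card natr_sum mulr_suml; apply: ler_sum => i _.
by rewrite mul1r -expr2 -real_normK ?num_real // lerXn2r ?nnegrE // entry_norm.
Qed.

Lemma norm_le_dot m (x : 'rV[R]_m) : `|x| ^+ 2 <= dot x x.
Proof.
rewrite -[leRHS]sqr_sqrtr ?dot_ge0 // lerXn2r ?nnegrE ?sqrtr_ge0 //.
apply: norm_le_entry; first exact: sqrtr_ge0.
move=> i; rewrite -(ler_pXn2r (ltn0Sn 1)) ?nnegrE ?sqrtr_ge0 // sqr_sqrtr ?dot_ge0 //.
rewrite real_normK ?num_real // dotE (bigD1 i) //= -expr2 lerDl.
by apply: sumr_ge0 => j _; rewrite -expr2 sqr_ge0.
Qed.

Lemma differentiable_sqdist c x : differentiable (sqdist c) x.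
Proof.
have dB : differentiable (fun y => y - c) x by apply: differentiableB.
apply: (@differentiable_entry _ _ _ _ (fun y => (y - c) *m (y - c)^T)).
by apply: differentiable_mulmx => //; exact: differentiable_trmx.
Qed.

Lemma partial_sqdist c x i : is_derive x (delta_mx 0 i) (sqdist c) (2 * (x - c) 0 i).
Proof.
have dB : is_derive x (delta_mx 0 i) (fun y => y - c) (delta_mx 0 i).
  by apply: is_derive_eq; rewrite subr0.
have h := is_derive_mulmx dB (is_derive_trmx dB).
have := is_derive_entry 0 0 h.
rewrite mxE -[X in _ + X]/(dot (x - c) (delta_mx 0 i)) -[X in X + _]/(dot (delta_mx 0 i) (x - c)).
have e : dot (x - c) (delta_mx 0 i) = (x - c) 0 i.
  by rewrite dotE (bigD1 i) //= big1 ?addr0 ?mxE ?eqxx ?mulr1 // => j /negbTE ji; rewrite !mxE ji mulr0.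
have -> : dot (delta_mx 0 i) (x - c) = (x - c) 0 i.
  by rewrite -e !dotE; apply: eq_bigr => j _; rewrite mulrC.
by rewrite e mulr2n mulrDl mul1r.
Qed.

Variables (al : R) (c0 : 'rV[R]_n). 
  Let E y := expR (- al * sqdist c0 y).

Lemma is_derive_gauss x i : is_derive x (delta_mx 0 i) E (- 2 * al * (x - c0) 0 i * E x).
Proof.
have h : is_derive x (delta_mx 0 i) (fun y => - al * sqdist c0 y) (- al * (2 * (x - c0) 0 i)).
  by have := partial_sqdist c0 x i => ?; exact: is_deriveZ.
have d : differentiable (fun y => - al * sqdist c0 y) x.
  by apply: differentiableZ; exact: differentiable_sqdist.
have := is_derive_expR_comp d h.
by have -> : - al * (2 * (x - c0) 0 i) = - 2 * al * (x - c0) 0 i by ring.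
Qed.
Lemma differentiable_gauss x : differentiable E x.
Proof.
apply: (@differentiable_comp _ _ _ _ (fun y => - al * sqdist c0 y) expR).
  by apply: differentiableZ; exact: differentiable_sqdist.
by apply/derivable1_diffP; exact: derivable_expR.
Qed.

Lemma partial_gauss i : partial i E = fun x => - 2 * al * (x - c0) 0 i * E x.
Proof. by apply/funext => x; have [] := is_derive_gauss x i. Qed.

Lemma differentiable_partial_gauss x i : differentiable (partial i E) x.
Proof.
rewrite partial_gauss; apply: differentiableM; last exact: differentiable_gauss.
apply: differentiableM; first exact: differentiable_cst.
by apply: (@differentiable_entry _ _ _ _ (fun y => y - c0)); exact: differentiableB.
Qed.

Lemma partial2_gauss x i j :
  partial i (partial j E) x = (4 * al ^+ 2 * (x - c0) 0 i * (x - c0) 0 j - 2 * al * (i == j)%:R) * E x.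
Proof.
rewrite partial_gauss.
have dB : is_derive x (delta_mx 0 i) (fun y => y - c0) (delta_mx 0 i).
  by apply: is_derive_eq; rewrite subr0.
have dBj := is_derive_entry 0 j dB.
have dE := is_derive_gauss x i.
have h : is_derive x (delta_mx 0 i) ((fun y => - 2 * al * (y - c0) 0 j) * E)
  ((- 2 * al * (x - c0) 0 j) *: (- 2 * al * (x - c0) 0 i * E x) + E x *: ((- 2 * al) *: (delta_mx 0 i : 'rV[R]_n) 0 j)).
  apply: is_deriveM; exact: is_deriveZ.
rewrite /partial -[LHS]/('D_(delta_mx 0 i) ((fun y => - 2 * al * (y - c0) 0 j) * E) x) h.(derive_val).
have -> : (delta_mx 0 i : 'rV[R]_n) 0 j = (i == j)%:R by rewrite mxE eqxx eq_sym.
set p := (x - c0) 0 i; set q := (x - c0) 0 j; set d : R := _%:R; set e := E x.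
change (- 2 * al * q * (- 2 * al * p * e) + e * (- 2 * al * d) = (4 * al ^+ 2 * p * q - 2 * al * d) * e).
ring.
Qed.

(** The quadratic form of [a] comes with [al ^+ 2] and everything else with [al], so that a large
    [al] makes the value positive away from [c0]. *)
Lemma elliptic_gauss (a : 'M[R]_n) b x :
  elliptic a b E x = (4 * al ^+ 2 * ((x - c0) *m a *m (x - c0)^T) 0 0
     - 2 * al * (\tr a + dot b (x - c0))) * E x.
Proof.
rewrite /elliptic.
under eq_bigr do under eq_bigr do rewrite partial2_gauss.
have -> : \sum_(k < n) b 0 k * partial k E x = - 2 * al * dot b (x - c0) * E x.
  rewrite dotE mulr_sumr mulr_suml; apply: eq_bigr => k _; rewrite partial_gauss; ring.
have -> : \sum_(i < n) \sum_(j < n) a i j * ((4 * al ^+ 2 * (x - c0) 0 i * (x - c0) 0 j - 2 * al * (i == j)%:R) * E x)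
  = (4 * al ^+ 2 * ((x - c0) *m a *m (x - c0)^T) 0 0 - 2 * al * \tr a) * E x.
  have -> : ((x - c0) *m a *m (x - c0)^T) 0 0 = \sum_(i < n) \sum_(j < n) a i j * (x - c0) 0 i * (x - c0) 0 j.
    rewrite exchange_big mxE; apply: eq_bigr => j _; rewrite [X in X * _]mxE mulr_suml.
    by apply: eq_bigr => i _; rewrite [(_ ^T) _ _]mxE; ring.
  rewrite /mxtrace mulrBl !mulr_sumr !mulr_suml -sumrB; apply: eq_bigr => i _.
  have -> : 2 * al * a i i * E x = \sum_(j < n) 2 * al * a i j * (i == j)%:R * E x.
    rewrite (bigD1 i) //= big1 ?addr0 ?eqxx ?mulr1 // => j /negbTE; by rewrite eq_sym => ->; rewrite mulr0 mul0r.
  rewrite mulr_sumr mulr_suml -sumrB; apply: eq_bigr => j _; ring.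
ring.
Qed.
End MaximumPrinciple.

Lemma compact_superlevel (R : realType) (T : topologicalType) (A : set T) (u : T -> R) m :
  compact A -> closed A -> (forall y, A y -> {for y, continuous u}) ->
  compact (A `&` [set y | m <= u y]).
Proof.
move=> cA clA cu; apply: (subclosed_compact _ cA); last by move=> y [].
move=> y cy.
have Ay : A y by apply: clA => N /cy [z [[Az _] Nz]]; exists z.
split => //=; rewrite leNgt; apply/negP => um.
have /cy[z [[_ /= mz] zm]] : \forall z \near y, u z < m by exact: (cvgr_lt _ (cu y Ay)).
by move: (lt_le_trans zm mz); rewrite ltxx.
Qed.

Lemma continuous_norm_sub (R : realType) n (y z : 'rV[R]_n) :
  {for z, continuous (fun w : 'rV[R]_n => `|w - y|)}.
Proof.
have h : {for z, continuous (fun w : 'rV[R]_n => w - y)}.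
  by apply: differentiable_continuous; apply: differentiableB.
by apply: (continuous_comp h); exact: norm_continuous.
Qed.

Lemma near_norm_sub (R : realType) n (x : 'rV[R]_n) (d : R) :
  0 < d -> \forall y \near x, `|y - x| < d.
Proof.
move=> d0; have := nbhsx_ballx x d d0; apply: filterS => y.
by rewrite -ball_normE /= distrC.
Qed.

Lemma closed_norm_ball (R : realType) n (y : 'rV[R]_n) s :
  closed [set z : 'rV[R]_n | `|z - y| <= s].
Proof.
have cf : continuous (fun z : 'rV[R]_n => `|z - y|) by move=> z; exact: continuous_norm_sub.
apply: (@preimage_closed _ _ (fun z : 'rV[R]_n => `|z - y|) [set t | t <= s]) => [z _|].
  exact: cf.
exact: closed_le.
Qed.

Lemma compact_norm_ball (R : realType) n (y : 'rV[R]_n) s :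
  compact [set z : 'rV[R]_n | `|z - y| <= s].
Proof.
apply: bounded_closed_compact; last exact: closed_norm_ball.
exists (`|y| + s); split; first exact: num_real.
move=> t ht z /= zs; apply/ltW/le_lt_trans/ht.
have -> : z = y + (z - y) by rewrite addrC subrK.
by apply: le_trans (ler_normD _ _) _; rewrite lerD2l.
Qed.

Section StrongMaximum.
Context {R : realType} {n : nat}.
Variables (U : set 'rV[R]_n) (u : 'rV[R]_n -> R) (a : 'rV[R]_n -> 'M[R]_n)
  (b : 'rV[R]_n -> 'rV[R]_n) (m : R).
Hypothesis oU : open U.
Hypothesis du : forall y, U y -> differentiable u y.
Hypothesis ddu : forall y i, U y -> differentiable (partial i u) y.
Hypothesis ca : forall y, U y -> differentiable a y.
Hypothesis cb : forall y, U y -> differentiable b y.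
Hypothesis sa : forall y, U y -> exists2 T : 'M[R]_n, a y = T^T *m T & T \in unitmx.
Hypothesis Lu : forall y, U y -> elliptic (a y) (b y) u y = 0.
Hypothesis um : forall y, U y -> u y <= m.

(* Hopf's barrier: near [y1] the function [u + eps * exp (- al * |z - c|^2)] has an interior
   maximum, where the elliptic operator would have to be nonpositive. *)
Lemma touching_ball (c y1 : 'rV[R]_n) (s0 : R) : 0 < s0 ->
  (forall z, `|z - y1| <= s0 -> U z) -> y1 != c -> u y1 = m ->
  (forall z, `|z - y1| <= s0 -> z != y1 -> sqdist c z <= sqdist c y1 -> u z < m) -> False.
Proof.
move=> s00 hU yc uy hlt.
(* The bound by half the distance keeps the ball [Om] away from [c], where the quadratic term of
   [elliptic_gauss] degenerates. *)
pose s := Num.min s0 (`|y1 - c| / 2).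
have yc0 : 0 < `|y1 - c| by rewrite normr_gt0 subr_eq0.
have s_gt0 : 0 < s by rewrite lt_min s00 divr_gt0.
have [ss0 ssc] : s <= s0 /\ s < `|y1 - c|.
  by rewrite /s ge_min lexx gt_min; split=> //; rewrite ltr_pdivrMr // ltr_pMr // ltr1n orbT.
pose Om := [set z : 'rV[R]_n | `|z - y1| <= s].
have cOm : compact Om by exact: compact_norm_ball.
have clOm : closed Om by exact: closed_norm_ball.
have OmU z : Om z -> U z by move=> zs; apply: hU; exact: le_trans ss0.
have Omc z : Om z -> z - c != 0.
  rewrite subr_eq0 /Om /= => zs; apply/eqP => zc; move: zs; rewrite zc distrC.
  by move=> /(lt_le_trans ssc); rewrite ltxx.
have Om1 : Om y1 by rewrite /Om /= subrr normr0 ltW.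
pose k z := ((z - c) *m a z *m (z - c)^T) 0 0.
pose g z := \tr (a z) + dot (b z) (z - c).
have dB (z : 'rV[R]_n) : differentiable (fun y : 'rV[R]_n => y - c) z by apply: differentiableB.
have dk z : U z -> differentiable k z.
  move=> Uz; apply: (@differentiable_entry _ _ _ _ (fun z => (z - c) *m a z *m (z - c)^T)).
  apply: differentiable_mulmx; first by apply: differentiable_mulmx => //; exact: ca.
  exact: differentiable_trmx.
have dg z : U z -> differentiable g z.
  move=> Uz; apply: differentiableD.
    by apply: differentiable_bigsum => i; apply: differentiable_entry; exact: ca.
  apply: (@differentiable_entry _ _ _ _ (fun z => b z *m (z - c)^T)).
  by apply: differentiable_mulmx; [exact: cb | exact: differentiable_trmx].
have within_diff f : (forall z, U z -> differentiable f z) -> {within Om, continuous (f : 'rV[R]_n -> R)}.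
  move=> df; apply: continuous_in_subspaceT => z; rewrite inE => /OmU Uz.
  exact: differentiable_continuous (df z Uz).
have [zk /set_mem Omzk hk] := compact_EVT_min (ex_intro _ _ Om1) cOm (within_diff _ dk).
have kpos : 0 < k zk.
  have [T aE Tu] := sa (OmU _ Omzk).
  have -> : k zk = dot ((zk - c) *m T^T) ((zk - c) *m T^T).
    by rewrite /k /dot aE trmx_mul trmxK !mulmxA.
  apply: dot_gt0; apply: contra_neq (Omc _ Omzk) => e.
  have Ttu : T^T \in unitmx by rewrite unitmx_tr.
  by rewrite -[zk - c](mulmxK Ttu) e mul0mx.
have [zg /set_mem Omzg hg] := compact_EVT_max (ex_intro _ _ Om1) cOm (within_diff _ dg).
(* By [elliptic_gauss], positivity on [Om] amounts to 2 al k > g. With [k zk] the minimum of [k] and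
   [g zg] the maximum of [g], this choice gives al k >= |g zg| + 1 everywhere. *)
pose al := (`|g zg| + 1) / k zk.
have al0 : 0 < al by rewrite divr_gt0 // ltr_wpDl.
pose E z := expR (- al * sqdist c z).
have LE z : Om z -> 0 < elliptic (a z) (b z) E z.
  move=> Omz; rewrite elliptic_gauss -/(k z) -/(g z) mulr_gt0 ?expR_gt0 //.
  have h1 : k zk <= k z by apply: hk; rewrite inE.
  have h2 : g z <= g zg by apply: hg; rewrite inE.
  have h3 : al * k zk = `|g zg| + 1 by rewrite /al mulfVK // gt_eqF.
  have h4 : g zg <= `|g zg| := ler_norm _.
  have h5 : al * k zk <= al * k z by rewrite ler_pM2l.
  have : 0 < 2 * al * (2 * (al * k z) - g z).
    have aux (X Y N g' G : R) : 0 <= N -> X = N + 1 -> X <= Y -> g' <= G -> G <= N ->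
        0 < 2 * Y - g' by lra.
    apply: mulr_gt0; first by rewrite mulr_gt0.
    by apply: aux h3 h5 h2 h4; exact: normr_ge0.
  by congr (0 < _); ring.
(* The boundary of [Om] splits in two. On the part inside the ball around [c], [u] stays below [m]
   by a margin [eps], which [E z - E y1 <= 1] cannot make up; on the rest [E] is below its value at
   [y1]. So the maximum of [v] is interior. *)
pose S := Om `&` [set z | s <= `|z - y1|] `&` [set z | - sqdist c y1 <= - sqdist c z].
have cS : compact S.
  have c1 : compact (Om `&` [set z | s <= `|z - y1|]).
    by apply: compact_superlevel => // z _; exact: continuous_norm_sub.
  apply: compact_superlevel => //; first exact: (compact_closed (@norm_hausdorff _ _) c1).
  by move=> z _; apply/differentiable_continuous/differentiableN/differentiable_sqdist.
have [eps eps0 heps] : exists2 e : R, 0 < e & forall z, S z -> u z + e < m.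
  have [[z0 Sz0]|/set0P/negP/negPn/eqP S0] := pselect (S !=set0); last first.
    by exists 1 => // z; rewrite S0.
  have [|zs /set_mem Szs hs] := compact_EVT_max (ex_intro _ _ Sz0) cS (f := u).
    apply: continuous_in_subspaceT => z; rewrite inE => -[[/OmU Uz _] _].
    exact: differentiable_continuous (du Uz).
  have uzs : u zs < m.
    case: Szs => -[Omz /= sz]; rewrite /= lerN2 => dz; apply: hlt => //.
      exact: le_trans ss0.
    by apply/eqP => e; move: sz; rewrite e subrr normr0 leNgt s_gt0.
  exists ((m - u zs) / 2); first by rewrite divr_gt0 // subr_gt0.
  by move=> z Sz; have := hs z (mem_set Sz); lra.
pose v z := u z + eps * (E z - E y1).
have dE z : differentiable E z by exact: differentiable_gauss.
have dv z : U z -> differentiable v z.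
  move=> Uz; apply: differentiableD; first exact: du.
  by apply: differentiableZ; apply: differentiableB.
have [zv /set_mem Omzv hv] := compact_EVT_max (ex_intro _ _ Om1) cOm (within_diff _ dv).
have vm : m <= v zv.
  by apply: le_trans (hv y1 (mem_set Om1)); rewrite /v subrr mulr0 addr0 uy.
have interior : `|zv - y1| < s.
  rewrite ltNge; apply/negP => sz.
  have [dz|dz] := leP (sqdist c zv) (sqdist c y1).
    have : u zv + eps < m by apply: heps; split; [split|rewrite /= lerN2].
    have : E zv - E y1 <= 1.
      have : 0 < E y1 by exact: expR_gt0.
      have : E zv <= 1.
        rewrite -expR0 ler_expR mulNr oppr_le0 mulr_ge0 ?(ltW al0) //; exact: dot_ge0.
      by lra.
    rewrite -(ler_pM2l eps0) mulr1; move: vm; rewrite /v; lra.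
  have : E zv < E y1 by rewrite ltr_expR !mulNr ltrN2 ltr_pM2l.
  rewrite -subr_lt0 -(pmulr_rlt0 _ eps0); have := um (OmU _ Omzv); move: vm; rewrite /v; lra.
have Uzv := OmU _ Omzv.
have nearU : \forall z \near zv, U z by exact: open_nbhs_nbhs.
have pv j z : U z -> is_derive z (delta_mx 0 j) v (partial j u z + eps * partial j E z).
  move=> Uz.
  have h1 : is_derive z (delta_mx 0 j) u (partial j u z) by apply/derivableP/diff_derivable/du.
  have h2 : is_derive z (delta_mx 0 j) E (partial j E z) by apply/derivableP/diff_derivable.
  have h3 : is_derive z (delta_mx 0 j) (fun z => E z - E y1) (partial j E z).
    by apply: is_derive_eq; rewrite subr0.
  by apply: is_deriveD; exact: is_deriveZ.
have dpE j z : differentiable (partial j E) z by exact: differentiable_partial_gauss.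
have nearpv j : \forall z \near zv, partial j u z + eps * partial j E z = partial j v z.
  by apply: filterS nearU => z Uz; have [_ <-] := pv j z Uz.
have dsum j : differentiable (fun z => partial j u z + eps * partial j E z) zv.
  by apply: differentiableD; [exact: ddu | exact: differentiableZ].
have ppv i j : partial i (partial j v) zv = partial i (partial j u) zv + eps * partial i (partial j E) zv.
  rewrite {1}/partial -(near_eq_derive _ (nearpv j)).
  have h1 : is_derive zv (delta_mx 0 i) (partial j u) (partial i (partial j u) zv).
    by apply/derivableP/diff_derivable/ddu.
  have h2 : is_derive zv (delta_mx 0 i) (partial j E) (partial i (partial j E) zv).
    by apply/derivableP/diff_derivable.
  have h3 : is_derive zv (delta_mx 0 i) (fun z => partial j u z + eps * partial j E z)
      (partial i (partial j u) zv + eps * partial i (partial j E) zv).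
    by apply: is_deriveD; exact: is_deriveZ.
  by rewrite h3.(derive_val).
have [T aE _] := sa Uzv.
have : elliptic (a zv) (b zv) v zv <= 0.
  apply: elliptic_local_max aE.
  - by apply: filterS nearU => z Uz; exact: dv.
  - by move=> j; exact: near_eq_differentiable (nearpv j) (dsum j).
  have : \forall z \near zv, `|z - y1| < s.
    have : 0 < s - `|zv - y1| by rewrite subr_gt0.
    move=> /(near_norm_sub zv); apply: filterS => z.
    by move=> h; apply: le_lt_trans (ler_distD zv _ _) _; rewrite -ltrBrDr.
  by apply: filterS => z /ltW zs; apply: hv; rewrite inE.
apply/negP; rewrite -ltNge.
have -> : elliptic (a zv) (b zv) v zv = elliptic (a zv) (b zv) u zv + eps * elliptic (a zv) (b zv) E zv.
  by apply: elliptic_combination ppv => j; rewrite (nbhs_singleton (nearpv j)).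
by rewrite Lu // add0r mulr_gt0 // LE.
Qed.

(** If [u] were below [m] at some [x0] near [x], let [y1] be a point of the set u = m closest to
    [x0] in the Euclidean distance. A ball around [x0] then touches this set at [y1], which
    [touching_ball] excludes. *)
Lemma strong_max x : U x -> u x = m -> \forall y \near x, u y = m.
Proof.
move=> Ux ux.
have [r r0 hr] : exists2 r : R, 0 < r & forall z, `|z - x| < r -> U z.
  have : \forall z \near x, U z by exact: open_nbhs_nbhs.
  rewrite (near_shift 0) subr0 => /nbhs0_radius[r r0 h]; exists r => // z zr.
  by have := h (z - x) zr; rewrite /= subrK.
(* The distance to be minimized is Euclidean while the norm is the maximum norm. The factor n + 1
   bounds their ratio and keeps [y1] in the interior of [Bx]. *)
pose de := r / (4 * (n%:R + 1)).
have n1 : (0 : R) < n%:R + 1 by rewrite ltr_wpDl.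
have de0 : 0 < de by rewrite divr_gt0 // mulr_gt0.
have : \forall y \near x, `|y - x| < de.
  exact: near_norm_sub.
apply: filterS => x0 x0d.
apply: contrapT => ux0.
pose Bx := [set z : 'rV[R]_n | `|z - x| <= r / 2].
have BU z : Bx z -> U z.
  by move=> /= zb; apply: hr; apply: le_lt_trans zb _; rewrite ltr_pdivrMr // ltr_pMr // ltr1n.
pose K := Bx `&` [set z | m <= u z].
have cK : compact K.
  apply: compact_superlevel; [exact: compact_norm_ball|exact: closed_norm_ball|].
  by move=> z /BU/du; exact: differentiable_continuous.
have Kx : K x.
  by split; rewrite /= ?ux // /Bx /= subrr normr0 divr_ge0 // ltW.
have [|y1 /set_mem[By1 /= my1] hy1] := compact_EVT_min (ex_intro _ _ Kx) cK (f := sqdist x0).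
  by apply: continuous_in_subspaceT => z _; exact/differentiable_continuous/differentiable_sqdist.
have uy1 : u y1 = m by apply/eqP; rewrite eq_le my1 um //; exact: BU.
have y1d : `|y1 - x0| <= (n%:R + 1) * de.
  have nde : 0 <= (n%:R + 1) * de by rewrite mulr_ge0 ?(ltW n1) ?(ltW de0).
  rewrite -(ler_pXn2r (ltn0Sn 1)) ?nnegrE //.
  apply: le_trans (norm_le_dot _) _.
  apply: le_trans (hy1 x (mem_set Kx)) _; apply: le_trans (dot_le_norm _) _.
  have : `|x - x0| ^+ 2 <= de ^+ 2 by rewrite lerXn2r ?nnegrE // ?ltW // distrC.
  have : (0 : R) <= n%:R by [].
  have := sqr_ge0 de; nra.
have y1x0 : y1 != x0 by apply/eqP => e; apply: ux0; rewrite -e.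
have ltm z : Bx z -> sqdist x0 z < sqdist x0 y1 -> u z < m.
  move=> Bz dz; rewrite ltNge; apply/negP => mz.
  have := hy1 z; rewrite inE => /(_ (conj Bz mz)) /(lt_le_trans dz); by rewrite ltxx.
(* Halving the ball around [x0] gives one that meets the boundary of the larger ball only at [y1],
   so [u < m] holds on all the rest of it. *)
pose c := 2^-1 *: (x0 + y1).
pose e := 2^-1 *: (y1 - x0).
have ce : c = x0 + e.
  by rewrite /c /e; apply/rowP => i; rewrite !mxE; field.
have ye : y1 = c + e by rewrite /c /e; apply/rowP => i; rewrite !mxE; field.
have y1x : `|y1 - x| < r / 2.
  have : (n%:R + 1) * de = r / 4 by rewrite /de; field; rewrite gt_eqF.
  have : de <= r / 4 by rewrite /de ler_pdivrMr ?mulr_gt0 //; have : (0 : R) <= n%:R by []; nra.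
  move=> d4 n4; apply: le_lt_trans (ler_distD x0 _ _) _.
  have -> : r / 2 = r / 4 + r / 4 by field.
  by apply: ler_ltD; [rewrite -n4 | apply: lt_le_trans d4].
have e0 : e != 0.
  by rewrite /e scaler_eq0 invr_eq0 pnatr_eq0 /= subr_eq0.
apply: (@touching_ball c y1 (r / 2 - `|y1 - x|)).
- by rewrite subr_gt0.
- move=> z zs; apply: BU => /=.
  by apply: le_trans (ler_distD y1 _ _) _; rewrite -lerBrDr.
- by rewrite ye -subr_eq0 (addrC c) addrK.
- exact: uy1.
move=> z zs zy1 dz; apply: ltm => /=.
  by rewrite /Bx /=; apply: le_trans (ler_distD y1 _ _) _; rewrite -lerBrDr.
move: dz; rewrite /sqdist; pose p := z - c.
have -> : z - x0 = p + e by rewrite /p ce opprD addrA addrNK.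
have -> : y1 - c = e by rewrite ye addrC addKr.
have -> : y1 - x0 = e + e by rewrite /e; apply/rowP => i; rewrite !mxE; field.
have pe : p - e != 0.
  by apply: contra_neq zy1 => /eqP; rewrite subr_eq0 /p subr_eq => /eqP ->; rewrite ye addrC.
have := dot_gt0 pe; rewrite -/p dotBB !dotDD; lra.
Qed.
End StrongMaximum.

(** * Geometry of immersed charts *)

Section Gram.
Context {R : realType} {n m : nat}.
Variable F : 'M[R]_(n, m).
Hypothesis freeF : row_free F.

Lemma gram_tr : (F *m F^T)^T = F *m F^T.
Proof. by rewrite trmx_mul trmxK. Qed.

Lemma gram_posdef (u : 'rV[R]_n) : u != 0 -> 0 < (u *m (F *m F^T) *m u^T) 0 0.
Proof.
move=> u0; have -> : u *m (F *m F^T) *m u^T = (u *m F) *m (u *m F)^T.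
  by rewrite trmx_mul !mulmxA.
apply: dot_gt0; apply: contra_neq u0 => e.
by apply: (row_free_inj freeF); rewrite e mul0mx.
Qed.

Lemma gram_unit : F *m F^T \in unitmx.
Proof.
rewrite -row_free_unit -kermx_eq0; apply/rowV0P => v /sub_kermxP vG.
apply/eqP; apply: contraT => /gram_posdef; rewrite vG mul0mx mxE ltxx //.
Qed.

Lemma gram_inv_tr : (invmx (F *m F^T))^T = invmx (F *m F^T).
Proof. by rewrite trmx_inv gram_tr. Qed.

Lemma gram_inv_factor : exists2 T : 'M[R]_n, invmx (F *m F^T) = T^T *m T & T \in unitmx.
Proof.
have [T hT] := cholesky gram_tr gram_posdef.
have Tu : T \in unitmx by case/mulmx1_unit: hT; rewrite unitmx_mul => /andP[].
exists T => //; apply: (can_inj (mulmxK gram_unit)); rewrite mulVmx ?gram_unit //.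
by rewrite -mulmxA; apply/esym; apply: mulmx1C.
Qed.
End Gram.

Section LocalImmersions.
Context {R : realType} {n m : nat}.
Variables (U : set 'rV[R]_n) (f : 'rV[R]_n -> 'rV[R]_m).
Hypothesis oU : open U.
Hypothesis smoothf : smooth_on U f.
Hypothesis freef : forall x, U x -> row_free (frame f x).

Definition hess (i : 'I_n) x : 'M[R]_(n, m) := \matrix_(j < n) partial i (partial j f) x.
(* [conn i x j k] is the Christoffel symbol Gamma^k_ij (see [christoffelE]). *)
Definition conn (i : 'I_n) x : 'M[R]_n :=
  hess i x *m (frame f x)^T *m invmx (induced_metric f x).

Local Notation F := (frame f).
Local Notation G := (induced_metric f).
Local Notation P := (fun x => invmx (induced_metric f x)).
Local Notation e_ i := (delta_mx 0 i : 'rV[R]_n).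

Lemma near_dom x : U x -> \forall y \near x, U y.
Proof. by move=> Ux; exact: open_nbhs_nbhs. Qed.

Lemma smooth0 x : U x -> differentiable f x.
Proof. exact: (smoothf [::]). Qed.
Lemma smooth1 i x : U x -> differentiable (partial i f) x.
Proof. exact: (smoothf [:: i]). Qed.
Lemma smooth2 i j x : U x -> differentiable (partial i (partial j f)) x.
Proof. exact: (smoothf [:: i; j]). Qed.

Lemma is_derive_partial (W : normedModType R) (g : 'rV[R]_n -> W) i x :
  differentiable g x -> is_derive x (e_ i) g (partial i g x).
Proof. by move=> dg; apply/derivableP/diff_derivable. Qed.

Lemma partial_eq (W : normedModType R) (g h : 'rV[R]_n -> W) i x dh :
  U x -> (forall y, U y -> g y = h y) -> is_derive x (e_ i) h dh -> partial i g x = dh.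
Proof.
move=> Ux gh [_ <-]; apply: near_eq_derive.
by apply: filterS (near_dom Ux) => y; exact: gh.
Qed.

Lemma partial_swap (g : 'rV[R]_n -> 'rV[R]_m) i j x :
  (forall y, U y -> differentiable g y) ->
  (forall k y, U y -> differentiable (partial k g) y) -> U x ->
  partial i (partial j g) x = partial j (partial i g) x.
Proof.
move=> dg ddg Ux; apply/rowP => a.
pose ga y := g y 0 a.
have dga y : U y -> differentiable ga y by move=> Uy; apply: differentiable_entry; exact: dg.
have pga k y : U y -> partial k g y 0 a = partial k ga y.
  by move=> Uy; have := is_derive_entry 0 a (is_derive_partial k (dg y Uy)) => -[_ <-].
have near_pga k : \forall y \near x, partial k g y 0 a = partial k ga y.
  by apply: filterS (near_dom Ux) => y; exact: pga.
have dpga k : differentiable (partial k ga) x.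
  by apply: near_eq_differentiable (near_pga k) _; apply: differentiable_entry; exact: ddg.
have e k l : partial k (partial l g) x 0 a = partial k (partial l ga) x.
  have [_ <-] := is_derive_entry 0 a (is_derive_partial k (ddg l x Ux)).
  exact: near_eq_derive.
have ndga : \forall y \near x, differentiable ga y.
  by apply: filterS (near_dom Ux) => y; exact: dga.
have sw : partial i (partial j ga) x = partial j (partial i ga) x.
  apply: derive_swap ndga _ _; [exact: dpga j | exact: dpga i].
apply: etrans (e i j) _; apply: etrans sw _; exact: esym (e j i).
Qed.

Lemma hess_swap i j x : U x -> row j (hess i x) = row i (hess j x).
Proof.
by move=> Ux; rewrite !rowK; apply: partial_swap => // [y|k y]; [exact: smooth0|exact: smooth1].
Qed.

Lemma is_derive_frame i x : U x -> is_derive x (e_ i) F (hess i x).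
Proof.
move=> Ux; apply: is_derive_mx => j a.
have -> : (fun y => F y j a) = (fun y => partial j f y 0 a).
  by apply/funext => y; rewrite mxE.
by rewrite mxE; apply: is_derive_entry; apply: is_derive_partial; exact: smooth1.
Qed.

Lemma differentiable_frame x : U x -> differentiable F x.
Proof.
move=> Ux; apply: differentiable_mx => j a.
have -> : (fun y => F y j a) = (fun y => partial j f y 0 a).
  by apply/funext => y; rewrite mxE.
by apply: differentiable_entry; exact: smooth1.
Qed.

Lemma differentiable_hess i x : U x -> differentiable (hess i) x.
Proof.
move=> Ux; apply: differentiable_mx => j a.
have -> : (fun y => hess i y j a) = (fun y => partial i (partial j f) y 0 a).
  by apply/funext => y; rewrite mxE.
by apply: differentiable_entry; exact: smooth2.
Qed.

Lemma metric_unit x : U x -> G x \in unitmx.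
Proof. by move=> /freef; exact: gram_unit. Qed.

Lemma metric_sym x i j : G x i j = G x j i.
Proof. by rewrite -{1}[G x]gram_tr mxE. Qed.

Lemma differentiable_metric x : U x -> differentiable G x.
Proof.
move=> Ux; apply: differentiable_mulmx; first exact: differentiable_frame.
by apply: differentiable_trmx; exact: differentiable_frame.
Qed.

Lemma differentiable_inv_metric x : U x -> differentiable P x.
Proof.
by move=> Ux; apply: differentiable_invmx; [exact: differentiable_metric|exact: metric_unit].
Qed.

Lemma differentiable_conn i x : U x -> differentiable (conn i) x.
Proof.
move=> Ux; apply: differentiable_mulmx; last exact: differentiable_inv_metric.
apply: differentiable_mulmx; first exact: differentiable_hess.
by apply: differentiable_trmx; exact: differentiable_frame.
Qed.

Lemma connG i x : U x -> conn i x *m G x = hess i x *m (F x)^T.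
Proof. by move=> Ux; rewrite /conn mulmxKV // metric_unit. Qed.

Lemma is_derive_metric i x : U x ->
  is_derive x (e_ i) G (conn i x *m G x + G x *m (conn i x)^T).
Proof.
move=> Ux; have dF := is_derive_frame i Ux.
have := is_derive_mulmx dF (is_derive_trmx dF); rewrite connG //.
have -> : G x *m (conn i x)^T = F x *m (hess i x)^T.
  by rewrite -[G x]gram_tr -trmx_mul connG // trmx_mul trmxK.
done.
Qed.

Lemma is_derive_inv_metric i x : U x ->
  is_derive x (e_ i) P (- (P x *m conn i x + (conn i x)^T *m P x)).
Proof.
move=> Ux; have Gu := metric_unit Ux.
have h := is_derive_invmx (differentiable_metric Ux) Gu (is_derive_metric i Ux).
have <- : - P x *m (conn i x *m G x + G x *m (conn i x)^T) *m P x
   = - (P x *m conn i x + (conn i x)^T *m P x); last exact: h.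
rewrite mulNmx mulNmx; congr (- _); rewrite mulmxDr mulmxDl; congr (_ + _).
  by rewrite mulmxA mulmxK.
by rewrite mulmxA mulVmx // mul1mx.
Qed.

Lemma conn_swap i j x : U x -> row j (conn i x) = row i (conn j x).
Proof. by move=> Ux; rewrite /conn !row_mul hess_swap. Qed.

(** With T i j l = <d_i d_j f, d_l f>, symmetric in i and j, the derivative of g_bc along d_a is T a
    b c + T a c b. In the Christoffel combination only two copies of T i j l survive. *)
Lemma christoffelE k i j x : U x -> christoffel G k i j x = conn i x j k.
Proof.
move=> Ux; pose T i j l := (hess i x *m (F x)^T) j l.
have Ts a b c : T a b c = T b a c.
  have r i' j' l : T i' j' l = (row j' (hess i' x) *m (F x)^T) 0 l.
    by rewrite -row_mul [RHS]mxE.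
  by rewrite (r a b) (r b a) hess_swap.
have dG a b c : partial a (fun y => G y b c) x = T a b c + T a c b.
  have := is_derive_entry b c (is_derive_metric a Ux) => -[_]; rewrite /partial => ->.
  rewrite connG // -[G x]gram_tr -trmx_mul connG // mxE; congr (_ + _); by rewrite mxE.
rewrite /christoffel.
under eq_bigr do rewrite !dG (Ts j i) (Ts _ i j) (Ts _ j i).
have -> : \sum_(l < n) invmx (G x) k l * (T i j l + T i l j + (T i j l + T j l i) - (T i l j + T j l i))
  = 2 * \sum_(l < n) T i j l * invmx (G x) l k.
  rewrite mulr_sumr; apply: eq_bigr => l _.
  have -> : invmx (G x) k l = invmx (G x) l k by rewrite -[in LHS]gram_inv_tr // mxE.
  ring.
by rewrite mulKf ?pnatr_eq0 // /conn [RHS]mxE.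
Qed.

(** The first-order coefficients - g^ik Gamma^l_ik of the Laplace-Beltrami operator; its
    second-order coefficients are the inverse metric. *)
Definition lap_drift x : 'rV[R]_n :=
  - \sum_(i < n) \sum_(k < n) invmx (G x) i k *: row k (conn i x).

Lemma differentiable_lap_drift x : U x -> differentiable lap_drift x.
Proof.
move=> Ux; apply: differentiableN.
apply: differentiable_bigsum => i; apply: differentiable_bigsum => k.
apply: differentiable_mx => a b.
have -> : (fun y => (invmx (G y) i k *: row k (conn i y)) a b)
   = (fun y => invmx (G y) i k) * (fun y => conn i y k b).
  by apply/funext => y; rewrite mxE [row k _ _ _]mxE.
apply: differentiableM; apply: differentiable_entry; [exact: differentiable_inv_metric|exact: differentiable_conn].
Qed.

Lemma second_formE x i k : second_form f x i k = row k (hess i x) - row k (conn i x) *m F x.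
Proof. by rewrite /second_form /normal_part /tangent_part rowK /conn !row_mul rowK. Qed.

Lemma second_form_normal x i k : U x -> second_form f x i k *m (F x)^T = 0.
Proof.
move=> Ux; rewrite second_formE mulmxBl -mulmxA -/(G x) -!row_mul connG //.
by rewrite subrr.
Qed.

Lemma mean_curvature_normal x : U x -> mean_curvature f x *m (F x)^T = 0.
Proof.
move=> Ux; rewrite /mean_curvature mulmx_suml big1 // => i _.
by rewrite mulmx_suml big1 // => j _; rewrite -scalemxAl second_form_normal // scaler0.
Qed.

Let u x := dot (f x) (f x).

Lemma is_derive_sqnorm i x : U x -> is_derive x (e_ i) u (2 * dot (partial i f x) (f x)).
Proof.
move=> Ux; have df := is_derive_partial i (smooth0 Ux).
have := is_derive_entry 0 0 (is_derive_mulmx df (is_derive_trmx df)).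
rewrite mxE -[X in _ + X]/(dot (f x) (partial i f x)).
have -> : dot (f x) (partial i f x) = dot (partial i f x) (f x).
  by rewrite !dotE; apply: eq_bigr => j _; rewrite mulrC.
by rewrite mulr2n mulrDl mul1r.
Qed.

Lemma differentiable_sqnorm x : U x -> differentiable u x.
Proof.
move=> Ux; apply: (@differentiable_entry _ _ _ _ (fun y => f y *m (f y)^T)).
by apply: differentiable_mulmx; [|apply: differentiable_trmx]; exact: smooth0.
Qed.

Lemma differentiable_dot (V : normedModType R) p (g h : V -> 'rV[R]_p) x :
  differentiable g x -> differentiable h x -> differentiable (fun y => dot (g y) (h y)) x.
Proof.
move=> dg dh; apply: (@differentiable_entry _ _ _ _ (fun y => g y *m (h y)^T)).
by apply: differentiable_mulmx => //; exact: differentiable_trmx.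
Qed.

Lemma partial_sqnorm i x : U x -> partial i u x = 2 * dot (partial i f x) (f x).
Proof. by move=> Ux; have [] := is_derive_sqnorm i Ux. Qed.

Lemma differentiable_partial_sqnorm x i : U x -> differentiable (partial i u) x.
Proof.
move=> Ux; apply: (@near_eq_differentiable _ _ _ (fun y => 2 * dot (partial i f y) (f y))).
  by apply: filterS (near_dom Ux) => y /partial_sqnorm ->.
by apply: differentiableZ; apply: differentiable_dot; [exact: smooth1|exact: smooth0].
Qed.

Lemma partial2_sqnorm i j x : U x -> partial i (partial j u) x =
  2 * (dot (partial i (partial j f) x) (f x) + G x i j).
Proof.
move=> Ux; apply: (@partial_eq _ _ (fun y => 2 * dot (partial j f y) (f y))) => //.
  by move=> y; exact: partial_sqnorm.
have d1 := is_derive_partial i (smooth1 j Ux); have d0 := is_derive_partial i (smooth0 Ux).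
have h := is_derive_entry 0 0 (is_derive_mulmx d1 (is_derive_trmx d0)).
have -> : dot (partial i (partial j f) x) (f x) + G x i j =
  (partial i (partial j f) x *m (f x)^T + partial j f x *m (partial i f x)^T) 0 0.
  rewrite [RHS]mxE; congr (_ + _).
  rewrite [LHS]mxE [RHS]mxE; apply: eq_bigr => a _.
  by rewrite [F x i a]mxE [(F x)^T a j]mxE [F x j a]mxE [(partial i f x)^T a 0]mxE mulrC.
exact: is_deriveZ.
Qed.

(** The Laplacian of the position vector is the mean curvature vector, and the trace of the metric
    against its inverse is n. *)
Lemma elliptic_sqnorm x : U x ->
  elliptic (P x) (lap_drift x) u x = 2 * (n%:R + dot (mean_curvature f x) (f x)).
Proof.
move=> Ux; rewrite /elliptic.
under eq_bigr do under eq_bigr do rewrite partial2_sqnorm //.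
under [X in _ + X]eq_bigr do rewrite partial_sqnorm //.
have trPG : \sum_(i < n) \sum_(j < n) invmx (G x) i j * G x i j = n%:R.
  rewrite -mxtrace1 -(mulVmx (metric_unit Ux)); apply: eq_bigr => i _; rewrite mxE.
  apply: eq_bigr => j _; congr (_ * _); exact: metric_sym.
have dr : \sum_(k < n) lap_drift x 0 k * dot (partial k f x) (f x) =
   - \sum_(i < n) \sum_(j < n) invmx (G x) i j * dot (row j (conn i x) *m F x) (f x).
  have e (w : 'rV[R]_n) : \sum_(k < n) w 0 k * dot (partial k f x) (f x) = dot (w *m F x) (f x).
    rewrite /dot -mulmxA mxE; apply: eq_bigr => k _; congr (_ * _).
    by rewrite [LHS]mxE [RHS]mxE; apply: eq_bigr => a _; congr (_ * _); rewrite mxE.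
  rewrite e /lap_drift mulNmx /dot mulNmx mxE; congr (- _).
  rewrite !mulmx_suml summxE; apply: eq_bigr => i _; rewrite !mulmx_suml summxE.
  by apply: eq_bigr => j _; rewrite -!scalemxAl mxE.
have hH : dot (mean_curvature f x) (f x) = \sum_(i < n) \sum_(j < n)
    invmx (G x) i j * (dot (partial i (partial j f) x) (f x) - dot (row j (conn i x) *m F x) (f x)).
  rewrite /mean_curvature /dot mulmx_suml summxE; apply: eq_bigr => i _.
  rewrite mulmx_suml summxE; apply: eq_bigr => j _.
  by rewrite -scalemxAl mxE second_formE rowK mulmxBl mxE; congr (_ * (_ + _)); rewrite mxE.
rewrite hH -trPG.
have -> : \sum_(k < n) lap_drift x 0 k * (2 * dot (partial k f x) (f x)) =
  2 * \sum_(k < n) lap_drift x 0 k * dot (partial k f x) (f x).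
  by rewrite mulr_sumr; apply: eq_bigr => k _; rewrite mulrCA.
rewrite dr mulrN -mulrN -!sumrN mulr_sumr -[in LHS]big_split -big_split /= mulr_sumr.
apply: eq_bigr => i _; rewrite -sumrN mulr_sumr -[in LHS]big_split -big_split /= mulr_sumr.
apply: eq_bigr => j _.
set A := dot _ _; set B := dot _ _; ring.
Qed.
End LocalImmersions.

(** * Lagrangian frames *)

Definition Jmx (R : realType) n : 'M[R]_(n + n) := block_mx 0 1%:M (- 1%:M) 0.

Lemma row_mul_col (R : pzRingType) m n p (A : 'M[R]_(m, n)) (B : 'M[R]_(n, p)) i j :
  (row i A *m col j B) 0 0 = (A *m B) i j.
Proof. by rewrite mxE [RHS]mxE; apply: eq_bigr => k _; rewrite !mxE. Qed.

Lemma row_form (R : pzRingType) m n p q (A : 'M[R]_(m, n)) (X : 'M[R]_(n, p)) (B : 'M[R]_(q, p)) i j :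
  (row i A *m X *m (row j B)^T) 0 0 = (A *m X *m B^T) i j.
Proof. by rewrite -row_mul tr_row row_mul_col. Qed.

Section LagrangianFrames.
Context {R : realType} {n : nat}.
Local Notation J := (Jmx R n).

Lemma Jmx_tr : J^T = - J.
Proof.
by rewrite /Jmx tr_block_mx linearN /= !trmx0 trmx1 opp_block_mx !oppr0 opprK.
Qed.

Lemma Jmx_sq : J *m J = - 1%:M.
Proof.
rewrite /Jmx mulmx_block !mul0mx !mulmx0 !add0r !addr0 mul1mx mulmx1.
have e k : - 1%:M = (-1)%:M :> 'M[R]_k by rewrite raddfN.
by rewrite !e -scalar_mx_block.
Qed.

Lemma JmapE (z : 'rV[R]_(n + n)) : Jmap z = z *m J.
Proof.
rewrite /Jmap -[in RHS](hsubmxK z) /Jmx mul_row_block !mulmx0 mulmx1 mulmxN mulmx1.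
by rewrite add0r addr0.
Qed.

Lemma mulJJ m (A : 'M[R]_(m, n + n)) : A *m J *m J = - A.
Proof. by rewrite -mulmxA Jmx_sq mulmxN mulmx1. Qed.

Lemma skew_form (z : 'rV[R]_(n + n)) (A : 'M[R]_(n + n)) : A^T = - A -> z *m A *m z^T = 0.
Proof.
move=> tA; have : (z *m A *m z^T)^T = - (z *m A *m z^T).
  by rewrite !trmx_mul trmxK tA mulNmx mulmxN mulmxA.
move/matrixP => /(_ 0 0); rewrite mxE [RHS]mxE => /eqP.
rewrite -addr_eq0 -mulr2n mulrn_eq0 /= => /eqP h; apply/matrixP => i j.
by rewrite !ord1 h mxE.
Qed.

Variable F : 'M[R]_(n, n + n).
Hypothesis freeF : row_free F.
Hypothesis lagF : F *m J *m F^T = 0.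
Local Notation G := (F *m F^T).
Local Notation P := (invmx (F *m F^T)).

Lemma PG1 : P *m G = 1%:M. Proof. by rewrite mulVmx // gram_unit. Qed.
Lemma GP1 : G *m P = 1%:M. Proof. by rewrite mulmxV // gram_unit. Qed.

(** By the Lagrangian condition the rows of [F] and [F *m J] form a basis of C^n with block diagonal
    Gram matrix. This is the resulting resolution of the identity; the minus sign is that of
    [J^T = - J]. *)
Lemma lagrangian_complete : F^T *m P *m F - J *m F^T *m P *m F *m J = 1%:M.
Proof.
pose A := col_mx F (F *m J); pose D := block_mx P 0 0 P.
have AA : A *m A^T = block_mx G 0 0 G.
  rewrite /A tr_col_mx mul_col_row trmx_mul Jmx_tr !mulNmx !mulmxN !mulmxA mulJJ lagF.
  by rewrite mulNmx opprK oppr0.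
have AD : A *m (A^T *m D) = 1%:M.
  rewrite mulmxA AA /D mulmx_block !mul0mx !mulmx0 !addr0 add0r GP1.
  by rewrite -scalar_mx_block.
have := mulmx1C AD; rewrite /A /D tr_col_mx mul_row_block !mulmx0 addr0 add0r mul_row_col.
by rewrite trmx_mul Jmx_tr !mulNmx !mulmxA.
Qed.

Lemma lagrangian_split m (A : 'M[R]_(m, n + n)) :
  A = (A *m F^T *m P) *m F - (A *m J *m F^T *m P) *m F *m J.
Proof. by rewrite -{1}[A]mulmx1 -lagrangian_complete mulmxBr !mulmxA. Qed.

Lemma lag_mul m p (A : 'M[R]_(m, n)) (B : 'M[R]_(n, p)) : A *m F *m J *m F^T *m B = 0.
Proof. by rewrite -!(mulmxA A) lagF mul0mx mulmx0. Qed.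

Variable C : 'I_n -> 'M[R]_n.
Hypothesis sC : symmetric_family C.

(* The complex linear extension to C^n of the tangent endomorphism with matrix [C i]. *)
Definition shape_op i : 'M[R]_(n + n) :=
  F^T *m P *m C i *m P *m F - J *m F^T *m P *m C i *m P *m F *m J.
Local Notation L := shape_op.

Lemma shape_op_tr i : (L i)^T = L i.
Proof.
have tP : P^T = P := gram_inv_tr F.
rewrite /L linearB /= !trmx_mul !trmxK tP (sC.1 i) Jmx_tr !mulNmx !mulmxN opprK !mulmxA.
by [].
Qed.

Lemma shape_opJ i : L i *m J = J *m L i.
Proof.
rewrite /L mulmxBl mulmxBr mulJJ opprK !mulmxA Jmx_sq !mulNmx mul1mx opprK addrC.
by [].
Qed.

Lemma frame_shape_op m (A : 'M[R]_(m, n)) i : A *m F *m L i = A *m C i *m P *m F.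
Proof.
rewrite /L mulmxBr !mulmxA -(mulmxA A F F^T) -(mulmxA A G P) GP1 mulmx1.
by rewrite lag_mul !mul0mx subr0.
Qed.

Lemma shape_op_mul i k :
  L i *m L k = F^T *m P *m (C i *m P *m C k) *m P *m F
    - J *m F^T *m P *m (C i *m P *m C k) *m P *m F *m J.
Proof.
rewrite {1}/L mulmxBl frame_shape_op.
have -> : J *m F^T *m P *m C i *m P *m F *m J *m L k = J *m F^T *m P *m C i *m P *m F *m L k *m J.
  by rewrite -!mulmxA -shape_opJ !mulmxA.
by rewrite frame_shape_op !mulmxA.
Qed.

Hypothesis CC : forall i j, C i *m P *m C j = C j *m P *m C i.

Lemma shape_op_comm i k : L i *m L k = L k *m L i.
Proof. by rewrite !shape_op_mul CC. Qed.

Variable z : 'rV[R]_(n + n).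
Hypothesis zF : z *m F^T = 0.
Local Notation w := (z *m J *m F^T *m P).
Hypothesis wC : \sum_k w 0 k *: C k = G.

Lemma normal_rot : z *m J = w *m F.
Proof. by rewrite {1}[z *m J]lagrangian_split mulJJ mulNmx zF oppr0 !mul0mx subr0. Qed.

(** The vector J z is tangent with coordinates [w], the unit of the algebra, and [L i] multiplies by
    the i-th frame vector. *)
Lemma row_shape_op i : z *m J *m L i = row i F.
Proof.
rewrite normal_rot frame_shape_op.
have -> : w *m C i = row i G.
  apply/rowP => j; transitivity ((C i *m w^T) j 0).
    have -> : C i *m w^T = (w *m C i)^T by rewrite [RHS]trmx_mul (sC.1 i).
    by rewrite [RHS]mxE.
  by rewrite family_unit // wC [RHS]mxE.
by rewrite -!row_mul GP1 mul1mx.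
Qed.

Variable N : R.
Hypothesis tC : forall k, \tr (C k *m P) = N * (w *m G) 0 k.

(** By associativity a product of two multiplications is a combination of single ones. Contracting
    with [P] turns its coefficients into traces, which [tC] identifies with N times the coordinates
    of the unit. *)
Lemma sum_shape_op : \sum_i \sum_k P i k *: (L i *m L k) = N *: 1%:M.
Proof.
have tP : P^T = P := gram_inv_tr F.
have e : \sum_i \sum_k P i k *: (C i *m P *m C k) = N *: G.
  have h i k : C i *m P *m C k = \sum_p (C i *m P) k p *: C p.
    by apply: (family_mul sC).
  rewrite -[in RHS]wC scaler_sumr.
  under eq_bigr do under eq_bigr do rewrite h scaler_sumr.
  under eq_bigr do rewrite exchange_big.
  rewrite exchange_big /=; apply: eq_bigr => p _.
  under eq_bigr do under eq_bigr do rewrite scalerA.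
  under eq_bigr do rewrite -scaler_suml.
  rewrite -scaler_suml scalerA; congr (_ *: _).
  transitivity (\sum_q \tr (C q *m P) * P q p).
    transitivity (\sum_i \sum_k \sum_q P i k * (C i k q * P q p)).
      apply: eq_bigr => i _; apply: eq_bigr => k _; rewrite mxE mulr_sumr.
      by apply: eq_bigr.
    under eq_bigr do rewrite exchange_big.
    rewrite exchange_big /=; apply: eq_bigr => q _; rewrite /mxtrace mulr_suml.
    apply: eq_bigr => i _; rewrite mxE mulr_suml; apply: eq_bigr => k _.
    have [_ _ ->] := family_entry i k q sC.
    have -> : C q k i = C q i k by have [_ -> _] := family_entry q k i sC.
    have -> : P k i = P i k by rewrite -{1}tP mxE.
    ring.
  under eq_bigr do rewrite tC.
  have -> : \sum_q N * (w *m G) 0 q * P q p = N * ((w *m G) *m P) 0 p.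
    by rewrite [X in _ = _ * X]mxE mulr_sumr; apply: eq_bigr => q _; rewrite mulrA.
  by rewrite -(mulmxA w) GP1 mulmx1.
transitivity (F^T *m P *m (\sum_i \sum_k P i k *: (C i *m P *m C k)) *m P *m F
   - J *m F^T *m P *m (\sum_i \sum_k P i k *: (C i *m P *m C k)) *m P *m F *m J).
  rewrite !(mulmx_sumr, mulmx_suml) -sumrB; apply: eq_bigr => i _.
  rewrite !(mulmx_sumr, mulmx_suml) -sumrB; apply: eq_bigr => k _.
  by rewrite shape_op_mul -!(scalemxAr, scalemxAl) -scalerBr.
rewrite e -!(scalemxAr, scalemxAl) -scalerBr; congr (_ *: _).
have e1 m (A : 'M[R]_(m, n)) : A *m P *m G *m P = A *m P.
  by rewrite -(mulmxA A P G) PG1 mulmx1.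
by rewrite -lagrangian_complete !e1.
Qed.

Section Projection.
Variable b : 'rV[R]_(n + n).
(* For a unit vector [b], the orthogonal projection onto the complex line through [b]. *)
Definition cproj : 'M[R]_(n + n) := b^T *m b - J *m b^T *m b *m J.

Lemma cproj_tr : cproj^T = cproj.
Proof.
rewrite /cproj linearB /= !trmx_mul !trmxK Jmx_tr !mulNmx !mulmxN opprK !mulmxA.
by [].
Qed.

Lemma cprojJ : cproj *m J = J *m cproj.
Proof.
rewrite /cproj mulmxBl mulmxBr mulJJ opprK !mulmxA Jmx_sq !mulNmx mul1mx opprK addrC.
by [].
Qed.

Hypothesis bb : b *m b^T = 1%:M.
Hypothesis LE : forall i, L i *m cproj = cproj *m L i.

Lemma bJb : b *m J *m b^T = 0.
Proof. exact: skew_form Jmx_tr. Qed.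

(** Commutation only puts [b *m L i] in the complex line through [b]; its component along J b
    vanishes because [L i *m J] is skew, so the eigenvalue is real. *)
Lemma eigen_shape_op i : exists l, b *m L i = l *: b.
Proof.
have bE : b *m cproj = b.
  by rewrite /cproj mulmxBr !mulmxA bb mul1mx bJb !mul0mx subr0.
exists ((b *m L i *m b^T) 0 0).
have sk : (L i *m J)^T = - (L i *m J).
  by rewrite trmx_mul shape_op_tr Jmx_tr mulNmx shape_opJ.
rewrite -{1}bE -mulmxA -LE mulmxA /cproj mulmxBr !mulmxA.
rewrite -(mulmxA b (L i) J) (skew_form b sk) !mul0mx subr0.
by rewrite {1}[b *m L i *m b^T]mx11_scalar mul_scalar_mx.
Qed.

(** Since [L i] sends J z to the i-th frame vector, the coordinates of [b] in the frames [F] and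
    [F *m J] are multiples of the vector [la] of its eigenvalues, with factors the components [al]
    and [be] of z. By [sum_shape_op], [la] has square norm N; expanding |b|^2 = 1 gives the
    claim. *)
Lemma cproj_value : N * (z *m cproj *m z^T) 0 0 = 1.
Proof.
have [l hl] := choice eigen_shape_op.
pose la : 'cV[R]_n := \col_i l i.
pose al := (z *m b^T) 0 0; pose be := (z *m J *m b^T) 0 0.
have Lb i : L i *m b^T = l i *: b^T.
  by rewrite -[L i]shape_op_tr -trmx_mul hl linearZ.
have alE : z *m b^T = al%:M by exact: mx11_scalar.
have beE : z *m J *m b^T = be%:M by exact: mx11_scalar.
have h1 : F *m b^T = be *: la.
  apply/row_matrixP => i; rewrite row_mul -row_shape_op -mulmxA Lb -scalemxAr beE.
  by apply/rowP => j; rewrite !mxE !ord1 eqxx mulr1n mulrC.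
have h2 : F *m J *m b^T = - (al *: la).
  apply/row_matrixP => i; rewrite !row_mul -row_shape_op -(mulmxA _ (L i)) shape_opJ.
  rewrite -!mulmxA Lb mulmxA mulmxA mulJJ -scalemxAr mulNmx alE.
  by apply/rowP => j; rewrite !mxE !ord1 eqxx mulr1n mulrN mulrC.
have h3 : (la^T *m P *m la) 0 0 = N.
  have s : b *m (\sum_i \sum_k P i k *: (L i *m L k)) *m b^T
      = (\sum_i \sum_k P i k * (l i * l k))%:M.
    rewrite mulmx_sumr mulmx_suml [RHS]raddf_sum; apply: eq_bigr => i _.
    rewrite mulmx_sumr mulmx_suml [RHS]raddf_sum; apply: eq_bigr => k _.
    rewrite -scalemxAr -scalemxAl mulmxA hl -mulmxA Lb -scalemxAl -scalemxAr bb.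
    by rewrite !scalerA scalemx1 mulrA.
  have : (\sum_i \sum_k P i k * (l i * l k))%:M = N%:M :> 'M[R]_1.
    by rewrite -s sum_shape_op -scalemxAr -scalemxAl mulmx1 bb scalemx1.
  move=> /matrixP /(_ 0 0); rewrite [LHS]mxE [RHS]mxE !mulr1n => <-.
  rewrite exchange_big mxE; apply: eq_bigr => k _.
  rewrite [X in X * _]mxE [la k 0]mxE mulr_suml; apply: eq_bigr => i _.
  by rewrite [la^T 0 i]mxE [la i 0]mxE; ring.
have zEz : z *m cproj *m z^T = (al ^+ 2 + be ^+ 2)%:M.
  rewrite /cproj mulmxBr mulmxBl !mulmxA.
  have -> : z *m b^T *m b *m z^T = (al ^+ 2)%:M.
    have -> : z *m b^T *m b *m z^T = z *m b^T *m (z *m b^T)^T by rewrite trmx_mul trmxK !mulmxA.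
    by rewrite alE tr_scalar_mx -scalar_mxM expr2.
  have -> : z *m J *m b^T *m b *m J *m z^T = - (be ^+ 2)%:M.
    have -> : z *m J *m b^T *m b *m J *m z^T = - (z *m J *m b^T *m (z *m J *m b^T)^T).
      by rewrite !trmx_mul trmxK Jmx_tr mulNmx !mulmxN !mulmxA opprK.
    by rewrite beE tr_scalar_mx -scalar_mxM expr2.
  by rewrite opprK -raddfD.
have : (b *m b^T) 0 0 = 1 by rewrite bb mxE eqxx.
have -> : b *m b^T = (F *m b^T)^T *m P *m (F *m b^T) + (F *m J *m b^T)^T *m P *m (F *m J *m b^T).
  rewrite -{1}[b]mulmx1 -lagrangian_complete mulmxBr mulmxBl !trmx_mul trmxK Jmx_tr.
  by rewrite !(mulmxN, mulNmx) !mulmxA.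
rewrite h1 h2 -scaleNr !linearZ /= -!(scalemxAl, scalemxAr).
rewrite !scalerA -scalerDl mxE h3 zEz mxE eqxx mulr1n => <-; ring.
Qed.
End Projection.

(** The n vectors J E_j z are tangent, orthogonal and nonzero, hence a basis of the tangent space.
    This forces each E_k to preserve the tangent space, so that the third hypothesis exhibits E_j as
    a combination of the commuting [L l]. *)
Lemma cproj_comm_normal (b : 'I_n -> 'rV[R]_(n + n)) :
  let E j := cproj (b j) in
  (forall j k, E j *m E k = if j == k then E j else 0) ->
  (forall j, z *m E j *m F^T = 0) ->
  (forall j, F *m E j *m F^T = \sum_l (z *m E j *m J *m F^T *m P) 0 l *: C l) ->
  (forall j, (z *m E j *m z^T) 0 0 != 0) ->
  forall i j, L i *m E j = E j *m L i.
Proof.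
move=> E EE nE sE rE.
have tE j : (E j)^T = E j by exact: cproj_tr.
have EJ j : E j *m J = J *m E j by exact: cprojJ.
clearbody E; pose W : 'M[R]_n := \matrix_j (z *m E j *m J *m F^T *m P).
have WF j : row j W *m F = z *m E j *m J.
  rewrite rowK [RHS]lagrangian_split mulJJ mulNmx nE oppr0 !mul0mx subr0.
  by [].
have skE k : (E k *m J)^T = - (E k *m J) by rewrite trmx_mul tE Jmx_tr mulNmx EJ.
have FEJF k : F *m E k *m J *m F^T = 0.
  have WW j l : row j W *m (F *m E k *m J *m F^T) *m (row l W)^T = 0.
    have -> : row j W *m (F *m E k *m J *m F^T) *m (row l W)^T
       = (row j W *m F) *m (E k *m J) *m (row l W *m F)^T.
      by rewrite trmx_mul !mulmxA.
    rewrite !WF !trmx_mul Jmx_tr tE mulmxA mulNmx mulmxN !mulmxA mulJJ !mulNmx opprK.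
    rewrite -(mulmxA (z *m E j) J) -EJ !mulmxA -(mulmxA _ J (E l)) -EJ !mulmxA.
    rewrite -(mulmxA z (E j)) EE; case: eqVneq => [->|_]; last by rewrite mulmx0 !mul0mx.
    rewrite -(mulmxA z (E k)) EE; case: eqVneq => [->|_]; last by rewrite mulmx0 !mul0mx.
    by rewrite -(mulmxA z (E l)) skew_form.
  have WGW : W *m G *m W^T = diag_mx (\row_j (z *m E j *m z^T) 0 0).
    apply/matrixP => j l; rewrite -row_form.
    have -> : row j W *m G *m (row l W)^T = (row j W *m F) *m (row l W *m F)^T.
      by rewrite trmx_mul !mulmxA.
    rewrite !WF 2!trmx_mul Jmx_tr tE mulNmx mulmxN !mulmxA mulJJ !mulNmx opprK.
    rewrite -(mulmxA z (E j)) EE [RHS]mxE [in RHS]mxE; case: eqVneq => _ //.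
    by rewrite mulmx0 mul0mx mxE.
  have Wu : W \in unitmx.
    have : W *m G *m W^T \in unitmx.
      rewrite WGW unitmxE det_diag unitfE; apply/prodf_neq0 => j _; rewrite mxE; exact: rE.
    by rewrite !unitmx_mul => /andP[/andP[]].
  have WXW : W *m (F *m E k *m J *m F^T) *m W^T = 0.
    by apply/matrixP => j l; rewrite -row_form WW mxE [RHS]mxE.
  have Wtu : W^T \in unitmx by rewrite unitmx_tr.
  apply: (can_inj (mulKmx Wu)); rewrite mulmx0; apply: (can_inj (mulmxK Wtu)).
  by rewrite WXW mul0mx.
move=> i j.
suff -> : E j = \sum_l (z *m E j *m J *m F^T *m P) 0 l *: L l.
  rewrite mulmx_sumr mulmx_suml; apply: eq_bigr => l _.
  by rewrite -scalemxAr -scalemxAl shape_op_comm.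
have tP : P^T = P := gram_inv_tr F.
have FE : F *m E j = F *m E j *m F^T *m P *m F.
  by rewrite [LHS]lagrangian_split FEJF !mul0mx subr0.
have EF : E j *m F^T = F^T *m P *m (F *m E j *m F^T).
  by have := congr1 trmx FE; rewrite !trmx_mul !trmxK tP tE !mulmxA.
rewrite [LHS]lagrangian_split EJ -(mulmxA J) EF sE.
rewrite !(mulmx_sumr, mulmx_suml) -sumrB; apply: eq_bigr => l _.
by rewrite -!(scalemxAr, scalemxAl) -scalerBr /L !mulmxA.
Qed.

Lemma cproj_comm_base (T : 'M[R]_n) j :
  T *m G *m T^T = 1%:M ->
  (forall i k l, k != l -> (T *m C i *m T^T) k l = 0) ->
  let b := row j (T *m F) in
  b *m b^T = 1%:M /\ forall i, L i *m cproj b = cproj b *m L i.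
Proof.
move=> TG TC b.
have bE : b = row j T *m F by rewrite /b row_mul.
have PE : P = T^T *m T.
  apply: (can_inj (mulmxK (gram_unit freeF))); rewrite PG1 -mulmxA.
  by apply/esym; apply: mulmx1C.
split.
  rewrite [LHS]mx11_scalar; congr _%:M.
  have := row_form (T *m F) 1%:M (T *m F) j j; rewrite !mulmx1 => ->.
  by rewrite trmx_mul mulmxA -(mulmxA T) TG mxE eqxx.
move=> i; pose l := (T *m C i *m T^T) j j.
have bL : b *m L i = l *: b.
  rewrite bE frame_shape_op PE !mulmxA scalemxAl; congr (_ *m _).
  have -> : row j T *m C i *m T^T = l *: delta_mx 0 j.
    rewrite -!row_mul; apply/rowP => k.
    rewrite [LHS]mxE [RHS]mxE [delta_mx _ _ _ _]mxE eqxx /=.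
    case: eqVneq => [->|kj]; first by rewrite mulr1.
    by rewrite mulr0 TC // eq_sym.
  by rewrite -scalemxAl -rowE.
have Lb : L i *m b^T = l *: b^T by rewrite -[L i]shape_op_tr -trmx_mul bL linearZ.
have LE : L i *m cproj b = l *: cproj b.
  rewrite /cproj mulmxBr !(mulmxA (L i)) Lb shape_opJ -(mulmxA J (L i)) Lb.
  by rewrite -!(scalemxAl, scalemxAr) -scalerBr.
have := congr1 trmx LE; rewrite trmx_mul shape_op_tr linearZ /= cproj_tr => ->.
exact: LE.
Qed.
End LagrangianFrames.

(** * Constant curvature makes the algebra associative *)

Section ConstantCurvature.
Context {R : realType} {n : nat}.
Variables (C : 'I_n -> 'M[R]_n) (G P : 'M[R]_n) (w : 'rV[R]_n).
Hypothesis sC : symmetric_family C.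
Hypothesis n2 : (2 <= n)%N.
Hypothesis PG : P *m G = 1%:M.
Hypothesis tG : G^T = G.
Hypothesis tP : P^T = P.
Hypothesis posG : forall u : 'rV[R]_n, u != 0 -> 0 < (u *m G *m u^T) 0 0.
Hypothesis wC : \sum_k w 0 k *: C k = G.

Definition family_at (v : 'rV[R]_n) : 'M[R]_n := \sum_k v 0 k *: C k.
(** The inner product of the products x y and z t in the algebra; for the cubic form it is <sigma(x,
    y), sigma(z, t)>. *)
Definition family_form (x y z t : 'rV[R]_n) : R :=
  (x *m family_at y *m P *m (z *m family_at t)^T) 0 0.
Local Notation Q := family_form.

Lemma family_at_sym x y : x *m family_at y = y *m family_at x.
Proof.
have e u v : u *m family_at v = \row_l \sum_i \sum_k u 0 i * v 0 k * C k i l.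
  apply/rowP => l; rewrite mxE [RHS]mxE; apply: eq_bigr => i _.
  rewrite /family_at summxE mulr_sumr; apply: eq_bigr => k _; rewrite mxE; ring.
rewrite !e; apply/rowP => l; rewrite !mxE exchange_big; apply: eq_bigr => i _.
by apply: eq_bigr => k _; rewrite (sC.2 k i l); ring.
Qed.

Lemma family_formC x y z t : Q x y z t = Q y x z t.
Proof. by rewrite /Q family_at_sym. Qed.

Lemma family_form_sym x y z t : Q x y z t = Q z t x y.
Proof.
rewrite /Q; move: (x *m _) (z *m _) => A B.
have -> : A *m P *m B^T = (B *m P *m A^T)^T by rewrite !trmx_mul trmxK tP mulmxA.
by rewrite mxE.
Qed.

Lemma family_formC2 x y z t : Q x y z t = Q x y t z.
Proof. by rewrite family_form_sym family_formC family_form_sym. Qed.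

Lemma family_formD (a : R) x x' y z t : Q (x + a *: x') y z t = Q x y z t + a * Q x' y z t.
Proof. by rewrite /Q !mulmxDl -!scalemxAl mxE [X in _ + X]mxE. Qed.

Lemma family_formD2 (a : R) x y y' z t : Q x (y + a *: y') z t = Q x y z t + a * Q x y' z t.
Proof. by rewrite family_formC family_formD !(family_formC _ x). Qed.

Lemma family_formD3 (a : R) x y z z' t : Q x y (z + a *: z') t = Q x y z t + a * Q x y z' t.
Proof. by rewrite family_form_sym family_formD !(family_form_sym _ t). Qed.

Lemma family_formD4 (a : R) x y z t t' : Q x y z (t + a *: t') = Q x y z t + a * Q x y z t'.
Proof. by rewrite family_formC2 family_formD3 !(family_formC2 x y _ z). Qed.

(* The Gauss equation turns this into the numerator of the sectional curvature. *)
Definition gauss_num u v := Q v v u u - Q u v u v.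
Local Notation g u v := ((u *m G *m v^T) 0 0).

Variable K : R.
Hypothesis hK : forall u v : 'rV[R]_n, row_free (col_mx u v) ->
  gauss_num u v / (g u u * g v v - g u v ^+ 2) = K.

Lemma orthogonal_free (u v : 'rV[R]_n) : u != 0 -> v != 0 -> g u v = 0 -> row_free (col_mx u v).
Proof.
move=> u0 v0 uv; rewrite -kermx_eq0; apply/rowV0P => c /sub_kermxP.
rewrite -[c]hsubmxK mul_row_col; set a := lsubmx c; set b := rsubmx c => e.
have sG (x y : 'rV[R]_n) : g x y = g y x.
  have -> : y *m G *m x^T = (x *m G *m y^T)^T.
    by rewrite [RHS]trmx_mul trmxK trmx_mul tG mulmxA.
  by rewrite [RHS]mxE.
have ga : a 0 0 * g u u = 0.
  have := congr1 (fun y => g y u) e; rewrite !mulmxDl !mul0mx mxE [a]mx11_scalar [b]mx11_scalar.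
  by rewrite !mul_scalar_mx -!scalemxAl mxE [X in _ + X]mxE (sG v u) uv mulr0 addr0 [RHS]mxE !mxE eqxx !mulr1n.
have gb : b 0 0 * g v v = 0.
  have := congr1 (fun y => g y v) e; rewrite !mulmxDl !mul0mx mxE [a]mx11_scalar [b]mx11_scalar.
  by rewrite !mul_scalar_mx -!scalemxAl mxE [X in _ + X]mxE uv mulr0 add0r [RHS]mxE !mxE eqxx !mulr1n.
have z (x : R) (y : 'rV[R]_n) : y != 0 -> x * g y y = 0 -> x = 0.
  by move=> y0 /eqP; rewrite mulf_eq0 [g y y == 0]gt_eqF ?posG // orbF => /eqP.
by rewrite [a]mx11_scalar [b]mx11_scalar (z _ _ u0 ga) (z _ _ v0 gb) !raddf0 row_mx0.
Qed.

Lemma gauss_num_orthogonal u v : u != 0 -> v != 0 -> g u v = 0 ->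
  gauss_num u v = K * (g u u * g v v).
Proof.
move=> u0 v0 uv; have := hK (orthogonal_free u0 v0 uv).
rewrite uv expr0n subr0 => <-; by rewrite mulfVK //; apply: mulf_neq0; rewrite gt_eqF ?posG.
Qed.

(* The vector [w] acts as the identity, so the plane spanned by [w] and an orthogonal vector
   has curvature zero; this is where [2 <= n] enters. *)
Lemma gauss_num_zero u v : gauss_num u v = 0.
Proof.
have w0 : w != 0.
  apply/eqP => w0; move: wC; rewrite w0 big1 => [G0|k _]; last by rewrite mxE scale0r.
  have n0 : (0 < n)%N by apply: leq_trans n2.
  have := posG (u := delta_mx 0 (Ordinal n0)); rewrite -G0 mulmx0 mul0mx mxE ltxx.
  move=> h; have : (delta_mx 0 (Ordinal n0) : 'rV[R]_n) != 0.
    by apply/eqP => /rowP /(_ (Ordinal n0)); rewrite !mxE !eqxx => /eqP; rewrite oner_eq0.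
  by move/h.
have [u1 u10 uw] : exists2 u1 : 'rV[R]_n, u1 != 0 & g u1 w = 0.
  have kn : kermx (G *m w^T) != 0.
    rewrite -mxrank_eq0 mxrank_ker -lt0n subn_gt0.
    by apply: leq_ltn_trans (rank_leq_col _) _.
  have /rowV0Pn[u1 /sub_kermxP h u10] := kn.
  by exists u1 => //; rewrite -mulmxA h mxE.
have wG (x : 'rV[R]_n) : x *m family_at w = x *m G by rewrite /family_at wC.
have GP : G *m P = 1%:M by apply: mulmx1C.
have K0 : K = 0.
  have := gauss_num_orthogonal u10 w0 uw.
  have -> : gauss_num u1 w = 0.
    apply/eqP; rewrite subr_eq0; apply/eqP; rewrite /Q !wG -(mulmxA w) GP mulmx1.
    rewrite -(mulmxA u1) GP mulmx1.
    have -> : w *m (u1 *m family_at u1)^T = (u1 *m (u1 *m G)^T)^T.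
      rewrite [RHS]trmx_mul trmxK -wG -(family_at_sym w) trmx_mul mulmxA.
      have tf x : (family_at x)^T = family_at x.
        by rewrite /family_at linear_sum; apply: eq_bigr => k _; rewrite linearZ /= (sC.1 k).
      by rewrite tf.
    by rewrite mxE.
  move/esym/eqP; rewrite mulf_eq0 => /orP[/eqP //|].
  by rewrite mulf_eq0 !gt_eqF // posG.
have [->|u0] := eqVneq u 0.
  by rewrite /gauss_num /Q !mul0mx trmx0 mulmx0 subrr.
pose al := g u v / g u u; pose v' := v - al *: u.
have vE : v = v' + al *: u by rewrite subrK.
(* The numerator depends on [v] only modulo [u], which reduces everything to orthogonal pairs. *)
have e : gauss_num u v = gauss_num u v'.
  rewrite vE /gauss_num !(family_formD, family_formD2, family_formD3, family_formD4).
  rewrite (family_form_sym u u u v') (family_formC v' u u u); ring.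
have [v0|v0] := eqVneq v' 0.
  have z x y t : Q 0 x y t = 0 by rewrite /Q !mul0mx mxE.
  by rewrite e v0 /gauss_num (family_formC u) !z subrr.
rewrite e gauss_num_orthogonal ?K0 ?mul0r //.
rewrite /v' linearB linearZ /= mulmxBr -scalemxAr mxE [X in _ + X]mxE [X in - X]mxE.
by rewrite /al mulfVK ?subrr // gt_eqF // posG.
Qed.

(** The vanishing numerators are polarized first in v, then in u. *)
Lemma flat_family i j : C i *m P *m C j = C j *m P *m C i.
Proof.
have h1 u v v' : Q v v' u u = Q u v u v'.
  have := gauss_num_zero u (v + 1 *: v').
  have := gauss_num_zero u v; have := gauss_num_zero u v'; rewrite /gauss_num.
  rewrite !(family_formD, family_formD2, family_formD3, family_formD4).
  rewrite (family_formC v' v) (family_form_sym u v' u v); lra.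
have h2 u u' v v' : 2 * Q v v' u u' = Q u v u' v' + Q u' v u v'.
  have := h1 (u + 1 *: u') v v'; have := h1 u v v'; have := h1 u' v v'.
  rewrite !(family_formD, family_formD2, family_formD3, family_formD4).
  rewrite (family_formC2 v v' u' u); lra.
(* The two instances of [h2] share the term that pairs x z with t y; their difference is three times
   the claim. *)
have h x y z t : Q x y z t = Q x t z y.
  have := h2 z t x y; have := h2 z y x t.
  rewrite (family_formC z x t y) (family_formC t x z y) (family_formC y x z t) (family_formC z x y t).
  rewrite (family_formC2 x z t y) (family_formC2 x z y t).
  lra.
apply/matrixP => b d.
have e x : family_at (delta_mx 0 x) = C x.
  rewrite /family_at (bigD1 x) //= big1 ?addr0; last first.
    by move=> k /negbTE kx; rewrite mxE kx andbF scale0r.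
  by rewrite mxE !eqxx scale1r.
have q i' j' : (C i' *m P *m C j') b d = Q (delta_mx 0 b) (delta_mx 0 i') (delta_mx 0 d) (delta_mx 0 j').
  by rewrite /Q !e -!rowE row_form (sC.1 j').
by rewrite !q h.
Qed.
End ConstantCurvature.

Lemma is_derive_mulmxr (R : realType) (V : normedModType R) m n p (A : V -> 'M[R]_(m, n)) (B : 'M[R]_(n, p)) x v dA :
  is_derive x v A dA -> is_derive x v (fun y => A y *m B) (dA *m B).
Proof.
move=> hA; have h := is_derive_mulmx hA (is_derive_cst (B : 'M[R]_(n, p)) x v).
by move: h; rewrite mulmx0 addr0.
Qed.

Lemma is_derive_mulmxl (R : realType) (V : normedModType R) m n p (A : 'M[R]_(m, n)) (B : V -> 'M[R]_(n, p)) x v dB :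
  is_derive x v B dB -> is_derive x v (fun y => A *m B y) (A *m dB).
Proof.
move=> hB; have h := is_derive_mulmx (is_derive_cst (A : 'M[R]_(m, n)) x v) hB.
by move: h; rewrite mul0mx add0r.
Qed.

Lemma is_derive_scalemx (R : realType) (V : normedModType R) m n (a : V -> R) (B : V -> 'M[R]_(m, n)) x v da dB :
  is_derive x v a da -> is_derive x v B dB ->
  is_derive x v (fun y => a y *: B y) (da *: B x + a x *: dB).
Proof.
move=> ha hB; apply: is_derive_mx => i j.
have -> : (fun y => (a y *: B y) i j) = a * (fun y => B y i j).
  by apply/funext => y; rewrite mxE.
have h := is_derive_entry i j hB.
have := is_deriveM ha h; rewrite !mxE addrC => h1.
have -> : da * B x i j = B x i j *: da by rewrite mulrC.
exact: h1.
Qed.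

Lemma is_derive_mxtrace (R : realType) (V : normedModType R) n (A : V -> 'M[R]_n) x v dA :
  is_derive x v A dA -> is_derive x v (fun y => \tr (A y)) (\tr dA).
Proof.
move=> hA; have -> : (fun y => \tr (A y)) = \sum_i (fun y => A y i i).
  by apply/funext => y; rewrite fct_sumE.
by apply: is_derive_bigsum => i; exact: is_derive_entry.
Qed.

Section Products.
Context {R : realType} {n : nat}.
Variables (F : 'M[R]_(n, n + n)) (A1 A2 C1 C2 : 'M[R]_n).
Local Notation J := (Jmx R n).
Local Notation G := (F *m F^T).
Local Notation P := (invmx (F *m F^T)).
Hypothesis freeF : row_free F.
Hypothesis lagF : F *m J *m F^T = 0.
Hypothesis tC2 : C2^T = C2.

Let lag0 (A : 'M[R]_n) : A *m F *m J *m F^T = 0.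
Proof. by rewrite -[LHS]mulmx1 (lag_mul lagF). Qed.

Let tail : (A2 *m F + C2 *m P *m F *m J)^T = F^T *m A2^T - J *m F^T *m P *m C2.
Proof.
have tP : P^T = P := gram_inv_tr F.
by rewrite [_^T]raddfD /= !trmx_mul Jmx_tr tP tC2 !mulNmx !mulmxA.
Qed.

(** The factors have the shape of the second derivatives of a Lagrangian immersion: a tangent part
    in the frame [F] and a normal part in the frame [F *m J]. *)
Lemma split_product_rot :
  (A1 *m F + C1 *m P *m F *m J) *m J *m (A2 *m F + C2 *m P *m F *m J)^T
  = A1 *m C2 - C1 *m A2^T.
Proof.
rewrite tail mulmxDl mulJJ mulmxDl !mulmxBr !mulmxA !mulNmx mulJJ !lag0 !mulNmx !mul0mx.
rewrite sub0r opprK oppr0 subr0.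
rewrite -(mulmxA A1 F) -(mulmxA A1) (GP1 freeF) mulmx1; congr (_ - _).
by rewrite -(mulmxA (C1 *m P)) -(mulmxA C1) (PG1 freeF) mulmx1.
Qed.

Lemma split_product :
  (A1 *m F + C1 *m P *m F *m J) *m (A2 *m F + C2 *m P *m F *m J)^T
  = A1 *m G *m A2^T + C1 *m P *m C2.
Proof.
rewrite tail mulmxDl !mulmxBr !mulmxA !lag0 !mul0mx mulJJ !mulNmx subr0 sub0r opprK.
congr (_ + _).
by rewrite -(mulmxA (C1 *m P)) -(mulmxA C1) (PG1 freeF) mulmx1.
Qed.
End Products.

Lemma is_derive_unique (R : realType) (V W : normedModType R) (U : set V) (A B : V -> W) x v a b :
  open U -> U x -> is_derive x v A a -> is_derive x v B b ->
  (forall y, U y -> A y = B y) -> a = b.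
Proof.
move=> oU Ux [_ <-] [_ <-] AB; apply: near_eq_derive.
by have := open_nbhs_nbhs (conj oU Ux); apply: filterS => y; exact: AB.
Qed.

(** * Covariant derivatives of the cubic form and of the shape operators *)

Section CovariantDerivative.
Context {R : realType} {n : nat}.
Variables (C dC : 'I_n -> 'M[R]_n) (Gam : 'M[R]_n).

(** The covariant derivative of the cubic tensor in one fixed direction, whose connection matrix is
    [Gam]: [dC] holds the coordinate derivatives, and each of the three slots contributes one
    correction. *)
Definition cov_family i : 'M[R]_n :=
  dC i - \sum_l Gam i l *: C l - Gam *m C i - C i *m Gam^T.

Lemma sum_scale_row (w : 'rV[R]_n) :
  \sum_k w 0 k *: (\sum_l Gam k l *: C l) = \sum_l (w *m Gam) 0 l *: C l.
Proof.
under eq_bigr do rewrite scaler_sumr; rewrite exchange_big /=; apply: eq_bigr => l _.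
rewrite mxE scaler_suml; apply: eq_bigr => k _; by rewrite scalerA.
Qed.

Lemma cov_family_sym : symmetric_family C -> symmetric_family dC -> symmetric_family cov_family.
Proof.
move=> sC sdC; split=> [i|i j k].
  rewrite /cov_family !raddfB /= (sdC.1 i) !trmx_mul trmxK (sC.1 i) linear_sum /=.
  under eq_bigr do rewrite linearZ /= sC.1.
  by rewrite -!addrA; congr (_ + (_ + _)); rewrite addrC.
have e a b : cov_family a b k = dC a b k - (\sum_l Gam a l * C l b k + \sum_l Gam b l * C a l k)
    - \sum_l Gam k l * C a b l.
  have d (A S B D : 'M[R]_n) : (A - S - B - D) b k = A b k - (S b k + B b k) - D b k.
    by rewrite !mxE opprD !addrA.
  rewrite /cov_family d summxE; congr (_ - (_ + _) - _).
  - by apply: eq_bigr => l _; rewrite mxE.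
  - by rewrite mxE.
  - by rewrite mxE; apply: eq_bigr => l _; rewrite mxE mulrC.
rewrite !e (sdC.2 i j k); congr (_ - _ - _).
  rewrite addrC; congr (_ + _); apply: eq_bigr => l _; first by rewrite (sC.2 i l k).
  by rewrite (sC.2 l j k).
by apply: eq_bigr => l _; rewrite (sC.2 i j l).
Qed.

Variables (G P : 'M[R]_n) (w : 'rV[R]_n).

(** The second hypothesis is the coordinate derivative of the first, with the derivative of a
    parallel [P] inserted. The remaining connection terms only involve products [C a *m P *m C b],
    which are symmetric in a and b. *)
Lemma cov_family_comm i k :
  (forall i k, C i *m P *m C k = C k *m P *m C i) ->
  (forall i k, dC i *m P *m C k - C i *m (P *m Gam + Gam^T *m P) *m C k + C i *m P *m dC k
             = dC k *m P *m C i - C k *m (P *m Gam + Gam^T *m P) *m C i + C k *m P *m dC i) ->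
  cov_family i *m P *m C k + C i *m P *m cov_family k
  = cov_family k *m P *m C i + C k *m P *m cov_family i.
Proof.
move=> CC dCC.
have e a b : cov_family a *m P *m C b + C a *m P *m cov_family b
   = (dC a *m P *m C b - C a *m (P *m Gam + Gam^T *m P) *m C b + C a *m P *m dC b)
     - ((\sum_l Gam a l *: (C l *m P *m C b) + \sum_l Gam b l *: (C a *m P *m C l))
        + (Gam *m (C a *m P *m C b) + C a *m P *m C b *m Gam^T)).
  have s1 : (\sum_l Gam a l *: C l) *m P *m C b = \sum_l Gam a l *: (C l *m P *m C b).
    by rewrite !mulmx_suml; apply: eq_bigr => l _; rewrite -!scalemxAl.
  have s2 : C a *m P *m (\sum_l Gam b l *: C l) = \sum_l Gam b l *: (C a *m P *m C l).
    by rewrite mulmx_sumr; apply: eq_bigr => l _; rewrite -scalemxAr.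
  rewrite -s1 -s2 /cov_family; move: (\sum_l _) (\sum_l _) => Sa Sb.
  rewrite !(mulmxBl, mulmxBr) mulmxDr mulmxDl !mulmxA.
  move: (dC a *m P *m C b) (Sa *m P *m C b) (Gam *m C a *m P *m C b) (C a *m Gam^T *m P *m C b)
   (C a *m P *m dC b) (C a *m P *m Sb) (C a *m P *m Gam *m C b) (C a *m P *m C b *m Gam^T).
  move=> x1 x2 x3 x4 x5 x6 x7 x8; rewrite !opprD; apply/matrixP => p q; rewrite !mxE; ring.
have c a b : \sum_l Gam a l *: (C l *m P *m C b) = \sum_l Gam a l *: (C b *m P *m C l).
  by apply: eq_bigr => l _; rewrite CC.
by rewrite !e (dCC i k) (CC i k) (c i k) (c k i) [X in _ - (X + _) = _]addrC.
Qed.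

(** The second hypothesis is the coordinate derivative of the first when both [w] and [G] are
    parallel. *)
Lemma cov_family_unit : \sum_k w 0 k *: C k = G ->
  \sum_k w 0 k *: dC k - \sum_k (w *m Gam) 0 k *: C k = Gam *m G + G *m Gam^T ->
  \sum_k w 0 k *: cov_family k = 0.
Proof.
move=> wC dwC; rewrite /cov_family.
under eq_bigr do rewrite !scalerBr scalemxAr scalemxAl.
rewrite !sumrB -mulmx_sumr -mulmx_suml wC sum_scale_row dwC.
by rewrite -addrA -opprD subrr.
Qed.

Lemma cov_family_trace N : 
  (forall k, \tr (C k *m P) = N * (w *m G) 0 k) ->
  (forall k, \tr (dC k *m P) - \tr (C k *m (P *m Gam + Gam^T *m P)) = N * (w *m G *m Gam^T) 0 k) ->
  forall k, \tr (cov_family k *m P) = 0.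
Proof.
move=> tC dtC k; have tB (X Y : 'M[R]_n) : \tr (X - Y) = \tr X - \tr Y by rewrite raddfB.
rewrite /cov_family !mulmxBl !tB mulmx_suml.
have -> : \tr (\sum_l Gam k l *: C l *m P) = \sum_l \tr (Gam k l *: C l *m P) by rewrite raddf_sum.
have -> : \sum_l \tr (Gam k l *: C l *m P) = N * (w *m G *m Gam^T) 0 k.
  rewrite mxE mulr_sumr; apply: eq_bigr => l _.
  by rewrite -scalemxAl mxtraceZ tC [Gam^T l k]mxE; ring.
rewrite -dtC mulmxDr mxtraceD -(mulmxA Gam) (mxtrace_mulC Gam) !mulmxA; ring.
Qed.
End CovariantDerivative.

Section ShapeDerivative.
Context {R : realType} {n : nat}.
Variables (F Fm : 'M[R]_(n, n + n)) (C : 'I_n -> 'M[R]_n) (Gam : 'M[R]_n) (m i : 'I_n) (dCi dP : 'M[R]_n).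
Local Notation J := (Jmx R n).
Local Notation P := (invmx (F *m F^T)).
Hypothesis sC : symmetric_family C.
Hypothesis CC : forall i j, C i *m P *m C j = C j *m P *m C i.
Hypothesis FmE : Fm = Gam *m F + C m *m P *m F *m J.
Hypothesis dPE : dP = - (P *m Gam + Gam^T *m P).
Hypothesis dCE : dCi = \sum_l Gam i l *: C l + Gam *m C i + C i *m Gam^T.

Lemma coframe_derivative : dP *m F + P *m Fm = P *m C m *m P *m F *m J - Gam^T *m P *m F.
Proof.
rewrite FmE dPE mulmxDr mulNmx mulmxDl !mulmxA.
move: (P *m Gam *m F) (Gam^T *m P *m F) (_ *m J) => x1 x2 x3.
by apply/matrixP => p q; rewrite !mxE; ring.
Qed.

(** [B] is the derivative of the part [Y^T *m C i *m Y] of the shape operator. The connection terms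
    cancel because the cubic form is parallel; the rotation of the frame into the normal space adds
    [T *m J - J *m T], which the map X - J X J kills. The commutation of the family makes the two
    rotation terms involve the same [T]. *)
Lemma shape_derivative (B : 'M[R]_(n + n)) (Y := P *m F)
   (dY := P *m C m *m P *m F *m J - Gam^T *m P *m F) :
  B = dY^T *m C i *m Y + Y^T *m dCi *m Y + Y^T *m C i *m dY ->
  B - J *m B *m J = \sum_l Gam i l *: shape_op F C l.
Proof.
move=> BE; have tP : P^T = P := gram_inv_tr F.
pose T := F^T *m P *m (C m *m P *m C i) *m P *m F.
pose S := \sum_l Gam i l *: (F^T *m P *m C l *m P *m F).
have {BE} BE : B = S + (T *m J - J *m T).
  have sS : Y^T *m (\sum_l Gam i l *: C l) *m Y = S.
    rewrite /S mulmx_sumr mulmx_suml; apply: eq_bigr => l _.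
    by rewrite -scalemxAr -scalemxAl /Y trmx_mul tP !mulmxA.
  have T2 : T = F^T *m P *m C i *m P *m C m *m P *m F by rewrite /T CC !mulmxA.
  have e1 : dY^T *m C i *m Y = - (J *m T) - Y^T *m (Gam *m C i) *m Y.
    rewrite /dY /T /Y linearB /= !trmx_mul tP Jmx_tr trmxK (sC.1 m) mulmxBl mulmxBl !mulNmx.
    by rewrite !mulmxA.
  have e2 : Y^T *m C i *m dY = T *m J - Y^T *m (C i *m Gam^T) *m Y.
    by rewrite T2 /dY /Y trmx_mul tP mulmxBr !mulmxA.
  rewrite BE e1 e2 dCE !mulmxDr !mulmxDl sS.
  move: {sS} S (J *m T) (T *m J) (Y^T *m (Gam *m _) *m Y) (Y^T *m (_ *m Gam^T) *m Y) => x1 x2 x3 x4 x5.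
  by apply/matrixP => p q; rewrite !mxE; ring.
have z : J *m (T *m J - J *m T) *m J = T *m J - J *m T.
  have e1 : J *m (T *m J) *m J = - (J *m T) by rewrite mulmxA mulJJ.
  have e2 : J *m (J *m T) *m J = - (T *m J) by rewrite mulmxA Jmx_sq mulNmx mul1mx mulNmx.
  rewrite mulmxBr mulmxBl e1 e2 opprK addrC.
  by [].
rewrite BE mulmxDr mulmxDl z opprD addrACA subrr addr0.
rewrite /S mulmx_sumr mulmx_suml -sumrB; apply: eq_bigr => l _.
by rewrite -scalemxAr -scalemxAl -scalerBr /shape_op !mulmxA.
Qed.
End ShapeDerivative.

(** * Lagrangian immersions in a chart: Gauss and Codazzi equations, parallel cubic form *)

Section LagrangianCharts.
Context {R : realType} {n : nat}.
Variables (U : set 'rV[R]_n) (f : 'rV[R]_n -> 'rV[R]_(n + n)).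
Hypothesis oU : open U.
Hypothesis smoothf : smooth_on U f.
Hypothesis freef : forall x, U x -> row_free (frame f x).
Local Notation J := (Jmx R n).
Local Notation F := (frame f).
Local Notation G := (induced_metric f).
Local Notation P := (fun x => invmx (induced_metric f x)).
Local Notation e_ i := (delta_mx 0 i : 'rV[R]_n).
Hypothesis lagf : forall x, U x -> F x *m J *m (F x)^T = 0.

(* <sigma(d_i, d_j), J d_k>, the cubic form of a Lagrangian immersion. *)
Definition cubic (i : 'I_n) x : 'M[R]_n := - (hess f i x *m J *m (F x)^T).

Definition hess2 (m i : 'I_n) x : 'M[R]_(n, n + n) :=
  \matrix_(j < n) partial m (partial i (partial j f)) x.

Lemma is_derive_hess m i x : U x -> is_derive x (e_ m) (hess f i) (hess2 m i x).
Proof.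
move=> Ux; apply: is_derive_mx => j a.
have -> : (fun y => hess f i y j a) = (fun y => partial i (partial j f) y 0 a).
  by apply/funext => y; rewrite mxE.
by rewrite mxE; apply: is_derive_entry; apply: is_derive_partial; exact: (smooth2 smoothf).
Qed.

Lemma hess2_swap m i x : U x -> hess2 m i x = hess2 i m x.
Proof.
move=> Ux; apply/row_matrixP => j; apply: etrans (rowK _ _) (etrans _ (esym (rowK _ _))).
apply: (partial_swap oU) => // [y|k y]; [exact: (smooth1 smoothf)|exact: (smooth2 smoothf)].
Qed.

Definition dcubic m i x : 'M[R]_n :=
  - (hess2 m i x *m J *m (F x)^T + hess f i x *m J *m (hess f m x)^T).

Lemma is_derive_cubic m i x : U x -> is_derive x (e_ m) (cubic i) (dcubic m i x).
Proof.
move=> Ux; apply: is_deriveN; apply: is_derive_mulmx.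
  by apply: is_derive_mulmxr; exact: is_derive_hess.
by apply: is_derive_trmx; exact: (is_derive_frame smoothf).
Qed.

Lemma differentiable_cubic i x : U x -> differentiable (cubic i) x.
Proof.
move=> Ux; apply: differentiableN; apply: differentiable_mulmx; last first.
  by apply: differentiable_trmx; exact: (differentiable_frame smoothf).
apply: differentiable_mulmx; first exact: (differentiable_hess smoothf).
exact: differentiable_cst.
Qed.

(** Symmetry in the last two indices is the derivative of the Lagrangian condition; symmetry in the
    first two is the equality of mixed derivatives. *)
Lemma cubic_family x : U x -> symmetric_family (cubic^~ x).
Proof.
move=> Ux; split=> [i|i j k].
  have dF := is_derive_frame smoothf i Ux.
  have h1 := is_derive_mulmx (is_derive_mulmxr J dF) (is_derive_trmx dF).
  have h0 : is_derive x (e_ i) (cst (0 : 'M[R]_n)) 0 by exact: is_derive_cst.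
  have := is_derive_unique oU Ux h1 h0 lagf => /eqP; rewrite addr_eq0 => /eqP e.
  have t : (hess f i x *m J *m (F x)^T)^T = - (F x *m J *m (hess f i x)^T).
    by rewrite trmx_mul trmx_mul trmxK Jmx_tr mulNmx mulmxN mulmxA.
  by rewrite /cubic raddfN /= t e.
have r i' j' : cubic i' x j' k = - (row j' (hess f i' x) *m (J *m (F x)^T)) 0 k.
  by rewrite -row_mul [in RHS]mxE /cubic mxE mulmxA.
have e := hess_swap oU smoothf i j Ux.
exact: etrans (r i j) (etrans (congr1 (fun w => - (w *m (J *m (F x)^T)) 0 k) e) (esym (r j i))).
Qed.

Lemma hess_split i x : U x ->
  hess f i x = conn f i x *m F x + cubic i x *m P x *m F x *m J.
Proof.
move=> Ux; rewrite {1}[hess f i x](lagrangian_split (freef Ux) (lagf Ux)).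
by rewrite /cubic !mulNmx.
Qed.

Lemma second_form_cubic x i j : U x ->
  second_form f x i j = row j (cubic i x) *m P x *m F x *m J.
Proof.
by move=> Ux; rewrite second_formE {1}hess_split // linearD /= !row_mul addrC addKr.
Qed.

Let PGx x : U x -> P x *m G x = 1%:M.
Proof. by move=> Ux; exact: (PG1 (freef Ux)). Qed.
Let GPx x : U x -> G x *m P x = 1%:M.
Proof. by move=> Ux; exact: (GP1 (freef Ux)). Qed.
Let tP x : (P x)^T = P x.
Proof. exact: gram_inv_tr. Qed.
Let tG x : (G x)^T = G x.
Proof. exact: gram_tr. Qed.

Lemma hess_rot i m x : U x ->
  hess f i x *m J *m (hess f m x)^T
  = conn f i x *m cubic m x - cubic i x *m (conn f m x)^T.
Proof.
move=> Ux; have lag := lagf Ux.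
have tC : (cubic m x)^T = cubic m x by have [] := cubic_family Ux.
rewrite (hess_split i Ux) (hess_split m Ux).
exact: split_product_rot (freef Ux) lag tC.
Qed.

Lemma hess_hess i m x : U x ->
  hess f i x *m (hess f m x)^T
  = conn f i x *m G x *m (conn f m x)^T + cubic i x *m P x *m cubic m x.
Proof.
move=> Ux; have lag := lagf Ux.
have tC : (cubic m x)^T = cubic m x by have [] := cubic_family Ux.
rewrite (hess_split i Ux) (hess_split m Ux).
exact: split_product (freef Ux) lag tC.
Qed.

Lemma is_derive_conn_metric m i x : U x ->
  'D_(e_ m) (conn f i) x *m G x + conn f i x *m conn f m x *m G x
  = hess2 m i x *m (F x)^T + cubic i x *m P x *m cubic m x.
Proof.
move=> Ux.
have h1 : is_derive x (e_ m) (conn f i) ('D_(e_ m) (conn f i) x).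
  by apply/derivableP/diff_derivable; exact: (differentiable_conn smoothf freef).
have h2 := is_derive_mulmx h1 (is_derive_metric smoothf freef m Ux).
have h3 := is_derive_mulmx (is_derive_hess m i Ux) (is_derive_trmx (is_derive_frame smoothf m Ux)).
have := is_derive_unique oU Ux h2 h3 (fun y Uy => connG freef i Uy).
have a (D B X H Y W T : 'M[R]_n) :
    D *m H + B *m (X *m H + H *m Y) = W + (B *m H *m Y + T) -> D *m H + B *m X *m H = W + T.
  rewrite mulmxDr !mulmxA addrA => e; apply: (addIr (B *m H *m Y)).
  by rewrite e -!addrA; congr (_ + _); rewrite addrC.
have hh := hess_hess i m Ux.
by move=> e; exact: (a _ _ _ _ _ _ _ (etrans e (congr1 (+%R _) hh))).
Qed.

Lemma riemannE i j k l x : U x -> riemann G i j k l x =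
  ('D_(e_ i) (conn f j) x - 'D_(e_ j) (conn f i) x
   + conn f j x *m conn f i x - conn f i x *m conn f j x) k l.
Proof.
move=> Ux; rewrite /riemann.
have d a b : partial a (christoffel G l b k) x = ('D_(e_ a) (conn f b) x) k l.
  apply: (@partial_eq _ _ _ oU _ _ (fun y => conn f b y k l)) => //.
    by move=> y Uy; rewrite (christoffelE oU smoothf freef).
  apply: is_derive_entry; apply/derivableP/diff_derivable.
  exact: (differentiable_conn smoothf freef).
rewrite !d.
have c a b c' : christoffel G a b c' x = conn f b x c' a.
  exact: (christoffelE oU smoothf freef).
have -> : \sum_(h < n) (christoffel G h j k x * christoffel G l i h x
    - christoffel G h i k x * christoffel G l j h x)
  = (conn f j x *m conn f i x) k l - (conn f i x *m conn f j x) k l.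
  have s (A B : 'M[R]_n) : (A *m B) k l - (B *m A) k l = \sum_h (A k h * B h l - B k h * A h l).
    by rewrite [in LHS]mxE [X in _ - X]mxE -sumrB.
  apply: etrans (esym (s _ _)); apply: eq_bigr => h _.
  by rewrite (c h j k) (c l i h) (c h i k) (c l j h).
have ab (A B X Y : 'M[R]_n) : A k l - B k l + (X k l - Y k l) = (A - B + X - Y) k l.
  by rewrite !mxE addrA.
exact: ab.
Qed.

(** Antisymmetrizing [is_derive_conn_metric] in the two directions cancels the third derivatives of
    the immersion and leaves the Gauss equation. *)
Lemma riemann_metric i j x : U x ->
  ('D_(e_ i) (conn f j) x - 'D_(e_ j) (conn f i) x
   + conn f j x *m conn f i x - conn f i x *m conn f j x) *m G x
  = cubic j x *m P x *m cubic i x - cubic i x *m P x *m cubic j x.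
Proof.
move=> Ux; have h1 := is_derive_conn_metric i j Ux; have h2 := is_derive_conn_metric j i Ux.
rewrite hess2_swap // in h1.
have a (A B X Y H : 'M[R]_n) (E C D : 'M[R]_n) : A *m H + X *m H = E + C -> B *m H + Y *m H = E + D ->
    (A - B + X - Y) *m H = C - D.
  move=> e1 e2; have -> : (A - B + X - Y) *m H = (A *m H + X *m H) - (B *m H + Y *m H).
    by rewrite !(mulmxDl, mulNmx) opprD !addrA; congr (_ - _); rewrite addrAC.
  by rewrite e1 e2 opprD addrACA subrr add0r.
exact: a h1 h2.
Qed.

Lemma gauss_equation x u v : U x ->
  metric_dot G x (curvature_op G x u v v) u = gauss_num (cubic^~ x) (P x) u v.
Proof.
move=> Ux; have sC := cubic_family Ux.
pose K i j : 'M[R]_n := 'D_(e_ i) (conn f j) x - 'D_(e_ j) (conn f i) x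
   + conn f j x *m conn f i x - conn f i x *m conn f j x.
have cur : curvature_op G x u v v = v *m \sum_i \sum_j (u 0 i * v 0 j) *: K i j.
  apply/rowP => l; rewrite mxE mulmx_sumr summxE; apply: eq_bigr => i _.
  rewrite mulmx_sumr summxE; apply: eq_bigr => j _.
  rewrite -scalemxAr [RHS]mxE [X in _ = _ * X]mxE mulr_sumr; apply: eq_bigr => k _.
  by rewrite riemannE // mulrA.
have e : (\sum_i \sum_j (u 0 i * v 0 j) *: K i j) *m G x
  = family_at (cubic^~ x) v *m P x *m family_at (cubic^~ x) u
    - family_at (cubic^~ x) u *m P x *m family_at (cubic^~ x) v.
  have b (a c : 'rV[R]_n) : family_at (cubic^~ x) a *m P x *m family_at (cubic^~ x) c
      = \sum_j \sum_i (c 0 i * a 0 j) *: (cubic j x *m P x *m cubic i x).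
    rewrite /family_at !mulmx_suml; apply: eq_bigr => j _.
    rewrite mulmx_sumr; apply: eq_bigr => i _.
    have s (al be : R) (A Q B : 'M[R]_n) : (al *: A) *m Q *m (be *: B) = (be * al) *: (A *m Q *m B).
      by rewrite -!scalemxAl -scalemxAr scalerA mulrC.
    exact: s.
  have KG i j : K i j *m G x = cubic j x *m P x *m cubic i x - cubic i x *m P x *m cubic j x.
    by have h := riemann_metric i j Ux; exact: h.
  rewrite !b [X in _ = X - _]exchange_big /= -sumrB mulmx_suml; apply: eq_bigr => i _.
  rewrite -sumrB mulmx_suml; apply: eq_bigr => j _.
  apply: etrans (esym (scalemxAl _ _ _)) _; rewrite KG scalerBr; congr (_ - _ *: _).
  by rewrite mulrC.
have tf y : (family_at (cubic^~ x) y)^T = family_at (cubic^~ x) y.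
  by rewrite /family_at linear_sum; apply: eq_bigr => k _; rewrite linearZ /= (sC.1 k).
rewrite /metric_dot cur -(mulmxA v) e mulmxBr mulmxBl mxE [X in _ + X]mxE.
rewrite /gauss_num /family_form; congr (_ - _).
  by rewrite trmx_mul tf !mulmxA.
by rewrite [in RHS]trmx_mul tf [u *m _](family_at_sym sC) !mulmxA.
Qed.
Hypothesis n2 : (2 <= n)%N.
Hypothesis nrm : forall x, U x -> f x *m (F x)^T = 0.
Variable N : R.
Hypothesis N0 : N != 0.
Hypothesis mcf : forall x, U x -> mean_curvature f x = - N *: f x.
Variable K : R.
Hypothesis hK : forall x, U x -> forall u v : 'rV[R]_n,
  row_free (col_mx u v) -> sectional_curvature G x u v = K.

Local Notation C x := (cubic^~ x).

Let sC x (Ux : U x) : symmetric_family (C x) := cubic_family Ux.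

(* The coordinates of the tangent vector J f in the frame. *)
Definition rot_coord x : 'rV[R]_n := f x *m J *m (F x)^T *m P x.
Local Notation w := rot_coord.

(** Differentiating the orthogonality of f and d_k f gives <d_i d_k f, f> = - g_ik: this makes J f
    the unit of the algebra. *)
Lemma rot_coord_cubic i x : U x -> w x *m cubic i x = row i (G x).
Proof.
move=> Ux; have df := is_derive_partial i (smooth0 smoothf Ux).
have dF := is_derive_trmx (is_derive_frame smoothf i Ux).
have h1 := is_derive_mulmx df dF.
have h0 : is_derive x (e_ i) (cst (0 : 'rV[R]_n)) 0 by exact: is_derive_cst.
have := is_derive_unique oU Ux h1 h0 nrm.
have -> : partial i f x = row i (F x) by rewrite rowK.
rewrite (hess_split i Ux) -row_mul.
have a (z : 'rV[R]_(n + n)) (Fx : 'M[R]_(n, n + n)) (Gm Ci Px : 'M[R]_n) (r : 'rV[R]_n) :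
    z *m Fx^T = 0 -> Px^T = Px -> Ci^T = Ci ->
    r + z *m (Gm *m Fx + Ci *m Px *m Fx *m J)^T = 0 ->
    z *m J *m Fx^T *m Px *m Ci = r.
  move=> zF tPx tCi; rewrite linearD /= !trmx_mul Jmx_tr tPx tCi mulmxDr !mulmxA zF mul0mx add0r.
  by rewrite mulmxN !mulNmx => /eqP; rewrite subr_eq0 => /eqP.
exact: a (nrm Ux) (tP x) ((sC Ux).1 i).
Qed.

Lemma sum_rot_cubic x : U x -> \sum_k w x 0 k *: cubic k x = G x.
Proof.
move=> Ux; apply/matrixP => i j; rewrite summxE.
transitivity ((w x *m cubic i x) 0 j); last first.
  by apply: etrans (congr1 (fun r : 'rV[R]_n => r 0 j) (rot_coord_cubic i Ux)) _; rewrite mxE.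
rewrite [RHS]mxE; apply: eq_bigr => k _; rewrite mxE; congr (_ * _).
exact: ((sC Ux).2 k i j).
Qed.

(** The traces of the cubic form are the products of the mean curvature vector with the J d_k f, and
    this vector is - N f. *)
Lemma trace_cubic k x : U x -> \tr (cubic k x *m P x) = N * (w x *m G x) 0 k.
Proof.
move=> Ux; pose t : 'rV[R]_n := \row_l \tr (cubic l x *m P x).
have Ht : mean_curvature f x = t *m P x *m F x *m J.
  rewrite /mean_curvature.
  transitivity (\sum_i \sum_j (P x i j *: row j (cubic i x)) *m P x *m F x *m J).
    apply: eq_bigr => i _; apply: eq_bigr => j _.
    by rewrite (second_form_cubic i j Ux) !scalemxAl.
  have -> : t = \sum_i \sum_j P x i j *: row j (cubic i x).
    apply/rowP => l; rewrite mxE /mxtrace summxE; apply: eq_bigr => i _.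
    rewrite mxE summxE; apply: eq_bigr => j _; rewrite [RHS]mxE [X in _ = _ * X]mxE [RHS]mulrC.
    congr (_ * _); last by have /matrixP /(_ i j) := tP x; rewrite mxE.
    have [e _ _] := family_entry l i j (sC Ux); have [_ e' _] := family_entry i l j (sC Ux).
    exact: etrans e e'.
  rewrite !mulmx_suml; apply: eq_bigr => i _; rewrite !mulmx_suml; apply: eq_bigr => j _.
  by [].
have e : t *m P x = N *: w x.
  have := mcf Ux; rewrite Ht => h.
  have a (z : 'rV[R]_(n + n)) (Fx : 'M[R]_(n, n + n)) (Px : 'M[R]_n) (s : 'rV[R]_n) :
     Fx *m Fx^T *m Px = 1%:M -> s *m Fx *m J = - N *: z -> s = N *: (z *m J *m Fx^T *m Px).
    move=> FP /(congr1 (fun y => y *m J *m Fx^T *m Px)); rewrite mulJJ !mulNmx -!mulmxA (mulmxA Fx) FP mulmx1.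
    by rewrite scaleNr mulNmx -!scalemxAl => /oppr_inj.
  exact: a (GPx Ux) h.
have -> : \tr (cubic k x *m P x) = (t *m P x *m G x) 0 k.
  by rewrite -mulmxA PGx // mulmx1 mxE.
by rewrite e -scalemxAl mxE.
Qed.

Lemma cubic_flat i j x : U x ->
  cubic i x *m P x *m cubic j x = cubic j x *m P x *m cubic i x.
Proof.
move=> Ux; apply: (@flat_family _ _ (C x) (G x) (P x) (w x) (sC Ux) n2 _ _ _ _ _ K).
- exact: PGx.
- exact: tG.
- exact: tP.
- exact: (gram_posdef (freef Ux)).
- exact: sum_rot_cubic.
- move=> u v uv; rewrite -(hK Ux uv) /sectional_curvature.
  by rewrite (gauss_equation u v Ux).
Qed.

(** The derivative J d_m f of the tangent field J f is normal, so this field is parallel. *)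
Lemma is_derive_rot_coord m x : U x -> is_derive x (e_ m) w (- (w x *m conn f m x)).
Proof.
move=> Ux; have df := is_derive_partial m (smooth0 smoothf Ux).
have dF := is_derive_trmx (is_derive_frame smoothf m Ux).
have dP := is_derive_inv_metric smoothf freef m Ux.
have h := is_derive_mulmx (is_derive_mulmx (is_derive_mulmxr J df) dF) dP.
have fE : partial m f x = row m (F x) by rewrite rowK.
have a (z r : 'rV[R]_(n + n)) (Fx H : 'M[R]_(n, n + n)) (Gm Cm Px : 'M[R]_n) :
    z *m Fx^T = 0 -> Px^T = Px -> Cm^T = Cm -> r *m J *m Fx^T = 0 ->
    H = Gm *m Fx + Cm *m Px *m Fx *m J ->
    (r *m J *m Fx^T + z *m J *m H^T) *m Px + z *m J *m Fx^T *m - (Px *m Gm + Gm^T *m Px)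
    = - (z *m J *m Fx^T *m Px *m Gm).
  move=> zF tPx tCm -> ->; rewrite add0r linearD /= !trmx_mul Jmx_tr tPx tCm mulmxDr !mulmxA.
  rewrite mulmxN !mulNmx mulJJ !mulNmx opprK zF !mul0mx addr0 mulmxN mulmxDr !mulmxA opprD.
  by rewrite addrCA subrr addr0.
have lag : partial m f x *m J *m (F x)^T = 0.
  by rewrite fE -!row_mul (lagf Ux) row0.
have e := a _ _ _ _ _ _ _ (nrm Ux) (tP x) ((sC Ux).1 m) lag (hess_split m Ux).
by rewrite -e; exact: h.
Qed.

Lemma dcubic_family m x : U x -> symmetric_family (fun i => dcubic m i x).
Proof.
move=> Ux; have d i := is_derive_cubic m i Ux; split=> [i|i j k].
  apply: (is_derive_unique oU Ux (is_derive_trmx (d i)) (d i)) => y Uy.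
  exact: ((sC Uy).1 i).
apply: (is_derive_unique oU Ux (is_derive_entry j k (d i)) (is_derive_entry i k (d j))) => y Uy.
exact: ((sC Uy).2 i j k).
Qed.

Definition cov_cubic m i x := cov_family (C x) (fun i => dcubic m i x) (conn f m x) i.

(** The Codazzi equation: the third derivatives are symmetric, and by [hess_rot] the products of
    second derivatives trade places with the connection terms. *)
Lemma cov_cubic_swap m i x : U x -> cov_cubic m i x = cov_cubic i m x.
Proof.
move=> Ux; rewrite /cov_cubic /cov_family /dcubic.
have h m' i' := hess_rot i' m' Ux.
have s : \sum_l conn f m x i l *: cubic l x = \sum_l conn f i x m l *: cubic l x.
  apply: eq_bigr => l _; congr (_ *: _).
  have := conn_swap oU smoothf m i Ux => /rowP /(_ l); rewrite [LHS]mxE [RHS]mxE.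
  by [].
have hs := hess2_swap m i Ux.
have a (X Hi Hm S A B Ct D : 'M[R]_n) :
   Hi = A - Ct -> Hm = B - D ->
   - (X + Hi) - S - B - Ct = - (X + Hm) - S - A - D.
  by move=> -> ->; apply/matrixP => p q; rewrite !mxE; ring.
rewrite s hs; exact: a (h m i) (h i m).
Qed.

Lemma cov_cubic_comm m i k x : U x ->
  cov_cubic m i x *m P x *m cubic k x + cubic i x *m P x *m cov_cubic m k x
  = cov_cubic m k x *m P x *m cubic i x + cubic k x *m P x *m cov_cubic m i x.
Proof.
move=> Ux; have dC i' := is_derive_cubic m i' Ux.
have dP := is_derive_inv_metric smoothf freef m Ux.
have CC i j := cubic_flat i j Ux.
have h a b := is_derive_mulmx (is_derive_mulmx (dC a) dP) (dC b).
have e (A X Q B A' B' : 'M[R]_n) : (A *m X + B *m - Q) *m A' + B *m X *m B'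
    = A *m X *m A' - B *m Q *m A' + B *m X *m B'.
  by rewrite mulmxDl mulmxN mulNmx.
have dCC a b : dcubic m a x *m P x *m cubic b x
     - cubic a x *m (P x *m conn f m x + (conn f m x)^T *m P x) *m cubic b x
     + cubic a x *m P x *m dcubic m b x
   = dcubic m b x *m P x *m cubic a x
     - cubic b x *m (P x *m conn f m x + (conn f m x)^T *m P x) *m cubic a x
     + cubic b x *m P x *m dcubic m a x.
  have q := is_derive_unique oU Ux (h a b) (h b a) (fun y Uy => cubic_flat a b Uy).
  exact: etrans (esym (e _ _ _ _ _ _)) (etrans q (e _ _ _ _ _ _)).
exact: (@cov_family_comm R n (C x) (fun i => dcubic m i x) (conn f m x) (P x) i k CC dCC).
Qed.

Lemma cov_cubic_unit m x : U x -> \sum_k w x 0 k *: cov_cubic m k x = 0.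
Proof.
move=> Ux; have dC i' := is_derive_cubic m i' Ux.
have dw := is_derive_rot_coord m Ux.
have dG := is_derive_metric smoothf freef m Ux.
have h : is_derive x (e_ m) (fun y => \sum_k w y 0 k *: cubic k y)
   (\sum_k ((- (w x *m conn f m x)) 0 k *: cubic k x + w x 0 k *: dcubic m k x)).
  have -> : (fun y => \sum_k w y 0 k *: cubic k y) = \sum_k (fun y => w y 0 k *: cubic k y).
    by apply/funext => y; rewrite fct_sumE.
  apply: is_derive_bigsum => k; apply: is_derive_scalemx (dC k).
  exact: is_derive_entry dw.
have q := is_derive_unique oU Ux h dG (fun y Uy => sum_rot_cubic Uy).
have e (v u : 'rV[R]_n) (A B : 'I_n -> 'M[R]_n) :
   \sum_k v 0 k *: B k - \sum_k u 0 k *: A k = \sum_k ((- u) 0 k *: A k + v 0 k *: B k).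
  by rewrite -sumrB; apply: eq_bigr => k _; rewrite [(- u) 0 k]mxE scaleNr addrC.
exact: (@cov_family_unit R n (C x) (fun i => dcubic m i x) (conn f m x) (G x) (w x)
  (sum_rot_cubic Ux) (etrans (e _ _ _ _) q)).
Qed.

Lemma cov_cubic_trace m k x : U x -> \tr (cov_cubic m k x *m P x) = 0.
Proof.
move=> Ux; have dC i' := is_derive_cubic m i' Ux.
have dP := is_derive_inv_metric smoothf freef m Ux.
have dw := is_derive_rot_coord m Ux.
have dG := is_derive_metric smoothf freef m Ux.
have tC k' := trace_cubic k' Ux.
have dt k' : \tr (dcubic m k' x *m P x)
     - \tr (cubic k' x *m (P x *m conn f m x + (conn f m x)^T *m P x))
   = N * (w x *m G x *m (conn f m x)^T) 0 k'.
  have h := is_derive_mxtrace (is_derive_mulmx (dC k') dP).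
  have h2 := is_derive_entry 0 k' (is_derive_mulmx dw dG).
  have h3 := is_deriveZ N h2.
  have q := is_derive_unique oU Ux h h3 (fun y Uy => trace_cubic k' Uy).
  have e (A B X Y : 'M[R]_n) : \tr (A *m B) - \tr (X *m Y) = \tr (A *m B + X *m - Y).
    by rewrite mulmxN mxtraceD raddfN.
  have e2 (v : 'rV[R]_n) (Gm H Gt : 'M[R]_n) : - (v *m Gm) *m H + v *m (Gm *m H + H *m Gt) = v *m H *m Gt.
    by rewrite mulNmx mulmxDr !mulmxA addKr.
  apply: etrans (e _ _ _ _) (etrans q _).
  exact: (congr1 (fun v : 'rV[R]_n => N * v 0 k') (e2 _ _ _ _)).
exact: (@cov_family_trace R n (C x) (fun i => dcubic m i x) (conn f m x) (G x) (P x) (w x) N tC dt k).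
Qed.

Lemma cov_cubic0 m i x : U x -> cov_cubic m i x = 0.
Proof.
move=> Ux; have trace_cubic' k := trace_cubic k Ux.
have CC i j := cubic_flat i j Ux.
have h1 m' : symmetric_family (fun i' => cov_cubic m' i' x).
  by apply: cov_family_sym; [exact: sC|exact: dcubic_family].
have h2 m' i' : cov_cubic m' i' x = cov_cubic i' m' x by exact: cov_cubic_swap.
have h3 m' i' k' : cov_cubic m' i' x *m P x *m cubic k' x + cubic i' x *m P x *m cov_cubic m' k' x
   = cov_cubic m' k' x *m P x *m cubic i' x + cubic k' x *m P x *m cov_cubic m' i' x.
  exact: cov_cubic_comm.
have h4 m' : \sum_k w x 0 k *: cov_cubic m' k x = 0 by exact: cov_cubic_unit.
have h5 m' k' : \tr (cov_cubic m' k' x *m P x) = 0 by exact: cov_cubic_trace.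
exact: (@parallel_family R n (C x) (G x) (P x) (w x) (sC Ux) (PGx Ux) (tG x) CC (sum_rot_cubic Ux)
  (fun m i => cov_cubic m i x) N N0 h1 h2 h3 h4 h5 trace_cubic' m i).
Qed.

Definition chart_shape i x : 'M[R]_(n + n) := shape_op (F x) (C x) i.

Lemma is_derive_chart_shape m i x : U x ->
  is_derive x (e_ m) (chart_shape i) (\sum_l conn f m x i l *: chart_shape l x).
Proof.
move=> Ux; have dC := is_derive_cubic m i Ux.
have dP := is_derive_inv_metric smoothf freef m Ux.
have dF := is_derive_frame smoothf m Ux.
have dY : is_derive x (e_ m) (fun y => P y *m F y)
    (P x *m cubic m x *m P x *m F x *m J - (conn f m x)^T *m P x *m F x).
  have e := @coframe_derivative R n (F x) _ (C x) (conn f m x) m _ (hess_split m Ux) erefl.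
  by rewrite -/(G x) in e; rewrite -e; exact: is_derive_mulmx dP dF.
have dB := is_derive_mulmx (is_derive_mulmx (is_derive_trmx dY) dC) dY.
rewrite mulmxDl in dB.
have dCE : dcubic m i x = \sum_l conn f m x i l *: cubic l x + conn f m x *m cubic i x
   + cubic i x *m (conn f m x)^T.
  have a (X A B D : 'M[R]_n) : X - A - B - D = 0 -> X = A + B + D.
    by move=> h; rewrite -[X]subr0 -h; apply/matrixP => p q; rewrite !mxE; ring.
  exact: a (cov_cubic0 m i Ux).
have e := shape_derivative (m := m) (sC Ux) (fun i j => cubic_flat i j Ux) dCE erefl.
have dL := is_deriveB dB (is_derive_mulmxr J (is_derive_mulmxl J dB)).
have -> : chart_shape i = (fun y => (P y *m F y)^T *m cubic i y *m (P y *m F y)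
    - J *m ((P y *m F y)^T *m cubic i y *m (P y *m F y)) *m J).
  apply/funext => y; have tPy : (invmx (F y *m (F y)^T))^T = invmx (F y *m (F y)^T) := gram_inv_tr (F y).
  by rewrite /chart_shape /shape_op trmx_mul tPy !mulmxA.
exact: (eq_ind _ (is_derive x (e_ m) _) dL _ e).
Qed.

Lemma differentiable_chart_shape i x : U x -> differentiable (chart_shape i) x.
Proof.
move=> Ux; have dF := differentiable_frame smoothf Ux.
have dC := differentiable_cubic i Ux.
have dP := differentiable_inv_metric smoothf freef Ux.
have dc k l (A : 'M[R]_(k, l)) : differentiable (fun _ : 'rV[R]_n => A) x by exact: differentiable_cst.
have dFt := differentiable_trmx dF.
apply: differentiableB.
  by do 4! [apply: differentiable_mulmx => //].
by do 6! [apply: differentiable_mulmx => //].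
Qed.
Local Notation L := (chart_shape).

(** By [is_derive_chart_shape] the entries of the commutators with the constant matrix [E] satisfy a
    linear homogeneous system along the segment, with Christoffel symbols as coefficients. *)
Lemma chart_shape_comm_segment (E : 'M[R]_(n + n)) x v :
  (forall t : R, 0 <= t <= 1 -> U (x + t *: v)) ->
  (forall i, L i x *m E = E *m L i x) ->
  forall i, L i (x + v) *m E = E *m L i (x + v).
Proof.
move=> seg h0 i; apply/eqP; rewrite -subr_eq0; apply/eqP/matrixP => a b; rewrite [RHS]mxE.
pose Q k y : 'M[R]_(n + n) := L k y *m E - E *m L k y.
pose u k y : R := Q k y a b.
pose B k l y : R := \sum_m v 0 m * conn f m y k l.
have dL k y : U y -> differentiable (L k) y by exact: (differentiable_chart_shape).
have dc k l (A : 'M[R]_(k, l)) y : differentiable (fun _ : 'rV[R]_n => A) y by exact: differentiable_cst.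
have dQ k y : U y -> differentiable (Q k) y.
  by move=> Uy; apply: differentiableB; apply: differentiable_mulmx => //; exact: dL.
have du k y : U y -> differentiable (u k) y by move=> Uy; apply: differentiable_entry; exact: dQ.
have pu m k y : U y -> partial m (u k) y = \sum_l conn f m y k l * u l y.
  move=> Uy; have h := is_derive_chart_shape m k Uy.
  have hQ := is_deriveB (is_derive_mulmxr E h) (is_derive_mulmxl E h).
  have [_] := is_derive_entry a b hQ; rewrite /partial => ->.
  have e (g : 'I_n -> R) (A : 'I_n -> 'M[R]_(n + n)) :
     ((\sum_l g l *: A l) *m E - E *m (\sum_l g l *: A l)) a b
     = \sum_l g l * (A l *m E - E *m A l) a b.
    rewrite mulmx_suml mulmx_sumr -sumrB summxE; apply: eq_bigr => l _.
    by rewrite -scalemxAl -scalemxAr -scalerBr mxE.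
  exact: e.
apply: (@linear_ode_zero R _ 'I_n u B x v _ _ _ _ i).
- by move=> t k /seg; exact: du.
- move=> t k l /seg Uy; apply: differentiable_bigsum => m.
  apply: differentiableZ; apply: differentiable_entry.
  exact: (differentiable_conn smoothf freef).
- move=> t k /seg Uy; rewrite derive_partial; last exact: du.
  under eq_bigr do rewrite pu // scaler_sumr.
  rewrite exchange_big /=; apply: eq_bigr => l _; rewrite /B mulr_suml; apply: eq_bigr => m _.
  exact: mulrA.
- by move=> k; rewrite /u /Q h0 subrr mxE.
Qed.

Lemma cproj_value_at (b : 'rV[R]_(n + n)) x : U x -> b *m b^T = 1%:M ->
  (forall i, L i x *m cproj b = cproj b *m L i x) ->
  N * (f x *m cproj b *m (f x)^T) 0 0 = 1.
Proof.
move=> Ux bb LE.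
have CC i j := cubic_flat i j Ux.
have tC k := trace_cubic k Ux.
exact: (@cproj_value R n (F x) (freef Ux) (lagf Ux) (C x) (cubic_family Ux) CC
  (f x) (nrm Ux) (sum_rot_cubic Ux) N tC b bb LE).
Qed.

(* Differentiating [f E f^T] twice expresses each [E] through the commuting [L i]. *)
Lemma cproj_comm_at (b : 'I_n -> 'rV[R]_(n + n)) x : U x ->
  (forall j k, cproj (b j) *m cproj (b k) = if j == k then cproj (b j) else 0) ->
  (\forall y \near x, forall j, N * (f y *m cproj (b j) *m (f y)^T) 0 0 = 1) ->
  forall i j, L i x *m cproj (b j) = cproj (b j) *m L i x.
Proof.
move=> Ux EE nE.
have CC i j := cubic_flat i j Ux.
have [V oV Vx hV] : exists2 V : set 'rV[R]_n, open V & V x /\ 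
    forall y, V y -> U y /\ forall j, N * (f y *m cproj (b j) *m (f y)^T) 0 0 = 1.
  have : nbhs x (fun y => U y /\ forall j, N * (f y *m cproj (b j) *m (f y)^T) 0 0 = 1).
    exact: filterI (near_dom oU Ux) nE.
  by rewrite nbhsE => -[V [oV Vx] hV]; exists V.
case: Vx hV => Vx hV.
have hV1 y (Vy : V y) := (hV y Vy).1; have hV2 y (Vy : V y) := (hV y Vy).2.
have tE j : (cproj (b j))^T = cproj (b j) by exact: cproj_tr.
(* The first derivative of the modulus identity says that E_j f is normal on [V]. *)
have fE y j : V y -> F y *m cproj (b j) *m (f y)^T = 0.
  move=> Vy; apply/row_matrixP => i; rewrite row0.
  have Uy := hV1 y Vy.
  have df := is_derive_partial i (smooth0 smoothf Uy).
  have h := is_derive_mulmx (is_derive_mulmxr (cproj (b j)) df) (is_derive_trmx df).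
  have h0 : is_derive y (e_ i) (cst (N^-1%:M : 'M[R]_1)) 0 by exact: is_derive_cst.
  have q := is_derive_unique oV Vy h h0 _.
  have {q} : partial i f y *m cproj (b j) *m (f y)^T + f y *m cproj (b j) *m (partial i f y)^T = 0.
    apply: q => z Vz; rewrite [LHS]mx11_scalar; congr _%:M.
    by apply: (mulfI N0); rewrite divff // hV2.
  have a (r z : 'rV[R]_(n + n)) (A : 'M[R]_(n + n)) : A^T = A -> r *m A *m z^T + z *m A *m r^T = 0 -> r *m A *m z^T = 0.
    move=> tA; have -> : z *m A *m r^T = (r *m A *m z^T)^T by rewrite !trmx_mul trmxK tA mulmxA.
    move: (r *m A *m z^T) => S /matrixP /(_ 0 0); rewrite 2!mxE [RHS]mxE -mulr2n => /eqP.
    rewrite mulrn_eq0 /= => /eqP S0; apply/matrixP => p q; by rewrite !ord1 S0 mxE.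
  move=> q; rewrite !row_mul rowK; exact: a (tE j) q.
have Fxj := fE x ^~ Vx.
apply: (@cproj_comm_normal R n (F x) (freef Ux) (lagf Ux) (C x) CC (f x) b EE).
- move=> j; apply: trmx_inj; rewrite trmx0 !trmx_mul trmxK tE mulmxA; exact: Fxj.
- move=> j; set w := _ *m invmx _.
  (* The second derivative meets the splitting of d_i d_k f, whose tangent part is orthogonal to E_j
     f by [Fxj]. *)
  have row_C i : cubic i x *m w^T = - (hess f i x *m cproj (b j) *m (f x)^T).
    have a (z : 'rV[R]_(n + n)) (Fx H : 'M[R]_(n, n + n)) (E : 'M[R]_(n + n)) (Gm Ci Px : 'M[R]_n) :
       E^T = E -> E *m J = J *m E -> Px^T = Px -> Fx *m E *m z^T = 0 ->
       H = Gm *m Fx + Ci *m Px *m Fx *m J ->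
       Ci *m (z *m E *m J *m Fx^T *m Px)^T = - (H *m E *m z^T).
      move=> tE' EJ tPx FEz ->; rewrite !trmx_mul trmxK Jmx_tr tE' tPx !mulmxDl.
      have -> : Gm *m Fx *m E *m z^T = 0 by rewrite -!mulmxA (mulmxA Fx) FEz mulmx0.
      by rewrite add0r !mulNmx !mulmxN !mulmxA.
    exact: a (tE j) (cprojJ (b j)) (gram_inv_tr (F x)) (Fxj j) (hess_split i Ux).
  apply/matrixP => k i; rewrite summxE.
  have -> : \sum_l (w 0 l *: cubic l x) k i = (cubic i x *m w^T) k 0.
    have aux (v : 'rV[R]_n) (D : 'I_n -> 'M[R]_n) : symmetric_family D ->
        \sum_l (v 0 l *: D l) k i = (D i *m v^T) k 0.
      move=> sD; rewrite mxE; apply: eq_bigr => l _; rewrite !mxE mulrC; congr (_ * _).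
      by have [] := family_entry l k i sD.
    exact: (aux w (C x) (sC Ux)).
  rewrite row_C.
  have df := is_derive_partial i (smooth0 smoothf Ux).
  have dF := is_derive_frame smoothf i Ux.
  have h := is_derive_mulmx (is_derive_mulmxr (cproj (b j)) dF) (is_derive_trmx df).
  have h0 : is_derive x (e_ i) (cst (0 : 'cV[R]_n)) 0 by exact: is_derive_cst.
  have := is_derive_unique oV Vx h h0 (fun y Vy => fE y j Vy).
  move=> /eqP; rewrite addrC addr_eq0 => /eqP <-.
  rewrite -row_mul_col [RHS]mxE [LHS]mxE; apply: eq_bigr => p _.
  by rewrite [col i _ p 0]mxE [(F x)^T p i]mxE [F x i p]mxE [(partial i f x)^T p 0]mxE [row _ _ _ _]mxE.
- by move=> j; apply/eqP => e; have := hV2 x Vx j; rewrite e mulr0 => /eqP; rewrite eq_sym oner_eq0.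
Qed.

(** A ball is convex, so the segment from [x'] to any of its points stays in [U]. That [x'] is not
    tied to the center is what allows a limit point to serve as center. *)
Lemma cproj_value_ball (b : 'I_n -> 'rV[R]_(n + n)) x x' (r : R) : 0 < r ->
  (forall y, ball x r y -> U y) ->
  (forall j, b j *m (b j)^T = 1%:M) -> 
  ball x r x' ->
  (forall i j, L i x' *m cproj (b j) = cproj (b j) *m L i x') ->
  forall y, ball x r y -> forall j, N * (f y *m cproj (b j) *m (f y)^T) 0 0 = 1.
Proof.
move=> r0 rU bb x'r Lx' y yr j; apply: cproj_value_at => //; first exact: rU.
have -> : y = x' + (y - x') by rewrite addrC subrK.
apply: chart_shape_comm_segment => // t /andP[t0 t1]; apply: rU.
have -> : x' + t *: (y - x') = (1 - t) *: x' + t *: y.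
  by rewrite scalerBr scalerBl scale1r addrAC addrA.
move: x'r yr; rewrite -ball_normE /ball_ /= => x'r yr.
have -> : x - ((1 - t) *: x' + t *: y) = (1 - t) *: (x - x') + t *: (x - y).
  by rewrite !scalerBr addrACA -scalerDl subrK scale1r opprD.
apply: le_lt_trans (ler_normD _ _) _; rewrite !normrZ (ger0_norm t0) ger0_norm ?subr_ge0 //.
have a (s p q : R) : 0 <= s -> s <= 1 -> p < r -> q < r -> (1 - s) * p + s * q < r.
  move=> + s1 pr qr; rewrite le_eqVlt => /orP[/eqP <-|s0]; first lra.
  have h1 : 0 < s * (r - q) by rewrite mulr_gt0 // subr_gt0.
  have h2 : 0 <= (1 - s) * (r - p) by rewrite mulr_ge0 // subr_ge0 // ltW.
  lra.
exact: a.
Qed.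
End LagrangianCharts.

Lemma elliptic_local_min (R : realType) n (u : 'rV[R]_n -> R) x (a T : 'M[R]_n) b :
  (\forall y \near x, differentiable u y) ->
  (forall i, differentiable (partial i u) x) ->
  (\forall y \near x, u x <= u y) -> a = T^T *m T -> 0 <= elliptic a b u x.
Proof.
move=> du ddu mn aE.
have p1 i y : differentiable u y -> partial i (fun z => - u z) y = - partial i u y.
  by move=> dy; rewrite /partial deriveN //; exact: diff_derivable.
have np1 i : \forall y \near x, - partial i u y = partial i (fun z => - u z) y.
  by apply: filterS du => y dy; rewrite p1.
have ux := nbhs_singleton du.
have p2 i j : partial i (partial j (fun z => - u z)) x = - partial i (partial j u) x.
  rewrite /partial -(near_eq_derive _ (np1 j)) deriveN //; exact: diff_derivable.
suff : elliptic a b (fun z => - u z) x <= 0.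
  have -> : elliptic a b (fun z => - u z) x = - elliptic a b u x; last by rewrite oppr_le0.
  rewrite /elliptic opprD -!sumrN; congr (_ + _); apply: eq_bigr => i _; last first.
    by rewrite p1 // mulrN.
  by rewrite -sumrN; apply: eq_bigr => j _; rewrite p2 mulrN.
apply: elliptic_local_max aE.
- by apply: filterS du => y dy; exact: differentiableN.
- move=> i; apply: near_eq_differentiable (np1 i) _; exact: differentiableN.
- by apply: filterS mn => y; rewrite lerN2.
Qed.

(** * Passing between neighborhoods in the manifold and in charts *)

Section Charts.
Context {R : realType} {n : nat} {M : topologicalType}.
Implicit Types (c : chart R n M) (p : M).

Lemma chart_near c p (B : set 'rV[R]_n) : chart_dom c p -> nbhs (chart_map c p) B ->
  \forall q \near p, chart_dom c q /\ B (chart_map c q).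
Proof.
move=> cp nB; have od := chart_dom_open c.
have nd : nbhs p (chart_dom c) by exact: open_nbhs_nbhs.
apply: filterI => //.
have := chart_map_continuous (c := c); rewrite continuous_open_subspace // => h.
by apply: (h p); rewrite ?inE.
Qed.

Lemma chart_inv_near c p (B : set M) : chart_dom c p -> nbhs p B ->
  \forall x \near chart_map c p, (chart_map c @` chart_dom c) x /\ B (chart_inv c x).
Proof.
move=> cp nB; have od := @chart_cod_open _ _ _ c.
have cx : (chart_map c @` chart_dom c) (chart_map c p) by exists p.
have nd : nbhs (chart_map c p) (chart_map c @` chart_dom c) by exact: open_nbhs_nbhs.
apply: filterI => //.
have := chart_inv_continuous (c := c); rewrite continuous_open_subspace // => h.
by apply: (h (chart_map c p)); rewrite ?inE ?chart_mapK.
Qed.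

Lemma clopen_setT (S : set M) p : connected [set: M] -> S p ->
  (forall q, S q -> nbhs q S) -> closed S -> S = [set: M].
Proof.
move=> cM Sp oS cS; apply: cM; first by exists p.
  by exists S; rewrite ?setTI // openE => q; exact: oS.
by exists S; rewrite ?setTI.
Qed.
End Charts.

(** * Unitary frames and the projections onto their complex lines *)

Section UnitaryFrames.
Context {R : realType} {n : nat}.
Local Notation J := (Jmx R n).
Variable B : 'M[R]_(n, n + n).
Hypothesis BB : B *m B^T = 1%:M.
Hypothesis BJB : B *m J *m B^T = 0.
Local Notation b j := (row j B).

(** The real form of the unitary matrix whose rows are those of [B]. *)
Definition unitary_completion : 'M[R]_(n + n) := col_mx B (B *m J).

Lemma unitary_completionP : unitary_map unitary_completion.
Proof.
split.
  rewrite /unitary_completion tr_col_mx mul_col_row trmx_mul Jmx_tr !mulNmx !mulmxN !mulmxA.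
  by rewrite mulJJ mulNmx BB BJB opprK oppr0 -scalar_mx_block.
move=> z; rewrite !JmapE -!mulmxA; congr (_ *m _).
rewrite /unitary_completion mul_col_mx mulJJ.
rewrite /Jmx mul_block_col !mul0mx mul1mx add0r addr0 mulNmx mul1mx.
by [].
Qed.

Lemma unitary_completion_norm (z : 'rV[R]_(n + n)) j :
  lsubmx (z *m unitary_completion^T) 0 j ^+ 2 + rsubmx (z *m unitary_completion^T) 0 j ^+ 2
  = (z *m cproj (b j) *m z^T) 0 0.
Proof.
rewrite /unitary_completion tr_col_mx mul_mx_row row_mxKl row_mxKr.
have h (D : 'M[R]_(n, n + n)) : (z *m D^T) 0 j ^+ 2 = (z *m (row j D)^T *m row j D *m z^T) 0 0.
  have -> : z *m (row j D)^T *m row j D *m z^T = (z *m (row j D)^T) *m (z *m (row j D)^T)^T.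
    by rewrite [in RHS]trmx_mul trmxK mulmxA.
  have -> : (z *m D^T) 0 j = (z *m (row j D)^T) 0 0.
    by rewrite tr_row mxE [RHS]mxE; apply: eq_bigr => k _; rewrite [col _ _ _ _]mxE.
  by rewrite [z *m _]mx11_scalar tr_scalar_mx -scalar_mxM mxE eqxx mulr1n !mxE eqxx mulr1n expr2.
rewrite !h row_mul trmx_mul Jmx_tr mulNmx /cproj mulmxBr mulmxBl !mulmxA.
by rewrite !mulmxN !mulNmx !mulmxA [RHS]mxE.
Qed.

Lemma cproj_orthogonal j k : cproj (b j) *m cproj (b k) = if j == k then cproj (b j) else 0.
Proof.
have e1 : b j *m (b k)^T = (j == k)%:R%:M.
  rewrite [LHS]mx11_scalar; congr _%:M; have := row_form B 1%:M B j k; rewrite !mulmx1 => ->.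
  by rewrite BB mxE.
have e2 : b j *m J *m (b k)^T = 0.
  rewrite [LHS]mx11_scalar row_form BJB mxE; exact: raddf0.
have -> : cproj (b j) *m cproj (b k) = (j == k)%:R *: ((b j)^T *m b k - J *m (b j)^T *m b k *m J).
  have t m (X : 'M[R]_(m, 1)) (Y : 'rV[R]_(n + n)) (s : R) : X *m s%:M *m Y = s *: (X *m Y).
    by rewrite mul_mx_scalar scalemxAl.
  rewrite /cproj; move: (b j) (b k) e1 e2 => v w e1 e2.
  have h1 : v^T *m v *m (w^T *m w) = (j == k)%:R *: (v^T *m w).
    by rewrite mulmxA -(mulmxA _ v) e1 t.
  have h2 : v^T *m v *m (J *m w^T *m w *m J) = 0.
    by rewrite !mulmxA -(mulmxA _ v) -(mulmxA v^T) e2 mulmx0 !mul0mx.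
  have h3 : J *m v^T *m v *m J *m (w^T *m w) = 0.
    by rewrite !mulmxA -(mulmxA _ v) -(mulmxA _ (v *m J)) e2 mulmx0 !mul0mx.
  have h4 : J *m v^T *m v *m J *m (J *m w^T *m w *m J) = - ((j == k)%:R *: (J *m v^T *m w *m J)).
    rewrite !mulmxA mulJJ !mulNmx -(mulmxA _ v) e1; congr (- _).
    by rewrite t -!scalemxAl.
  by rewrite mulmxBl !mulmxBr h1 h2 h3 h4 subr0 sub0r opprK scalerBr.
by case: eqVneq => [->|_]; rewrite ?scale1r ?scale0r.
Qed.
End UnitaryFrames.

(** * Global arguments on the closed soliton *)

Section LagrangianSolitons.
Context {R : realType} {n : nat} {M : topologicalType}.
Variables (A : smooth_atlas R n M) (phi : M -> 'rV[R]_(n + n)).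
Hypothesis n0 : (0 < n)%N.
Hypothesis hM : closed_manifold A.
Hypothesis himm : immersion A phi.
Hypothesis hlag : lagrangian A phi.
Hypothesis hsol : imcf_homothetic_soliton A phi.
Local Notation J := (Jmx R n).

Local Notation U c := (chart_map c @` chart_dom c).
Local Notation f c := (phi \o chart_inv c).

Lemma in_charts_at (Q : ('rV[R]_n -> 'rV[R]_(n + n)) -> 'rV[R]_n -> Prop) c :
  charts A c -> in_charts A phi Q -> forall x, U c x -> Q (f c) x.
Proof. by move=> Ac hQ x [p cp <-]; exact: hQ. Qed.

Lemma chart_smooth c : charts A c -> smooth_on (U c) (f c).
Proof. exact: himm.1. Qed.

Lemma chart_free c : charts A c -> forall x, U c x -> row_free (frame (f c) x).
Proof. by move=> Ac; exact: (in_charts_at Ac himm.2). Qed.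

Lemma chart_lag c : charts A c -> forall x, U c x ->
  frame (f c) x *m J *m (frame (f c) x)^T = 0.
Proof.
move=> Ac x Ux; apply/matrixP => i j; rewrite [RHS]mxE -row_form !rowK -JmapE.
exact: (in_charts_at Ac hlag Ux i j).
Qed.

Lemma phi_near p (B : set 'rV[R]_(n + n)) : nbhs (phi p) B -> \forall q \near p, B (phi q).
Proof.
have [c Ac cp] := charts_cover A p; move=> nB.
have Ux : U c (chart_map c p) by exists p.
have df := smooth0 (chart_smooth Ac) Ux.
have nB' : nbhs ((f c) (chart_map c p)) B by rewrite /= chart_mapK.
have := chart_near cp (differentiable_continuous df nB'); apply: filterS => q [cq].
by rewrite /= chart_mapK.
Qed.

Lemma phi_continuous : continuous phi.
Proof. by move=> p B; exact: phi_near. Qed.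

Lemma sqnorm_continuous : continuous (fun p => dot (phi p) (phi p)).
Proof.
move=> p; apply: (@continuous_comp _ _ _ phi (fun z => dot z z)); first exact: phi_continuous.
apply: differentiable_continuous.
by apply: differentiable_dot.
Qed.

(** Take the inner product of the soliton equation with H: the left side gives -1, and H sees the
    whole position vector because it is normal. *)
Lemma soliton_support : exists2 a : R, a != 0 &
  in_charts A phi (fun f x => dot (mean_curvature f x) (f x) = - a^-1).
Proof.
have [hH [a a0 ha]] := hsol; exists a => // c p Ac cp.
have Ux : U c (chart_map c p) by exists p.
have := ha c p Ac cp; have := hH c p Ac cp => /=; set H := mean_curvature _ _ => H0 e.
have HF : H *m (frame (f c) (chart_map c p))^T = 0.
  exact: (mean_curvature_normal (chart_free Ac) Ux).
have := congr1 (fun z => dot H z) e; rewrite /=.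
have -> : dot H (- ((dot H H)^-1 *: H)) = -1.
  rewrite /dot linearN linearZ /= mulmxN -scalemxAr mxE [in X in - X]mxE -/(dot H H).
  by rewrite mulVf // dot_eq0.
have -> : dot H (a *: normal_part (f c) (chart_map c p) ((f c) (chart_map c p)))
    = a * dot H ((f c) (chart_map c p)).
  rewrite /dot linearZ -scalemxAr mxE; congr (_ * _).
  rewrite /normal_part /tangent_part linearB /= mulmxBr !trmx_mul trmxK.
  by rewrite !mulmxA HF !mul0mx subr0.
by move=> e1; apply: (mulfI a0); rewrite -e1 mulrN divff.
Qed.

Lemma elliptic_support c a : charts A c ->
  in_charts A phi (fun f x => dot (mean_curvature f x) (f x) = a) ->
  forall x, U c x -> elliptic (invmx (induced_metric (f c) x)) (lap_drift (f c) x)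
    (fun y => dot (f c y) (f c y)) x = 2 * (n%:R + a).
Proof.
move=> Ac ha x Ux.
by rewrite (elliptic_sqnorm (@chart_cod_open _ _ _ c) (chart_smooth Ac) (chart_free Ac) Ux)
  (in_charts_at Ac ha Ux).
Qed.

Lemma support_value (a : R) :
  in_charts A phi (fun f x => dot (mean_curvature f x) (f x) = a) -> a = - n%:R.
Proof.
move=> ha; have [_ cM _ [p0 _]] := hM.
have cu : {within [set: M], continuous (fun p => dot (phi p) (phi p))}.
  by apply: continuous_subspaceT; exact: sqnorm_continuous.
have M0 : [set: M] !=set0 by exists p0.
have dd c p : charts A c -> chart_dom c p ->
    \forall y \near chart_map c p, differentiable (fun y => dot (f c y) (f c y)) y.
  move=> Ac cp; have nd : \forall y \near chart_map c p, U c y.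
    by apply: near_dom; [exact: chart_cod_open|exists p].
  by apply: filterS nd => y Uy; exact: (differentiable_sqnorm (chart_smooth Ac)).
have ddd c p i : charts A c -> chart_dom c p ->
    differentiable (partial i (fun y => dot (f c y) (f c y))) (chart_map c p).
  move=> Ac cp; apply: (differentiable_partial_sqnorm (@chart_cod_open _ _ _ c) (chart_smooth Ac)).
  by exists p.
apply/eqP; rewrite eq_le; apply/andP; split.
  have [p _ mx] := compact_EVT_max M0 cM cu.
  have [c Ac cp] := charts_cover A p.
  have Ux : U c (chart_map c p) by exists p.
  have [T aE _] := gram_inv_factor (chart_free Ac Ux).
  have := elliptic_local_max (lap_drift (f c) (chart_map c p)) (dd c p Ac cp) (fun i => ddd c p i Ac cp) _ aE.
  rewrite (elliptic_support Ac ha Ux) pmulr_rle0 // -lerBrDl sub0r; apply.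
  by apply: filterE => y /=; rewrite chart_mapK //; apply: mx; rewrite inE.
have [p _ mn] := compact_EVT_min M0 cM cu.
have [c Ac cp] := charts_cover A p.
have Ux : U c (chart_map c p) by exists p.
have [T aE _] := gram_inv_factor (chart_free Ac Ux).
have := elliptic_local_min (lap_drift (f c) (chart_map c p)) (dd c p Ac cp) (fun i => ddd c p i Ac cp) _ aE.
rewrite (elliptic_support Ac ha Ux) pmulr_rge0 // -lerBlDl sub0r; apply.
by apply: filterE => y /=; rewrite chart_mapK //; apply: mn; rewrite inE.
Qed.

Lemma sqnorm_constant : exists r2 : R, forall p, dot (phi p) (phi p) = r2.
Proof.
have [a a0 ha] := soliton_support; have ea := support_value ha.
have [_ cM coM [p0 _]] := hM.
have cu : {within [set: M], continuous (fun p => dot (phi p) (phi p))}.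
  by apply: continuous_subspaceT; exact: sqnorm_continuous.
have M0 : [set: M] !=set0 by exists p0.
have [p _ mx] := compact_EVT_max M0 cM cu.
exists (dot (phi p) (phi p)).
pose S := [set q | dot (phi q) (phi q) = dot (phi p) (phi p)].
suff ST : S = [set: M] by move=> q; have : S q by rewrite ST.
apply: (clopen_setT (p := p)) => //.
  move=> q Sq; have [c Ac cq] := charts_cover A q.
  have Ux : U c (chart_map c q) by exists q.
  have sm := strong_max (@chart_cod_open _ _ _ c)
    (fun y Uy => differentiable_sqnorm (chart_smooth Ac) Uy)
    (fun y i Uy => differentiable_partial_sqnorm (@chart_cod_open _ _ _ c) (chart_smooth Ac) i Uy)
    (fun y Uy => differentiable_inv_metric (chart_smooth Ac) (chart_free Ac) Uy)
    (fun y Uy => differentiable_lap_drift (chart_smooth Ac) (chart_free Ac) Uy)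
    (fun y Uy => gram_inv_factor (chart_free Ac Uy)).
  have := sm (dot (phi p) (phi p)) _ _ _ Ux.
  have h1 y : U c y -> elliptic (invmx (induced_metric (f c) y)) (lap_drift (f c) y)
    (fun y => dot (f c y) (f c y)) y = 0.
    by move=> Uy; rewrite (elliptic_support Ac ha Uy) ea subrr mulr0.
  have h2 y : U c y -> dot (f c y) (f c y) <= dot (phi p) (phi p).
    by move=> _; apply: mx; rewrite inE.
  move=> /(_ h1 h2); rewrite /= chart_mapK // => /(_ Sq) nS.
  by have := chart_near cq nS; apply: filterS => z [cz]; rewrite /= chart_mapK.
have -> : S = (fun q => dot (phi q) (phi q)) @^-1` [set dot (phi p) (phi p)] by [].
by apply: preimage_closed => [q _|]; [exact: sqnorm_continuous|exact: closed_eq].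
Qed.

Lemma soliton_spherical : exists2 N : R, 0 < N &
  (forall p, dot (phi p) (phi p) = n%:R / N) /\
  in_charts A phi (fun f x => f x *m (frame f x)^T = 0 /\ mean_curvature f x = - N *: f x).
Proof.
have [r2 hr] := sqnorm_constant.
have [a a0 ha] := soliton_support; have ea := support_value ha.
have nF : in_charts A phi (fun f x => f x *m (frame f x)^T = 0).
  move=> c p Ac cp; apply/rowP => i; rewrite [RHS]mxE.
  have Ux : U c (chart_map c p) by exists p.
  have := partial_sqnorm (chart_smooth Ac) i Ux.
  have -> : (fun x => dot (f c x) (f c x)) = cst r2 by apply/funext => x; exact: hr.
  rewrite /partial derive_cst => /esym/eqP; rewrite mulf_eq0 pnatr_eq0 /= => /eqP e.
  apply: etrans e; rewrite [RHS]mxE [LHS]mxE; apply: eq_bigr => k _.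
  by rewrite [X in _ * X]mxE [X in _ * X]mxE [X in _ = _ * X]mxE mulrC.
have [p0 _] : [set: M] !=set0 by case: hM.
(* With phi normal, the soliton equation makes H a multiple of phi; the value - n of <H, phi>
   determines the factor. *)
have key c p : charts A c -> chart_dom c p ->
   mean_curvature (f c) (chart_map c p) = - (n%:R / r2) *: phi p /\ 0 < r2.
  move=> Ac cp; have [hH [b b0 hb]] := hsol.
  have := hb c p Ac cp; have := hH c p Ac cp; have := ha c p Ac cp; have := nF c p Ac cp => /=.
  rewrite chart_mapK //; set H := mean_curvature _ _ => nFp dHp H0.
  have -> : normal_part (f c) (chart_map c p) (phi p) = phi p.
    by rewrite /normal_part /tangent_part nFp !mul0mx subr0.
  move=> e; have HE : H = - (b * dot H H) *: phi p.
    have := congr1 (fun z => - dot H H *: z) e; rewrite scalerN scaleNr opprK scalerA.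
    by rewrite mulfV ?dot_eq0 // scale1r scalerA mulNr [b * _]mulrC.
  have p0' : phi p != 0 by apply: contraNneq H0 => z; rewrite HE z scaler0.
  have r20 : 0 < r2 by rewrite -(hr p) dot_gt0.
  split => //; rewrite {1}HE; congr (_ *: _).
  have dz (k : R) (z : 'rV[R]_(n + n)) : dot (k *: z) z = k * dot z z.
    by rewrite /dot -scalemxAl mxE.
  have e1 : - (b * dot H H) * r2 = - n%:R by rewrite -(hr p) -(dz _ (phi p)) -HE dHp ea.
  have r2n : r2 != 0 by rewrite gt_eqF.
  by apply: (mulIf r2n); rewrite e1 mulNr mulfVK.
have [c0 Ac0 cp0] := charts_cover A p0; have [_ r20] := key c0 p0 Ac0 cp0.
have nn : 0 < n%:R :> R by rewrite ltr0n.
exists (n%:R / r2); first by rewrite divr_gt0.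
split=> [p|c p Ac cp]; first by rewrite hr invf_div mulrC mulfVK // gt_eqF.
split; first exact: nF.
by have [-> _] := key c p Ac cp; rewrite /= chart_mapK.
Qed.
Hypothesis n2 : (2 <= n)%N.
Variable N : R.
Hypothesis N0 : N != 0.
Hypothesis hN : in_charts A phi (fun f x => f x *m (frame f x)^T = 0 /\ mean_curvature f x = - N *: f x).
Hypothesis hK : constant_sectional_curvature A phi.

Let nrm c (Ac : charts A c) x (Ux : U c x) := (in_charts_at Ac hN Ux).1.
Let mcf c (Ac : charts A c) x (Ux : U c x) := (in_charts_at Ac hN Ux).2.

Lemma adapted_frame : exists (B : 'M[R]_(n, n + n)) (p0 : M) (c0 : chart R n M),
  [/\ B *m B^T = 1%:M, B *m J *m B^T = 0, charts A c0, chart_dom c0 p0 &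
    forall i j, chart_shape (f c0) i (chart_map c0 p0) *m cproj (row j B)
      = cproj (row j B) *m chart_shape (f c0) i (chart_map c0 p0)].
Proof.
have [K hK0] := hK; have [_ _ _ [p0 _]] := hM.
have [c Ac cp] := charts_cover A p0.
have Ux : U c (chart_map c p0) by exists p0.
set x := chart_map c p0 in Ux.
have oU := @chart_cod_open _ _ _ c.
have sf := chart_smooth Ac; have ff := chart_free Ac; have lf := chart_lag Ac.
have CC i j := cubic_flat oU sf ff lf n2 (nrm Ac) (in_charts_at Ac hK0) i j Ux.
have sC : symmetric_family ((cubic (f c))^~ x) := cubic_family oU sf lf Ux.
have wC := sum_rot_cubic oU sf ff lf (nrm Ac) Ux.
have [T TG TC] := codiagonalization sC (gram_tr (frame (f c) x)) (gram_posdef (ff x Ux))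
  (PG1 (ff x Ux)) CC wC.
have cb j := cproj_comm_base (ff x Ux) (lf x Ux) sC j TG TC.
exists (T *m frame (f c) x), p0, c; split => //.
- by rewrite trmx_mul mulmxA -(mulmxA T).
- by rewrite trmx_mul mulmxA (lag_mul (lf x Ux)).
- by move=> i j; exact: ((cb j).2 i).
Qed.

(** The points near which all moduli take this value form a clopen set, nonempty by [adapted_frame].
    For closedness, a chart ball around a limit point contains a point of the set; there
    [cproj_comm_at] recovers the commutation, which then spreads over the ball. *)
Lemma circle_moduli : exists B : 'M[R]_(n, n + n),
  [/\ B *m B^T = 1%:M, B *m J *m B^T = 0 &
    forall p j, N * (phi p *m cproj (row j B) *m (phi p)^T) 0 0 = 1].
Proof.
have [B [p0 [c0 [BB BJB Ac0 cp0 base]]]] := adapted_frame; exists B; split => //.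
have [K hK0] := hK.
have bb j : row j B *m (row j B)^T = 1%:M.
  rewrite [LHS]mx11_scalar; congr _%:M; have := row_form B 1%:M B j j; rewrite !mulmx1 => ->.
  by rewrite BB mxE eqxx.
pose Q p := forall j, N * (phi p *m cproj (row j B) *m (phi p)^T) 0 0 = 1.
have ball_prop c p (r : R) x' : charts A c -> chart_dom c p -> 0 < r ->
    (forall y, ball (chart_map c p) r y -> U c y) -> ball (chart_map c p) r x' ->
    (forall i j, chart_shape (f c) i x' *m cproj (row j B) = cproj (row j B) *m chart_shape (f c) i x') ->
    \forall q \near p, Q q.
  move=> Ac cp r0 rU x'r cx'; have oU := @chart_cod_open _ _ _ c.
  have sf := chart_smooth Ac; have ff := chart_free Ac; have lf := chart_lag Ac.
  have h := cproj_value_ball oU sf ff lf n2 (nrm Ac) N0 (mcf Ac) (in_charts_at Ac hK0) r0 rU bb x'r cx'.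
  have := chart_near cp (nbhsx_ballx (chart_map c p) r r0); apply: filterS => q [cq bq] j.
  by have := h _ bq j; rewrite /= chart_mapK.
have chart_ball c p : charts A c -> chart_dom c p ->
    exists2 r : R, 0 < r & forall y, ball (chart_map c p) r y -> U c y.
  move=> Ac cp; have nU : nbhs (chart_map c p) (U c) by apply: near_dom; [exact: chart_cod_open|exists p].
  by have /nbhs_ballP[r r0 hr] := nU; exists r.
suff ST : [set p | \forall q \near p, Q q] = [set: M].
  move=> p; have : [set p | \forall q \near p, Q q] p by rewrite ST.
  exact: nbhs_singleton.
have [_ _ coM _] := hM; apply: (clopen_setT (p := p0)) => //.
- have [r r0 rU] := chart_ball c0 p0 Ac0 cp0.
  exact: ball_prop Ac0 cp0 r0 rU (ballxx _ r0) base.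
- by move=> q; exact: nbhs_interior.
move=> p clp; have [c Ac cp] := charts_cover A p.
have [r r0 rU] := chart_ball c p Ac cp.
have [q [/= nQ [cq bq]]] := clp _ (chart_near cp (nbhsx_ballx (chart_map c p) r r0)).
have oU := @chart_cod_open _ _ _ c.
have sf := chart_smooth Ac; have ff := chart_free Ac; have lf := chart_lag Ac.
have Uq : U c (chart_map c q) by exists q.
have nq : \forall y \near chart_map c q,
    forall j, N * (f c y *m cproj (row j B) *m (f c y)^T) 0 0 = 1.
  by have := chart_inv_near cq nQ; apply: filterS => y [_].
have cx' := cproj_comm_at oU sf ff lf n2 (nrm Ac) N0 (in_charts_at Ac hK0) Uq (cproj_orthogonal BB BJB) nq.
exact: (@ball_prop c p r (chart_map c q) Ac cp r0 rU bq cx').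
Qed.

Lemma circle_decomposition : 0 < N -> exists (rho : R) (V : 'M[R]_(n + n)),
  [/\ 0 < rho, unitary_map V, forall p, product_of_circles (rho^-1 *: (phi p *m V^T)) &
    forall p, phi p = rho *: ((rho^-1 *: (phi p *m V^T)) *m V)].
Proof.
move=> Np; have [B [BB BJB hB]] := circle_moduli.
have uV := unitary_completionP BB BJB.
have s0 : 0 < (Num.sqrt N)^-1 by rewrite invr_gt0 sqrtr_gt0.
(* Each complex coordinate of phi in the frame [B] has squared modulus 1 / N. *)
exists (Num.sqrt N)^-1, (unitary_completion B); split => // [p j|p].
  have e1 (a : R) (z : 'rV[R]_(n + n)) : lsubmx (a *: z) 0 j = a * lsubmx z 0 j by rewrite linearZ mxE.
  have e2 (a : R) (z : 'rV[R]_(n + n)) : rsubmx (a *: z) 0 j = a * rsubmx z 0 j by rewrite linearZ mxE.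
  rewrite e1 e2 !exprMn -mulrDr unitary_completion_norm invrK sqr_sqrtr; last exact: ltW.
  exact: (hB p j).
rewrite -scalemxAl scalerA divff ?gt_eqF // scale1r -mulmxA.
by rewrite (mulmx1C uV.1) mulmx1.
Qed.
End LagrangianSolitons.

(** * Covering the product of circles *)

Section InverseFunction.
Context {R : realType} {n : nat}.
Variables (U : set 'rV[R]_n) (x0 : 'rV[R]_n).
Hypothesis oU : open U.
Hypothesis Ux0 : U x0.
Local Notation e_ i := (delta_mx 0 i : 'rV[R]_n).

Lemma mulmx_bound m p (B : 'M[R]_(m, p)) : exists2 C : R, 0 < C & forall u : 'rV[R]_m, `|u *m B| <= C * `|u|.
Proof.
exists (1 + \sum_k \sum_a `|B k a|).
  by rewrite ltr_pwDl // sumr_ge0 // => k _; rewrite sumr_ge0.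
move=> u; apply: norm_le_entry => [|a].
  by rewrite mulr_ge0 // addr_ge0 // sumr_ge0 // => k _; rewrite sumr_ge0.
rewrite mxE; apply: le_trans (ler_norm_sum _ _ _) _.
rewrite mulrDl mul1r mulr_suml; apply: le_trans (_ : _ <= \sum_(k < m) (\sum_a `|B k a|) * `|u|) _; last first.
  by rewrite lerDr.
apply: ler_sum => k _; rewrite normrM mulrC; apply: ler_pM => //; last exact: entry_norm.
by rewrite (bigD1 a) //= lerDl sumr_ge0.
Qed.

(** The first derivatives are continuous, hence close to the identity near [x0]; the mean value
    theorem on segments does the rest. *)
Lemma near_identity (h : 'rV[R]_n -> 'rV[R]_n) :
  (forall x, U x -> differentiable h x) ->
  (forall i x, U x -> differentiable (partial i h) x) ->
  frame h x0 = 1%:M ->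
  exists2 r : R, 0 < r & (forall z, `|z - x0| <= r -> U z) /\
    forall x y, `|x - x0| <= r -> `|y - x0| <= r ->
      `|(h x - x) - (h y - y)| <= 2^-1 * `|x - y|.
Proof.
move=> dh ddh h1.
(* Each component of the increment collects n errors, which add up to at most 1/2; using n + 1
   avoids a division by zero. *)
pose eps : R := (2 * n.+1%:R)^-1.
have eps0 : 0 < eps by rewrite invr_gt0 mulr_gt0.
have near_frame i a : \forall z \near x0, `|partial i h z 0 a - (i == a)%:R| <= eps.
  have dp : differentiable (fun z => partial i h z 0 a) x0.
    by apply: differentiable_entry; exact: ddh.
  have := differentiable_continuous dp => /cvgrPdist_le /(_ eps eps0).
  have -> : partial i h x0 0 a = (i == a)%:R.
    by have /matrixP /(_ i a) := h1; rewrite !mxE.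
  by apply: filterS => z; rewrite distrC.
have [r r0 hr] : exists2 r : R, 0 < r & forall z, `|z - x0| <= r ->
    U z /\ forall i a, `|partial i h z 0 a - (i == a)%:R| <= eps.
  have : \forall z \near x0, U z /\ forall i a, `|partial i h z 0 a - (i == a)%:R| <= eps.
    apply: filterI; first exact: near_dom.
    exact: (@filter_forall _ _ (fun i z => forall a, `|partial i h z 0 a - (i == a)%:R| <= eps) _ _
      (fun i => @filter_forall _ _ (fun a z => `|partial i h z 0 a - (i == a)%:R| <= eps) _ _ (near_frame i))).
  move=> /nbhs_ballP[r /= r0 hr]; exists (r / 2); first by rewrite divr_gt0.
  move=> z zr; apply: hr; rewrite -ball_normE /= distrC.
  by apply: le_lt_trans zr _; rewrite gtr_pMr // invf_lt1 // ltr1n.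
exists r => //; split=> [z /hr[] //|x y xr yr].
apply: norm_le_entry => [|a]; first by rewrite mulr_ge0 // invr_ge0.
pose g z := h z 0 a - z 0 a.
have seg (t : R) : 0 <= t <= 1 -> `|y + t *: (x - y) - x0| <= r.
  move=> /andP[t0 t1].
  have -> : y + t *: (x - y) - x0 = (1 - t) *: (y - x0) + t *: (x - x0).
    by apply/rowP => j; rewrite !mxE; ring.
  apply: le_trans (ler_normD _ _) _; rewrite !normrZ (ger0_norm t0) ger0_norm ?subr_ge0 //.
  have b (p q s : R) : 0 <= s -> s <= 1 -> p <= r -> q <= r -> (1 - s) * p + s * q <= r.
    move=> s0 s1 pr qr.
    have k1 : 0 <= s * (r - q) by rewrite mulr_ge0 // subr_ge0.
    have k2 : 0 <= (1 - s) * (r - p) by rewrite mulr_ge0 // subr_ge0.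
    lra.
  exact: b.
have dg z : U z -> differentiable g z.
  move=> Uz; apply: differentiableB; apply: differentiable_entry; first exact: dh.
  exact: ex_diff.
have pg i z : U z -> partial i g z = partial i h z 0 a - (i == a)%:R.
  move=> Uz; have d1 := is_derive_entry 0 a (is_derive_partial i (dh z Uz)).
  have d2 := is_derive_entry 0 a (is_derive_id z (e_ i)).
  have := is_deriveB d1 d2; rewrite [(delta_mx 0 i) 0 a]mxE /= => -[_].
  by rewrite eq_sym.
have [c /andP[c0 c1]] := @MVT_interval R (fun t : R => g (y + t *: (x - y)))
  (fun t : R => 'D_(x - y) g (y + t *: (x - y))) 1 ltr01
  (fun t ht => is_derive_line (dg _ (hr _ (seg t ht)).1)).
have -> : y + 1 *: (x - y) = x by rewrite scale1r addrC subrK.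
rewrite scale0r addr0 mulr1 => e.
have c01 : 0 <= c <= 1 by rewrite !ltW.
have -> : (h x - x - (h y - y)) 0 a = g x - g y by rewrite !mxE.
rewrite e derive_partial; last exact: dg (hr _ (seg c c01)).1.
apply: le_trans (ler_norm_sum _ _ _) _.
apply: le_trans (_ : _ <= \sum_(i < n) `|x - y| * eps) _.
  apply: ler_sum => i _; rewrite normrM; apply: ler_pM => //; first exact: entry_norm.
  by rewrite pg; [exact: (hr _ (seg c c01)).2|exact: (hr _ (seg c c01)).1].
have en : eps * n%:R <= 2^-1.
  rewrite /eps invfM -mulrA ler_piMr ?invr_ge0 // mulrC ler_pdivrMr ?ltr0n //.
  by rewrite mul1r ler_nat.
rewrite sumr_const card_ord -(mulr_natr (`|x - y| * eps)) -mulrA mulrC.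
by rewrite ler_wpM2r.
Qed.

(** After composition with the inverse derivative [B] the map is close to the identity. This gives
    the Lipschitz bound, and solving h x = w becomes a fixed point problem for the contraction
    [T]. *)
Lemma local_inverse (h : 'rV[R]_n -> 'rV[R]_n) :
  (forall x, U x -> differentiable h x) ->
  (forall i x, U x -> differentiable (partial i h) x) ->
  frame h x0 \in unitmx ->
  exists r C e : R, [/\ 0 < r, 0 < C, 0 < e, (forall z, `|z - x0| <= r -> U z) &
    (forall x y, `|x - x0| <= r -> `|y - x0| <= r -> `|x - y| <= C * `|h x - h y|) /\
    (forall w, `|w - h x0| < e -> exists2 x, `|x - x0| < r & h x = w)].
Proof.
move=> dh ddh hu; set B := invmx (frame h x0).
pose g z := h z *m B.
have dc k l (D : 'M[R]_(k, l)) x : differentiable (fun _ : 'rV[R]_n => D) x by exact: differentiable_cst.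
have dg x : U x -> differentiable g x by move=> Ux; apply: differentiable_mulmx => //; exact: dh.
have pg i x : U x -> partial i g x = partial i h x *m B.
  by move=> Ux; have [] := is_derive_mulmxr B (is_derive_partial i (dh x Ux)).
have ddg i x : U x -> differentiable (partial i g) x.
  move=> Ux; apply: (@near_eq_differentiable _ _ _ (fun z => partial i h z *m B)).
    by apply: filterS (near_dom oU Ux) => z Uz; rewrite pg.
  by apply: differentiable_mulmx => //; exact: ddh.
have g1 : frame g x0 = 1%:M.
  rewrite -(mulmxV hu); apply/row_matrixP => i; rewrite row_mul !rowK; exact: pg.
have [r r0 [rU hr]] := near_identity dg ddg g1.
have [C C0 hC] := mulmx_bound B.
have lip x y : `|x - x0| <= r -> `|y - x0| <= r -> `|x - y| <= 2 * `|g x - g y|.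
  move=> xr yr; have := hr x y xr yr.
  have : `|x - y| <= `|g x - g y| + `|(g x - x) - (g y - y)|.
    have -> : x - y = (g x - g y) - ((g x - x) - (g y - y)).
      by apply/rowP => j; rewrite !mxE; ring.
    exact: ler_normB.
  have b (p q s : R) : p <= q + s -> s <= 2^-1 * p -> p <= 2 * q by move=> *; lra.
  exact: b.
have gC x y : `|g x - g y| <= C * `|h x - h y| by rewrite /g -mulmxBl; exact: hC.
(* The last value makes the target move by at most r / 4: then [T] preserves the closed ball, as r /
   2 + r / 4 <= r, and the solution is interior, as 2 (r / 4) < r. *)
exists r, (2 * C), (r / (4 * C)); split => //; try by rewrite ?divr_gt0 ?mulr_gt0.
split=> [x y xr yr|w we].
  by apply: le_trans (lip x y xr yr) _; rewrite -mulrA ler_pM2l.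
pose S := [set z : 'rV[R]_n | `|z - x0| <= r].
pose T z := z - g z + w *m B.
have Sx0 : S x0 by rewrite /S /= subrr normr0 ltW.
have wB : `|w *m B - g x0| <= r / 4.
  rewrite /g -mulmxBl; apply: le_trans (hC _) _.
  have b (p q : R) : 0 < p -> q < r / (4 * p) -> p * q <= r / 4.
    by move=> p0; rewrite ltr_pdivlMr ?mulr_gt0 // => h1; nra.
  exact: b.
have TS : {homo T : z / S z >-> S z}.
  move=> z zS; rewrite /S /= /T.
  have -> : z - g z + w *m B - x0 = - ((g z - z) - (g x0 - x0)) + (w *m B - g x0).
    by apply/rowP => j; rewrite !mxE; ring.
  apply: le_trans (ler_normD _ _) _; rewrite normrN.
  have h1 := hr z x0 zS Sx0.
  have b (p q s : R) : p <= 2^-1 * q -> q <= r -> s <= r / 4 -> 0 < r -> p + s <= r by move=> *; lra.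
  exact: b h1 zS wB r0.
have cd : {within S, continuous (fun z => `|w *m B - g z|)}.
  apply: continuous_in_subspaceT => z; rewrite inE => zS.
  have dgz : differentiable (fun z => w *m B - g z) z.
    by apply: differentiableB; [exact: dc|apply: dg; exact: rU].
  by apply: (continuous_comp (differentiable_continuous dgz)); exact: norm_continuous.
(* A contraction has no displacement where its displacement is minimal. *)
have [x xS mn] := compact_EVT_min (ex_intro _ x0 Sx0) (compact_norm_ball (y := x0) (s := r)) cd.
rewrite inE in xS.
have gx : g x = w *m B.
  have /mn : T x \in S by rewrite inE; exact: TS.
  have -> : w *m B - g (T x) = - ((g (T x) - T x) - (g x - x)).
    by apply/rowP => j; rewrite !mxE; ring.
  rewrite normrN; have := hr (T x) x (TS _ xS) xS.
  have -> : T x - x = w *m B - g x by apply/rowP => j; rewrite !mxE; ring.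
  move=> h1 h2; apply/esym/eqP; rewrite -subr_eq0 -normr_le0.
  have b (p q : R) : q <= 2^-1 * p -> p <= q -> p <= 0 by move=> *; lra.
  exact: b h1 h2.
exists x.
  have := lip x x0 xS Sx0; rewrite gx => h1.
  have b (p s : R) : p <= 2 * s -> s <= r / 4 -> 0 < r -> p < r by move=> *; lra.
  exact: b h1 wB r0.
have Bu : B \in unitmx by rewrite unitmx_inv.
by apply: (can_inj (mulmxK Bu)).
Qed.
End InverseFunction.

(** On the open half circle where the cosine relative to (x0, y0) is positive, the sine determines
    the point. *)
Lemma circle_eq (R : realType) (x0 y0 x y x' y' : R) :
  x0 ^+ 2 + y0 ^+ 2 = 1 -> x ^+ 2 + y ^+ 2 = 1 -> x' ^+ 2 + y' ^+ 2 = 1 ->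
  x0 * y - y0 * x = x0 * y' - y0 * x' ->
  0 < x0 * x + y0 * y -> 0 < x0 * x' + y0 * y' -> x = x' /\ y = y'.
Proof.
move=> h0 h h' ek t0 t0'.
have k2 (a b : R) : a ^+ 2 + b ^+ 2 = 1 -> (x0 * a + y0 * b) ^+ 2 = 1 - (x0 * b - y0 * a) ^+ 2.
  move=> e; have -> : 1 = (x0 ^+ 2 + y0 ^+ 2) * (a ^+ 2 + b ^+ 2) by rewrite h0 e mulr1.
  ring.
have et : x0 * x + y0 * y = x0 * x' + y0 * y'.
  have : (x0 * x + y0 * y) ^+ 2 = (x0 * x' + y0 * y') ^+ 2 by rewrite !k2 // ek.
  by move/eqP; rewrite eqrXn2 // ?ltW // => /eqP.
have ex (a b : R) : a = x0 * (x0 * a + y0 * b) - y0 * (x0 * b - y0 * a).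
  by rewrite -{1}[a]mul1r -h0; ring.
have ey (a b : R) : b = y0 * (x0 * a + y0 * b) + x0 * (x0 * b - y0 * a).
  by rewrite -{1}[b]mul1r -h0; ring.
by split; [rewrite (ex x y) (ex x' y') et ek|rewrite (ey x y) (ey x' y') et ek].
Qed.

Lemma near_forall_lt (R : realType) n m (g : 'rV[R]_n -> 'rV[R]_m) x :
  {for x, continuous g} -> (forall j, 0 < g x 0 j) -> \forall y \near x, forall j, 0 < g y 0 j.
Proof.
move=> cg g0.
have h j : \forall y \near x, 0 < g y 0 j.
  have ce : {for g x, continuous (fun z : 'rV[R]_m => z 0 j)}.
    by apply: differentiable_continuous; apply: differentiable_entry; exact: ex_diff.
  have := continuous_comp cg ce; rewrite /continuous_at => /cvgr_gt; apply; exact: g0.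
exact: (@filter_forall _ _ (fun j y => 0 < g y 0 j) _ _ h).
Qed.

Lemma continuous_mulmxr (R : realType) n m (K : 'M[R]_(n, m)) (x : 'rV[R]_n) :
  {for x, continuous (fun z : 'rV[R]_n => z *m K)}.
Proof.
apply: differentiable_continuous; apply: differentiable_mulmx; last exact: differentiable_cst.
exact: ex_diff.
Qed.

(** * Local sections of an immersion into the product of circles *)

Section LocalSections.
Context {R : realType} {n : nat} {M : topologicalType}.
Variables (A : smooth_atlas R n M) (q : M -> 'rV[R]_(n + n)).
Hypothesis imm : immersion A q.
Hypothesis qT : forall p, product_of_circles (q p).
Local Notation U c := (chart_map c @` chart_dom c).
Local Notation f c := (q \o chart_inv c).

(* Componentwise, [w *m sine_mx z] and [w *m cosine_mx z] are the imaginary and real parts of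
   w_j times the conjugate of z_j. *)
Definition sine_mx (z : 'rV[R]_(n + n)) : 'M[R]_(n + n, n) :=
  col_mx (- diag_mx (rsubmx z)) (diag_mx (lsubmx z)).
Definition cosine_mx (z : 'rV[R]_(n + n)) : 'M[R]_(n + n, n) :=
  col_mx (diag_mx (lsubmx z)) (diag_mx (rsubmx z)).

Lemma sine_mxE (z w : 'rV[R]_(n + n)) j : (w *m sine_mx z) 0 j
  = lsubmx z 0 j * rsubmx w 0 j - rsubmx z 0 j * lsubmx w 0 j.
Proof.
rewrite -[w in LHS]hsubmxK mul_row_col mulmxN !mul_mx_diag [LHS]mxE [X in X + _]mxE.
by rewrite [X in - X + _]mxE [X in _ + X]mxE addrC [rsubmx w _ _ * _]mulrC [lsubmx w _ _ * _]mulrC.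
Qed.

Lemma cosine_mxE (z w : 'rV[R]_(n + n)) j : (w *m cosine_mx z) 0 j
  = lsubmx z 0 j * lsubmx w 0 j + rsubmx z 0 j * rsubmx w 0 j.
Proof.
rewrite -[w in LHS]hsubmxK mul_row_col !mul_mx_diag [LHS]mxE [X in X + _]mxE.
by rewrite [X in _ + X]mxE [rsubmx w _ _ * _]mulrC [lsubmx w _ _ * _]mulrC.
Qed.

Lemma circles_tangent c x : charts A c -> U c x -> frame (f c) x *m cosine_mx (f c x) = 0.
Proof.
move=> Ac Ux; apply/row_matrixP => i; rewrite row_mul rowK row0; apply/rowP => j.
rewrite cosine_mxE [RHS]mxE.
have df := is_derive_partial i (smooth0 (imm.1 c Ac) Ux).
have dl := is_derive_entry 0 (lshift n j) df; have dr := is_derive_entry 0 (rshift n j) df.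
have h := is_deriveD (is_deriveM dl dl) (is_deriveM dr dr).
have h0 : is_derive x (delta_mx 0 i : 'rV[R]_n) (cst (1 : R)) 0 by exact: is_derive_cst.
have := is_derive_unique (@chart_cod_open _ _ _ c) Ux h h0 _.
have e y : ((fun y => f c y 0 (lshift n j)) * (fun y => f c y 0 (lshift n j))
    + (fun y => f c y 0 (rshift n j)) * (fun y => f c y 0 (rshift n j))) y = cst 1 y.
  by have := qT (chart_inv c y) j; rewrite !mxE !expr2.
move=> /(_ (fun y _ => e y)); rewrite !mxE /= => h1.
have b (a a' d d' : R) : a *: a' + a *: a' + (d *: d' + d *: d') = 0 -> a * a' + d * d' = 0.
  by rewrite /GRing.scale /= => *; lra.
exact: b h1.
Qed.

(** A tangent vector is killed by the cosines, as the moduli are constant; a vector killed by both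
    sines and cosines is zero, so an immersion stays immersive when only the sines are kept. *)
Lemma sine_chart_unit c x : charts A c -> U c x ->
  frame (f c) x *m sine_mx (f c x) \in unitmx.
Proof.
move=> Ac Ux; rewrite -row_free_unit -kermx_eq0; apply/rowV0P => v /sub_kermxP.
rewrite mulmxA => e1.
have e2 : v *m frame (f c) x *m cosine_mx (f c x) = 0 by rewrite -mulmxA circles_tangent // mulmx0.
have ff : row_free (frame (f c) x).
  by case: Ux => p cp <-; exact: imm.2.
apply: (row_free_inj ff); rewrite mul0mx; move: (v *m frame (f c) x) e1 e2 => u e1 e2.
have hz := qT (chart_inv c x).
have a (z w : 'rV[R]_(n + n)) : product_of_circles z -> w *m sine_mx z = 0 -> w *m cosine_mx z = 0 -> w = 0.
  move=> zT s0 c0; rewrite -[w]hsubmxK.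
  have [lw rw] : lsubmx w = 0 /\ rsubmx w = 0.
    have z0 j : (0 : 'rV[R]_n) 0 j = 0 by rewrite mxE.
    have hj j : lsubmx w 0 j = 0 /\ rsubmx w 0 j = 0.
      have := zT j; have := sine_mxE z w j; have := cosine_mxE z w j; rewrite s0 c0 z0.
      have b (p r s t : R) : 0 = p * s + r * t -> 0 = p * t - r * s -> p ^+ 2 + r ^+ 2 = 1 -> s = 0 /\ t = 0.
        move=> h1 h2 h3; split.
          by rewrite -[s]mul1r -h3; transitivity (p * (p * s + r * t) - r * (p * t - r * s)); [ring|rewrite -h1 -h2; ring].
        by rewrite -[t]mul1r -h3; transitivity (r * (p * s + r * t) + p * (p * t - r * s)); [ring|rewrite -h1 -h2; ring].
      exact: b.
    by split; apply/rowP => j; rewrite [RHS]mxE; have [] := hj j.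
  by rewrite lw rw row_mx0.
exact: a hz e1 e2.
Qed.

(** The sines relative to [q p] are coordinates on the part of the torus with positive cosines, and
    [q] read in them has a local inverse. The section is defined on an ambient open set [V], through
    the sines of an arbitrary z, and inverts [q] on the torus only. *)
Lemma local_section p : exists (W : set M) (V : set 'rV[R]_(n + n)) (s : 'rV[R]_(n + n) -> M),
  [/\ open W, W p, open V, V (q p) &
   [/\ forall a b, W a -> W b -> q a = q b -> a = b,
       forall z, V z -> product_of_circles z -> W (s z) /\ q (s z) = z &
       forall z, V z -> {for z, continuous s}]].
Proof.
have [c Ac cp] := charts_cover A p.
have Ux : U c (chart_map c p) by exists p.
set x0 := chart_map c p in Ux *.
have fx0 : f c x0 = q p by rewrite /= chart_mapK.
have sf := imm.1 c Ac.
have cf x : U c x -> {for x, continuous (f c)}.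
  by move=> Uy; apply: differentiable_continuous; exact: (smooth0 sf).
pose S := sine_mx (q p); pose T := cosine_mx (q p).
pose U' := [set x | U c x /\ forall j, 0 < (f c x *m T) 0 j].
have T0 : forall j, 0 < (q p *m T) 0 j.
  by move=> j; rewrite cosine_mxE -!expr2 (qT p j).
have nearT (z : 'rV[R]_(n + n)) : (forall j, 0 < (z *m T) 0 j) -> \forall y \near z, forall j, 0 < (y *m T) 0 j.
  by apply: near_forall_lt; exact: continuous_mulmxr.
have oU' : open U'.
  rewrite openE => x [Uy hy]; apply: filterI.
    by apply: near_dom => //; exact: chart_cod_open.
  exact: (cf x Uy _ (nearT _ hy)).
have U'x0 : U' x0 by split => //; rewrite fx0.
pose h x := f c x *m S.
have dh x : U' x -> differentiable h x.
  by move=> [Uy _]; apply: differentiable_mulmx; [exact: (smooth0 sf)|exact: differentiable_cst].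
have ph i x : U' x -> partial i h x = partial i (f c) x *m S.
  by move=> [Uy _]; have [] := is_derive_mulmxr S (is_derive_partial i (smooth0 sf Uy)).
have ddh i x : U' x -> differentiable (partial i h) x.
  move=> U'y; apply: (@near_eq_differentiable _ _ _ (fun z => partial i (f c) z *m S)).
    by apply: filterS (near_dom oU' U'y) => z Uz; rewrite ph.
  apply: differentiable_mulmx; last exact: differentiable_cst.
  by case: U'y => Uy _; exact: (smooth1 sf).
have hu : frame h x0 \in unitmx.
  have -> : frame h x0 = frame (f c) x0 *m sine_mx (f c x0).
    apply/row_matrixP => i; rewrite row_mul !rowK fx0; exact: ph.
  exact: sine_chart_unit.
have [r [C [e [r0 C0 e0 rU [lip sur]]]]] := local_inverse oU' U'x0 dh ddh hu.
(* A total inverse is needed for the choice; away from the ball its value is an arbitrary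
   default. *)
have ch (w : 'rV[R]_n) : exists x : 'rV[R]_n, `|w - h x0| < e -> `|x - x0| < r /\ h x = w.
  have [we|we] := pselect (`|w - h x0| < e); last by exists w.
  by have [x xr hx] := sur w we; exists x.
have [g hg] := choice ch.
pose W := [set p' | chart_dom c p' /\ `|chart_map c p' - x0| < r].
pose V := [set z : 'rV[R]_(n + n) | `|z *m S - h x0| < e /\ forall j, 0 < (z *m T) 0 j].
exists W, V, (fun z => chart_inv c (g (z *m S))); split.
- rewrite openE => p' [cp' p'r].
  apply: (chart_near (B := [set x | `|x - x0| < r]) cp').
  have := @continuous_norm_sub R n x0 (chart_map c p') => /cvgr_lt; exact.
- by split => //; rewrite subrr normr0.
- rewrite openE => z [zV zT]; apply: filterI; last exact: nearT.
  have cS := continuous_comp (@continuous_mulmxr R (n + n) n S z) (@continuous_norm_sub R n (h x0) (z *m S)).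
  by have := cS => /cvgr_lt; exact.
- by split => //; rewrite /h fx0 subrr normr0.
split=> [a b [ca ar] [cb br] qab|z [zV zt] zT|z [zV _]].
- rewrite -(chart_mapK ca) -(chart_mapK cb); congr (chart_inv c _).
  have := lip _ _ (ltW ar) (ltW br); rewrite /h /= !chart_mapK // qab subrr normr0 mulr0.
  by rewrite normr_le0 subr_eq0 => /eqP.
- have [gr hgz] := hg _ zV; set x := g _ in gr hgz *.
  have [[p' cp' p'x] xT] := rU _ (ltW gr).
  have ip : chart_inv c x = p' by rewrite -p'x chart_mapK.
  split; first by rewrite ip; split => //; rewrite p'x.
  have fx : f c x = q p' by rewrite /= ip.
  rewrite ip.
  have st j : lsubmx (q p') 0 j = lsubmx z 0 j /\ rsubmx (q p') 0 j = rsubmx z 0 j.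
    apply: circle_eq (qT p j) (qT p' j) (zT j) _ _ _.
    + by rewrite -!sine_mxE -hgz /h fx.
    + by have := xT j; rewrite fx cosine_mxE.
    + by have := zt j; rewrite cosine_mxE.
  rewrite -[LHS]hsubmxK -[RHS]hsubmxK; congr row_mx; apply/rowP => j; by have [] := st j.
- have [gr hgz] := hg _ zV.
  have [[p' cp' p'x] xT] := rU _ (ltW gr).
  move=> B; rewrite -p'x chart_mapK // => nB.
  have := chart_inv_near cp' nB; rewrite p'x => nB'.
  (* Continuity of the inverse comes from the Lipschitz estimate [lip]. *)
  have cg : {for z *m S, continuous g}.
    move=> D /nbhs_ballP[eps /= eps0 hD].
    have n1 : \forall w \near z *m S, `|w - h x0| < e.
      by have := @continuous_norm_sub R n (h x0) (z *m S) => /cvgr_lt; exact.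
    have n2 := @near_norm_sub R n (z *m S) (eps / C) (divr_gt0 eps0 C0).
    apply: filterS2 n1 n2 => w w1 w2.
    have [gw hw] := hg _ w1; apply: hD; rewrite -ball_normE /ball_ /=.
    apply: le_lt_trans (lip _ _ (ltW gr) (ltW gw)) _.
    by rewrite hgz hw mulrC -ltr_pdivlMr // distrC.
  have nz : nbhs z (fun y => U c (g (y *m S)) /\ B (chart_inv c (g (y *m S)))).
    exact: (continuous_comp (@continuous_mulmxr R (n + n) n S z) cg nB').
  suff : nbhs z (fun y => B (chart_inv c (g (y *m S)))) by [].
  by apply: filterS nz => y [].
Qed.
End LocalSections.

Lemma circle_angle (R : realType) (x y : R) : x ^+ 2 + y ^+ 2 = 1 ->
  exists t : R, cos t = x /\ sin t = y.
Proof.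
move=> e; have x1 : -1 <= x <= 1.
  have : x ^+ 2 <= 1 by rewrite -e lerDl sqr_ge0.
  by move=> h; apply/andP; split; nra.
have ey : Num.sqrt (1 - x ^+ 2) = `|y| by rewrite -e addrC addKr sqrtr_sqr.
have [y0|y0] := leP 0 y.
  by exists (acos x); rewrite acosK ?in_itv // sin_acos ?in_itv //= ey ger0_norm.
by exists (- acos x); rewrite cosN sinN acosK ?in_itv // sin_acos ?in_itv //= ey ltr0_norm // opprK.
Qed.

(** * An immersion of a closed manifold into the torus is a covering *)

Section TorusCovering.
Context {R : realType} {n : nat} {M : topologicalType}.
Variables (A : smooth_atlas R n M) (q : M -> 'rV[R]_(n + n)).
Hypothesis hM : closed_manifold A.
Hypothesis imm : immersion A q.
Hypothesis qT : forall p, product_of_circles (q p).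
Local Notation T := (@product_of_circles R n).

Let cq : continuous q := phi_continuous imm.

Lemma image_compact_closed (K : set M) : closed K -> closed (q @` K).
Proof.
move=> cK; have [_ cM _ _] := hM.
apply: compact_closed; first exact: norm_hausdorff.
apply: continuous_compact; first exact: continuous_subspaceT.
exact: subclosed_compact cK cM _.
Qed.

(** The real form of the path whose j-th coordinate is z_j exp(i th_j t); it stays on the torus. *)
Definition rotation_path (z0 : 'rV[R]_(n + n)) (th : 'I_n -> R) (t : R) : 'rV[R]_(n + n) :=
  row_mx (\row_j (lsubmx z0 0 j * cos (th j * t) - rsubmx z0 0 j * sin (th j * t)))
         (\row_j (lsubmx z0 0 j * sin (th j * t) + rsubmx z0 0 j * cos (th j * t))).

Lemma rotation_path_continuous z0 th : continuous (rotation_path z0 th).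
Proof.
move=> t; apply: differentiable_continuous; apply: differentiable_mx => i a.
have dl j : differentiable (fun s : R => th j * s) t by apply: differentiableZ; exact: ex_diff.
have dc j : differentiable (fun s : R => cos (th j * s)) t.
  apply: (@differentiable_comp _ _ _ _ (fun s : R => th j * s) cos) => //.
  by apply/derivable1_diffP; exact: ex_derive.
have ds j : differentiable (fun s : R => sin (th j * s)) t.
  apply: (@differentiable_comp _ _ _ _ (fun s : R => th j * s) sin) => //.
  by apply/derivable1_diffP; exact: ex_derive.
rewrite -[a]splitK; case: (fintype.split a) => j /=.
  have -> : (fun y => rotation_path z0 th y i (lshift n j)) =
      (fun y => lsubmx z0 0 j * cos (th j * y) - rsubmx z0 0 j * sin (th j * y)).
    by apply/funext => y; rewrite /rotation_path row_mxEl mxE.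
  by apply: differentiableB; apply: differentiableZ.
have -> : (fun y => rotation_path z0 th y i (rshift n j)) =
    (fun y => lsubmx z0 0 j * sin (th j * y) + rsubmx z0 0 j * cos (th j * y)).
  by apply/funext => y; rewrite /rotation_path row_mxEr mxE.
by apply: differentiableD; apply: differentiableZ.
Qed.

(** Any point of the torus is joined to a point of the image by a rotation path. The times at which
    the path lies in the image form a clopen set: closed by compactness of the manifold, open by the
    local sections. *)
Lemma circles_surjective : q @` [set: M] = T.
Proof.
apply/seteqP; split => [_ [p _ <-]|z zT]; first exact: qT.
have [_ cM _ [p0 _]] := hM.
have ang (j : 'I_n) : exists t : R, cos t = lsubmx (q p0) 0 j * lsubmx z 0 j + rsubmx (q p0) 0 j * rsubmx z 0 j
    /\ sin t = lsubmx (q p0) 0 j * rsubmx z 0 j - rsubmx (q p0) 0 j * lsubmx z 0 j.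
  apply: circle_angle; rewrite -[RHS](mulr1 1) -{1}(qT p0 j) -(zT j); ring.
have [th hth] := choice ang.
pose g := rotation_path (q p0) th.
have gT t : T (g t).
  move=> j; rewrite /g /rotation_path row_mxKl row_mxKr (mxE _ _ 0 j) [X in _ + X ^+ 2]mxE.
  have := cos2Dsin2 (th j * t); have := qT p0 j.
  move: (lsubmx _ _ _) (rsubmx _ _ _) (cos _) (sin _) => a b C S e1 e2.
  by transitivity ((a ^+ 2 + b ^+ 2) * (C ^+ 2 + S ^+ 2)); [ring|rewrite e1 e2 mulr1].
have g0 : g 0 = q p0.
  rewrite -[RHS]hsubmxK /g /rotation_path; congr row_mx; apply/rowP => j;
  by rewrite mxE mulr0 cos0 sin0 !mulr1 !mulr0 ?subr0 ?add0r.
have g1 : g 1 = z.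
  rewrite -[RHS]hsubmxK /g /rotation_path; congr row_mx; apply/rowP => j;
  rewrite mxE mulr1 (hth j).1 (hth j).2; have := qT p0 j;
  set a := lsubmx (q p0) _ _; set b := rsubmx (q p0) _ _ => e1.
    by rewrite -[RHS]mul1r -e1; ring.
  by rewrite -[RHS]mul1r -e1; ring.
pose S := [set t : R | (q @` [set: M]) (g t)].
suff ST : S = [set: R] by rewrite -g1; have : S 1 by rewrite ST.
apply: (clopen_setT (p := 0)).
- by apply/connected_intervalP.
- by rewrite /S /= g0; exists p0.
- move=> t [p _ pt]; have [W [V [s [_ _ oV Vp [_ hs _]]]]] := local_section imm qT p.
  have : nbhs (g t) V by rewrite -pt; exact: open_nbhs_nbhs.
  move=> nV; have nV' : nbhs t (fun t' => V (g t')) by exact: (rotation_path_continuous nV).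
  apply: filterS nV' => t' Vt'.
  by exists (s (g t')) => //; have [] := hs _ Vt' (gT t').
apply: (@preimage_closed _ _ g (q @` [set: M])) => [t _|]; first exact: rotation_path_continuous.
exact: image_compact_closed closedT.
Qed.

Lemma near_all_seq (I : eqType) (X : topologicalType) (x : X) (s : seq I) (P : I -> X -> Prop) :
  (forall i, i \in s -> \forall y \near x, P i y) -> \forall y \near x, forall i, i \in s -> P i y.
Proof.
elim: s => [|a s IH] h; first by apply: filterE => y i; rewrite in_nil.
have h1 := h a (mem_head a s); have h2 := IH (fun i hi => h i (mem_behead (s := a :: s) hi)).
by apply: filterS2 h1 h2 => y ya ys i; rewrite in_cons => /orP[/eqP ->|/ys].
Qed.

(** A local homeomorphism from a compact space has finite fibres. The sheets over a small [V] are
    the injectivity neighborhoods [Ws p] of the fibre points, cut down to the preimage of [V]. *)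
Lemma torus_covering : covering_map_onto T q.
Proof.
split; [exact: cq|exact: circles_surjective|move=> y Ty].
have [hsM cM _ _] := hM.
have [Ws hW] := choice (local_section imm qT).
have [Vs hV] := choice hW.
have [ss hs] := choice hV.
have clF : closed [set p | q p = y].
  apply: (@preimage_closed _ _ q [set y]) => [p _|]; first exact: cq.
  exact: accessible_closed_set1 (hausdorff_accessible (@norm_hausdorff _ _)) y.
have cF : compact [set p | q p = y] by apply: subclosed_compact clF cM _.
have [D DF FD] : exists2 D : seq M, (forall p, p \in D -> q p = y) & (forall p, q p = y -> p \in D).
  (* [M] is not pointed, so the cover form of compactness is not available; instead use the filter
     of the finite sets containing a given one. *)
  pose Fl := filter_from [set: seq M] (fun D0 : seq M => [set D : seq M | {subset D0 <= D}]).
  have FF : Filter Fl.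
    apply: filter_from_filter; first by exists [::].
    by move=> D1 D2 _ _; exists (D1 ++ D2) => // D hD; split => p hp; apply: hD; rewrite mem_cat hp ?orbT.
  have ncF : near_covering [set p | q p = y] by apply/compact_near_coveringP.
  have [|D0 _ hD] := ncF _ Fl (fun D p => q p = y -> p \in D) FF.
    move=> p /= py; have [oW Wp _ _ [inj _ _]] := hs p.
    exists (Ws p, [set D : seq M | p \in D]); first split.
    - exact: open_nbhs_nbhs.
    - by exists [:: p] => // D hD; apply: hD; rewrite mem_head.
    - by move=> [p' D] [/= Wp' pD] p'y; rewrite (inj p' p Wp' Wp) ?p'y.
  exists [seq p <- D0 | q p == y] => p; first by rewrite mem_filter => /andP[/eqP].
  by move=> py; rewrite mem_filter py eqxx; apply: (hD D0).
pose Om := \bigcup_(p in [set p | q p = y]) Ws p.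
have oOm : open Om by apply: bigcup_open => p _; have [] := hs p.
have n1 : \forall z \near y, forall p, p \in D -> Vs p z.
  apply: near_all_seq => p /DF py; have [_ _ oV Vp _] := hs p.
  by rewrite -py; exact: open_nbhs_nbhs.
(* The complement of the union [Om] has a closed image that misses [y]; avoiding it confines the
   preimage of [V] to the sheets. *)
have n2 : \forall z \near y, ~ (q @` (~` Om)) z.
  have cl : closed (q @` (~` Om)) by apply: image_compact_closed; exact: open_closedC.
  apply: (@open_nbhs_nbhs _ y (~` (q @` (~` Om)))); split; first exact: closed_openC.
  by move=> [p pO py]; apply: pO; exists p => //; have [] := hs p.
(* By the Hausdorff property, sections through different fibre points stay different near [y]; this
   makes the sheets disjoint. *)
have n3 : \forall z \near y, forall ab, ab \in [seq (a, b) | a <- D, b <- D] ->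
    ab.1 != ab.2 -> ss ab.1 z != ss ab.2 z.
  apply: near_all_seq => -[a b] /allpairsP[[a' b'] /= [aD bD [-> ->]]].
  have [->|ab] := eqVneq a' b'; first by apply: filterE => z; rewrite eqxx.
  have ha := DF _ aD; have hb := DF _ bD.
  have [_ Wa oVa Va [inja sa ca]] := hs a'; have [_ Wb oVb Vb [injb sb cb]] := hs b'.
  rewrite ha in Va; rewrite hb in Vb.
  have ea : ss a' y = a'.
    by have [w1 w2] := sa y Va Ty; apply: inja => //; rewrite w2 ha.
  have eb : ss b' y = b'.
    by have [w1 w2] := sb y Vb Ty; apply: injb => //; rewrite w2 hb.
  have OH := hsM; rewrite open_hausdorff in OH.
  have [[N1 N2] /= [aO bO] [oN1 oN2 /eqP N12]] := OH a' b' ab.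
  rewrite inE in aO; rewrite inE in bO.
  have m1 : \forall z \near y, N1 (ss a' z).
    by apply: (ca y Va); rewrite ea; exact: open_nbhs_nbhs.
  have m2 : \forall z \near y, N2 (ss b' z).
    by apply: (cb y Vb); rewrite eb; exact: open_nbhs_nbhs.
  apply: filterS2 m1 m2 => z z1 z2 _; apply/eqP => e.
  have : (N1 `&` N2) (ss a' z) by split => //; rewrite e.
  by rewrite N12.
have : nbhs y (fun z => (forall p, p \in D -> Vs p z) /\ ~ (q @` (~` Om)) z /\
    forall ab, ab \in [seq (a, b) | a <- D, b <- D] -> ab.1 != ab.2 -> ss ab.1 z != ss ab.2 z).
  by apply: filterI => //; exact: filterI.
rewrite nbhsE => -[V [oV Vy] hVV].
exists V; split => //.
exists {p | q p = y}, (fun i => Ws (sval i) `&` q @^-1` V).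
have WE (i : {p | q p = y}) a : Ws (sval i) a -> V (q a) -> ss (sval i) (q a) = a.
  move=> Wa Va; have [_ _ _ _ [inj sec _]] := hs (sval i).
  have [Vi _] := hVV _ Va.
  have [w1 w2] := sec (q a) (Vi _ (FD _ (svalP i))) (qT a).
  exact: inj.
split.
- move=> i; apply: openI; first by have [] := hs (sval i).
  by apply: open_comp => // p _; exact: cq.
- move=> i j _ _ [a [[Wi Va] [Wj _]]].
  have [_ [_ dis]] := hVV _ Va.
  have ei := WE i a Wi Va; have ej := WE j a Wj Va.
  case: (eqVneq (sval i) (sval j)) => [e|ne].
    by apply: eq_sig_hprop => // p; exact: Prop_irrelevance.
  have pD : (sval i, sval j) \in [seq (a, b) | a <- D, b <- D].
    by apply/allpairsP; exists (sval i, sval j); split => //; apply: FD; [exact: (svalP i)|exact: (svalP j)].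
  by have := dis _ pD ne; rewrite /= ei ej eqxx.
- apply/seteqP; split => [a Va|a [i _ [_ Va]]] //.
  have [_ [nO _]] := hVV _ Va.
  have [p py Wp] : Om a.
    by apply: contrapT => na; apply: nO; exists a.
  by exists (exist _ p py).
move=> i; exists (ss (sval i)); have [_ _ _ _ [inj sec cs]] := hs (sval i).
have Vi z : V z -> Vs (sval i) z by move=> /hVV[h _]; apply: h; apply: FD; exact: (svalP i).
split.
- apply: continuous_in_subspaceT => z; rewrite inE => -[Vz _]; exact: cs (Vi z Vz).
- apply/seteqP; split => [_ [z [Vz Tz] <-]|a [Wa Va]].
    by have [w1 w2] := sec z (Vi z Vz) Tz; split => //=; rewrite w2.
  by exists (q a); [split|exact: WE].
- by move=> z [Vz Tz]; have [] := sec z (Vi z Vz) Tz.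
Qed.
End TorusCovering.

(** * Immersions composed with linear isomorphisms, and the classification *)

Lemma foldr_partial_mulmxr (R : realType) n m p (U : set 'rV[R]_n) (f : 'rV[R]_n -> 'rV[R]_m)
    (B : 'M[R]_(m, p)) s x : open U -> smooth_on U f -> U x ->
  foldr partial (fun y => f y *m B) s x = foldr partial f s x *m B.
Proof.
move=> oU sf; elim: s x => [//|i s IH] x Ux /=.
by apply: (partial_eq oU Ux IH); apply: is_derive_mulmxr; apply: is_derive_partial; exact: sf.
Qed.

Lemma smooth_on_mulmxr (R : realType) n m p (U : set 'rV[R]_n) (f : 'rV[R]_n -> 'rV[R]_m)
    (B : 'M[R]_(m, p)) : open U -> smooth_on U f -> smooth_on U (fun y => f y *m B).
Proof.
move=> oU sf s x Ux; apply: (@near_eq_differentiable _ _ _ (fun y => foldr partial f s y *m B)).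
  by apply: filterS (near_dom oU Ux) => y Uy; rewrite (foldr_partial_mulmxr _ _ oU sf Uy).
by apply: differentiable_mulmx; [exact: sf|exact: differentiable_cst].
Qed.

Lemma immersion_mulmxr (R : realType) n m (M : topologicalType) (A : smooth_atlas R n M)
    (phi : M -> 'rV[R]_m) (B : 'M[R]_m) :
  B \in unitmx -> immersion A phi -> immersion A (fun p => phi p *m B).
Proof.
move=> Bu [sphi fphi]; have oU (c : chart R n M) := @chart_cod_open _ _ _ c.
split=> [c Ac|c p Ac cp]; first by
  exact: (@smooth_on_mulmxr R n m m _ (phi \o chart_inv c) B (oU c) (sphi c Ac)).
have Ux : (chart_map c @` chart_dom c) (chart_map c p) by exists p.
have -> : frame ((fun p => phi p *m B) \o chart_inv c) (chart_map c p)
    = frame (phi \o chart_inv c) (chart_map c p) *m B.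
  apply/row_matrixP => i; rewrite row_mul !rowK.
  exact: (foldr_partial_mulmxr B [:: i] (oU c) (sphi c Ac) Ux).
by rewrite /row_free mxrankMfree ?row_free_unit //; exact: fphi.
Qed.

Theorem corollary3p8 (R : realType) (n : nat) (hn : (2 <= n)%N)
    (M : topologicalType) (A : smooth_atlas R n M)
    (hM : closed_manifold A)
    (phi : M -> 'rV[R]_(n + n))
    (himm : immersion A phi)
    (hlag : lagrangian A phi)
    (hsol : imcf_homothetic_soliton A phi)
    (hK : constant_sectional_curvature A phi) :
  exists (rho : R) (U : 'M[R]_(n + n)) (q : M -> 'rV[R]_(n + n)),
    [/\ 0 < rho, unitary_map U,
        covering_map_onto product_of_circles q &
        forall p, phi p = rho *: (q p *m U)].
Proof.
have n0 : (0 < n)%N by apply: leq_trans hn.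
have [N Np [_ hN]] := soliton_spherical n0 hM himm hsol.
have [rho [V [rho0 uV qT phiE]]] := circle_decomposition hM himm hlag hn (lt0r_neq0 Np) hN hK Np.
exists rho, V, (fun p => rho^-1 *: (phi p *m V^T)); split => //.
apply: (torus_covering hM _ qT).
have -> : (fun p => rho^-1 *: (phi p *m V^T)) = (fun p => phi p *m (rho^-1 *: V^T)).
  by apply/funext => p; rewrite -scalemxAr.
apply: immersion_mulmxr => //; rewrite unitmxZ ?unitfE ?invr_eq0 ?lt0r_neq0 // unitmx_tr.
by have [] := mulmx1_unit uV.1.
Qed.
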